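(* Let $X=X(\mathbb R)$ be a Banach lattice satisfying Assumption A, and let $r,s\in\mathbb N$ with $2r\ge s$. Let $(\mathcal G_\sigma)_{\sigma\ge1}$ be linear sampling operators for which there are constants $K_1,K_3>0$ such that for all $\sigma\ge1$ $$\|\mathcal G_\sigma f\|_X\le K_1\|f\|_{X_\sigma}\ \ (f\in X_\sigma),\qquad \|g-\mathcal G_\sigma g\|_X\le K_3\sigma^{-s}\|g^{(s)}\|_X\ \ (g\in\mathcal B_X^\sigma).$$ Then there is $C>0$ independent of $f$ and $\sigma$ such that for all $\sigma\ge1$ and $f\in X_\sigma$ $$\|f-\mathcal G_\sigma f\|_X\le C\left(\|(I-\dot A_{\gamma/\sigma})^sf\|_X+\|(I-A_{\gamma/\sigma})^rf\|_{X_\sigma}\right).$$ If, additionally, $\mathcal G_\sigma:X_\sigma\to\mathcal B_X^\sigma$ for all $\sigma\ge1$, then there is $C>0$ independent of $f$ and $\sigma$ such that for all $\sigma\ge1$ and $f\in X_\sigma$ $$\|f-\mathcal G_\sigma f\|_{X_\sigma}\le C\left(\|(I-\dot A_{\gamma/\sigma})^sf\|_X+\|(I-A_{\gamma/\sigma})^rf\|_{X_\sigma}\right).$$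
   Context: $\mu$ is Lebesgue measure on $\mathbb R$. A Banach lattice $X=X(\mathbb R)$ is a Banach space of measurable functions on $\mathbb R$ such that: 1) if $f$ is measurable, $g\in X$ and $|f|\le|g|$, then $f\in X$ and $\|f\|_X\le\|g\|_X$; 2) if $f_n\in X$, $\sup_n\|f_n\|_X<\infty$ and $0\le f_n\uparrow f$, then $f\in X$ and $\|f_n\|_X\to\|f\|_X$; 3) for every measurable $E$ with $\mu(E)<\infty$, $\chi_E\in X$ and there is $c_E>0$ with $\int_E|f|\,d\mu\le c_E\|f\|_X$. Functions in $X$ are regarded as finite-valued and defined at every point, not as equivalence classes. Standing assumptions (used to ensure convergence of the sampling series when the functions $\varphi_{k,\sigma}$ are not compactly supported): $X$ has an order continuous norm ($f_n\downarrow0$ a.e. implies $\|f_n\|_X\to0$) and the Schwartz space $\mathcal S$ is dense in $X$. Steklov averages: $A_hf(x)=\frac1h\int_{x-h/2}^{x+h/2}f(t)\,dt$ and $\dot A_hf(x)=A_hf(x+\tfrac h2)$ for $h>0$; $I$ is the identity. Assumption A: $A_hf\in X$ for all $f\in X$, $h>0$, and $\sup_{h>0,\,\|f\|_X\le1}\|A_hf\|_X<\infty$. $\mathcal B_X^\sigma=\{g\in X\cap\mathcal S'(\mathbb R):\operatorname{supp}\widehat g\subset[-\sigma,\sigma]\}$ (Fourier transform in the sense of tempered distributions; such band-limited functions are understood as their continuous representatives). $(\Phi_\sigma)_{\sigma>0}$ are nested linear subspaces of $X$ ($\Phi_{\sigma'}\subset\Phi_\sigma$ for $\sigma'\le\sigma$,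 $\Phi_0=\{0\}$) satisfying $\|\varphi^{(q)}\|_X\le(B\sigma)^q\|\varphi\|_X$ for all $q\in\mathbb N$, $\varphi\in\Phi_\sigma$, with a constant $B=B_X>0$. (If $X$ is translation-invariant, spline spaces of smoothness $s$ are also admitted, with this inequality required only for $q\le s$.) Sampling operators: $\mathcal G_\sigma f(x)=\sum_{k\in\mathbb Z}f(x_{k,\sigma})\varphi_{k,\sigma}(x)$, where $\varphi_{k,\sigma}\in\Phi_\sigma$ and $x_k=x_{k,\sigma}\in\mathbb R$ are distinct nodes such that for some fixed $\gamma,\gamma'>0$, $\frac\gamma\sigma\le x_{k+1,\sigma}-x_{k,\sigma}\le\frac{\gamma'}\sigma$ for all $k\in\mathbb Z$; $\gamma$ in the claim is this constant. Put $\|f\|_{X_\sigma}=\big\|\sum_{k\in\mathbb Z}|f(x_k)|\chi_{[x_k,x_{k+1})}\big\|_X$; $f\in X_\sigma$ means $f\in X$ and $\|f\|_{X_\sigma}<\infty$. It is assumed that for all $f\in X_\sigma$ the series defining $\mathcal G_\sigma f$ converges in the norm of $X$. *)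

(* Defs.v *)
From HB Require Import structures.
From mathcomp Require Import all_boot all_order all_algebra.
From mathcomp Require Import complex.
From mathcomp Require Import all_classical all_reals all_analysis.
Set Implicit Arguments.
Unset Strict Implicit.
Unset Printing Implicit Defensive.
Import Order.TTheory GRing.Theory Num.Theory.
Import numFieldNormedType.Exports.
Local Open Scope classical_set_scope.
Local Open Scope ring_scope.
Local Open Scope complex_scope.

Section ComplexFunctions.
Variable R : realType.
Implicit Types (f g : R -> R[i]) (u v : R -> R) (A : set R).

Definition mu : {measure set (measurableTypeR R) -> \bar R} := lebesgue_measure.

Definition absc (z : R[i]) : R := ComplexField.Normc.normc z.

Definition refun f : R -> R := fun x => complex.Re (f x).
Definition imfun f : R -> R := fun x => complex.Im (f x).
Definition ofreal u : R -> R[i] := fun x => (u x)%:C.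

(* [lebesgue_measure] lives on the Borel sigma-algebra; Lebesgue measurability
   is measurability for its completion, i.e. a.e. equality with a Borel
   function. The library's integral of a nonnegative function is the supremum
   of the integrals of the Borel simple functions below it, so it returns the
   Lebesgue integral for such functions too. *)
Definition lmeasurable u :=
  exists2 v : measurableTypeR R -> R,
    measurable_fun setT v & {ae mu, forall x, u x = v x}.

Definition cmeasurable f := lmeasurable (refun f) /\ lmeasurable (imfun f).

Definition cintegral A f : R[i] :=
  (\int[mu]_(x in A) refun f x) +i* (\int[mu]_(x in A) imfun f x).

Definition cderiv (n : nat) f : R -> R[i] :=
  fun x => derive1n n (refun f) x +i* derive1n n (imfun f) x.

Definition ccontinuous f := continuous (refun f) /\ continuous (imfun f).

Definition cdifferentiable (n : nat) f :=
  (forall (k : nat) (x : R), (k < n)%N ->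
    derivable (derive1n k (refun f)) x 1 /\
    derivable (derive1n k (imfun f)) x 1) /\
  ccontinuous (cderiv n f).

Definition csmooth f := forall n : nat, cdifferentiable n f.

Definition steklov (h : R) f : R -> R[i] :=
  fun x => (h^-1)%:C * cintegral `[x - h / 2, x + h / 2] f.
Definition steklov_dot (h : R) f : R -> R[i] := fun x => steklov h f (x + h / 2).

(* (I - T)^r f *)
Definition id_minus_pow (T : (R -> R[i]) -> R -> R[i]) (r : nat) f : R -> R[i] :=
  iter r (fun g => g \- T g) f.

End ComplexFunctions.

Section TemperedDistributions.
Variable R : realType.
Implicit Types (f g p : R -> R[i]) (T : (R -> R[i]) -> R[i]).

Definition schwartz_values (m n : nat) p : set R :=
  range (fun x : R => `|x| ^+ m * absc (cderiv n p x)).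

Definition schwartz p :=
  csmooth p /\ forall m n : nat, has_ubound (schwartz_values m n p).

Definition schwartz_seminorm (m n : nat) p : R := sup (schwartz_values m n p).

Definition csupport p : set R := closure [set x : R | p x != 0].

Definition test_function p := csmooth p /\ compact (csupport p).

Definition fourier p : R -> R[i] := fun xi =>
  cintegral setT (fun x => p x * (cos (xi * x) -i* sin (xi * x))).

(* T is only meaningful on Schwartz functions. *)
Definition tempered_distribution T :=
  (forall (c : R[i]) p q, schwartz p -> schwartz q ->
     T (fun x => c * p x + q x) = c * T p + T q) /\
  exists (C : R) (N : nat), forall p, schwartz p ->
    absc (T p) <= C * \sum_(m < N) \sum_(n < N) schwartz_seminorm m n p.

(* T is the tempered distribution defined by the locally integrable function
   g; it is unique since test functions are dense in the Schwartz space. *)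
Definition represents T g :=
  forall p, test_function p -> T p = cintegral setT (fun x => g x * p x).

(* The support of the Fourier transform of T, defined by duality, is contained
   in [-sigma, sigma]. *)
Definition spectrum_in T (sigma : R) :=
  forall p, test_function p -> csupport p `&` `[- sigma, sigma] = set0 ->
    T (fourier p) = 0.

End TemperedDistributions.

Section BanachLattices.
Variable R : realType.

(* A space of everywhere defined functions; the norm identifies functions that
   agree almost everywhere. *)
Record banach_lattice := BanachLattice {
  bl_carrier :> (R -> R[i]) -> Prop;
  bl_norm : (R -> R[i]) -> R;
  bl_measurable : forall f, bl_carrier f -> cmeasurable f;
  bl_zero : bl_carrier (fun=> 0);
  bl_add : forall f g, bl_carrier f -> bl_carrier g -> bl_carrier (f \+ g);
  bl_scale : forall (c : R[i]) f, bl_carrier f ->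
    bl_carrier (fun x => c * f x);
  bl_norm_ge0 : forall f, bl_carrier f -> 0 <= bl_norm f;
  bl_norm_eq0 : forall f, bl_carrier f -> bl_norm f = 0 ->
    {ae @mu R, forall x, f x = 0};
  bl_norm_add : forall f g, bl_carrier f -> bl_carrier g ->
    bl_norm (f \+ g) <= bl_norm f + bl_norm g;
  bl_norm_scale : forall (c : R[i]) f, bl_carrier f ->
    bl_norm (fun x => c * f x) = absc c * bl_norm f;
  bl_complete : forall F : nat -> R -> R[i],
    (forall n, bl_carrier (F n)) ->
    (forall e : R, 0 < e -> exists N : nat, forall m n : nat,
      (N <= m)%N -> (N <= n)%N -> bl_norm (F m \- F n) < e) ->
    exists2 f, bl_carrier f & bl_norm (F n \- f) @[n --> \oo] --> (0 : R);
  bl_ideal : forall f g, cmeasurable f -> bl_carrier g ->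
    {ae @mu R, forall x, absc (f x) <= absc (g x)} ->
    bl_carrier f /\ bl_norm f <= bl_norm g;
  bl_fatou : forall (F : nat -> R -> R) (f : R -> R) (M : R),
    (forall n, bl_carrier (ofreal (F n))) ->
    (forall n, bl_norm (ofreal (F n)) <= M) ->
    {ae @mu R, forall x, (forall n, 0 <= F n x <= F n.+1 x) /\
      F n x @[n --> \oo] --> f x} ->
    bl_carrier (ofreal f) /\
    bl_norm (ofreal (F n)) @[n --> \oo] --> bl_norm (ofreal f);
  (* Borel sets E suffice: by [bl_ideal], a Lebesgue measurable set is covered
     by a Borel set of the same measure. *)
  bl_local : forall E : set (measurableTypeR R),
    measurable E -> (mu R E < +oo)%E ->
    bl_carrier (ofreal \1_E) /\
    exists2 c : R, 0 < c & forall f, bl_carrier f ->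
      (\int[mu R]_(x in E) (absc (f x))%:E <= (c * bl_norm f)%:E)%E
}.

Variable X : banach_lattice.
Implicit Types (f g : R -> R[i]) (sigma : R) (xs : int -> R).

(* The norm of X, extended by +oo outside X. *)
Definition xnorm f : \bar R :=
  if `[< X f >] then (bl_norm X f)%:E else +oo%E.

Definition order_continuous := forall F : nat -> R -> R,
  (forall n, X (ofreal (F n))) ->
  {ae @mu R, forall x, (forall n, 0 <= F n.+1 x <= F n x) /\
    F n x @[n --> \oo] --> (0 : R)} ->
  bl_norm X (ofreal (F n)) @[n --> \oo] --> (0 : R).

Definition schwartz_dense :=
  (forall p : R -> R[i], schwartz p -> X p) /\
  forall f (e : R), X f -> 0 < e ->
    exists2 p, schwartz p & bl_norm X (f \- p) < e.

Definition assumption_A :=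
  (forall f (h : R), X f -> 0 < h -> X (steklov h f)) /\
  exists M : R, forall f (h : R), X f -> 0 < h -> bl_norm X f <= 1 ->
    bl_norm X (steklov h f) <= M.

Definition bandlimited sigma : set (R -> R[i]) := [set g | X g /\
  ccontinuous g /\
  exists T, [/\ tempered_distribution T, represents T g
              & spectrum_in T sigma]].

Definition translation_invariant := forall f (a : R), X f ->
  X (fun y => f (y + a)) /\ bl_norm X (fun y => f (y + a)) = bl_norm X f.

(* Piecewise polynomials of bounded degree on a common locally finite knot
   sequence, with continuous derivatives up to order s - 1; the s-th derivative
   exists off the knots. *)
Definition spline_space (s : nat) (V : set (R -> R[i])) :=
  exists (d : nat) (t : int -> R),
    (forall k : int, t k < t (k + 1)) /\
    (forall y : R, exists k : int, t k <= y < t (k + 1)) /\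
    forall f, V f ->
      (forall m : nat, (m < s)%N -> cdifferentiable m f) /\
      forall k : int, exists2 p : {poly R[i]}, (size p <= d.+1)%N &
        forall y : R, t k <= y < t (k + 1) -> f y = p.[y%:C].

Definition bernstein (Phi : R -> set (R -> R[i])) (B : R) (q : nat) :=
  forall sigma f, 0 < sigma -> Phi sigma f ->
    (xnorm (cderiv q f) <= ((B * sigma) ^+ q)%:E * xnorm f)%E.

Definition approximation_spaces (s : nat) (Phi : R -> set (R -> R[i])) :=
  [/\ forall sigma, 0 <= sigma -> Phi sigma (fun=> 0) /\
        forall (c : R[i]) f g, Phi sigma f -> Phi sigma g ->
          Phi sigma (fun y => c * f y + g y),
      forall sigma, 0 <= sigma -> Phi sigma `<=` bl_carrier X,
      Phi 0 = [set (fun=> 0)],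
      forall sigma' sigma, 0 <= sigma' -> sigma' <= sigma ->
        Phi sigma' `<=` Phi sigma
    & exists2 B : R, 0 < B &
      ((forall sigma f, 0 < sigma -> Phi sigma f -> csmooth f) /\
       forall q : nat, bernstein Phi B q)
      \/
      [/\ translation_invariant,
          forall sigma, 0 < sigma -> spline_space s (Phi sigma)
        & forall q : nat, (q <= s)%N -> bernstein Phi B q]].

Definition separated_nodes (x : R -> int -> R) (gamma gamma' : R) :=
  forall sigma (k : int), 1 <= sigma ->
    gamma / sigma <= x sigma (k + 1) - x sigma k <= gamma' / sigma.

Definition node_step xs f : R -> R := fun y =>
  \sum_(k \in [set: int]) absc (f (xs k)) * \1_(`[xs k, xs (k + 1)[) y.

Definition xsnorm xs f : \bar R := xnorm (ofreal (node_step xs f)).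

Definition xs_space xs : set (R -> R[i]) :=
  [set f | X f /\ (xsnorm xs f < +oo)%E].

(* Sum over |k| <= n of f(x_k) phi_k, with x_k = xs k *)
Definition sampling_sum xs (phi : int -> R -> R[i]) f (n : nat) : R -> R[i] :=
  fun y => \sum_(j < (2 * n).+1)
    f (xs (j%:Z - n%:Z)) * phi (j%:Z - n%:Z) y.

(* The sampling series is summed in the norm of X, so G f is a function in X
   determined almost everywhere; it is determined everywhere as soon as it is
   required to be continuous, as in [bandlimited]. *)
Definition sampling_operator xs (phi : int -> R -> R[i])
    (G : (R -> R[i]) -> R -> R[i]) :=
  forall f, xs_space xs f -> X (G f) /\
    bl_norm X (sampling_sum xs phi f n \- G f) @[n --> \oo] --> (0 : R).

End BanachLattices.

(* Main.v *)
Require Import Defs.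
From mathcomp Require Import all_boot all_order all_algebra.
From mathcomp Require Import complex.
From mathcomp Require Import all_classical all_reals all_analysis.
From mathcomp Require Import measurable_realfun ring lra zify.
Set Implicit Arguments.
Unset Strict Implicit.
Unset Printing Implicit Defensive.
Import Order.TTheory GRing.Theory Num.Theory.
Import numFieldNormedType.Exports.
Local Open Scope classical_set_scope.
Local Open Scope ring_scope.
Local Open Scope complex_scope.

(* Put h = gamma / sigma, D = I - dotA_h and d = D^s f. The function f is
   compared with a band-limited g = J (W f). After a dilation h = 1, and J is the
   convolution operator with symbol eta = q / (x^2 + q), where q is a smooth bump
   supported in [-gamma, gamma] and equal to 1 near 0. The symbol 1 - m of D
   vanishes at 0 only, and to first order, while 1 - eta vanishes there to second
   order, so one would like to divide. As (1 - eta) / (1 - m) does not decay, write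
   I - J = (I - J) (I - dotA^4) + (I - J) dotA^4: the first term contains the factor
   D, and in the second one (1 - eta) m^4 / (1 - m) is the transform of an
   integrable kernel. Thus I - J = S D. Taking for J W a suitable
   polynomial in J one gets f - g = O d; likewise g^(s) and (I - A)^r g are
   convolutions of d with kernels bounded by a multiple of 1 / (1 + x^2), the
   latter because 1 - a vanishes to second order at 0 and 2 r >= s.

   Hence f - g, h^s g^(s) and (I - A)^r g are dominated pointwise by |d| and its
   average against h^-1 / (1 + (x / h)^2). Such averages are dyadic sums of
   Steklov averages, so Assumption A makes them bounded on X; they vary slowly at
   scale h, so they are also bounded from X to X_sigma. Since
   f - g = (I - A)^r f - (I - A)^r g + A P (f - g) with P a polynomial in A, this
   bounds the X_sigma norm of f - g, and the first claim follows from
   f - G f = (f - g) - G (f - g) + (g - G g). For the second one, g - G f is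
   band-limited, and a reproducing kernel dominates its values by averages of
   itself.

   All Fourier analysis is done with real cosine and sine transforms; inversion
   is reduced by scaling to the constant c0, the integral of (1 - cos x) / x^2,
   whose value is never needed. *)

(** * Integrals over the line *)

Section LineIntegral.
Variable R : realType.
Local Notation mu := (@lebesgue_measure R).
Implicit Types (f g : R -> R) (a b x y : R).

(** Every symbol is written as [poi] times a function with two bounded derivatives. Such symbols
    have transforms dominated by 1 / (1 + x^2), and kernels of this size form an algebra under
    convolution. This bookkeeping explains the fourth power of dotA: m^4 contains [poi] twice,
    dividing by n through |n|^2 = Qn * poi consumes one factor, and the other one is left for
    integrability.

    Two obstacles shape the passage to X. In general X is invariant neither under translations nor
    under dilations, so comparisons stay pointwise until they have been rescaled to h. Moreover f
    only agrees almost everywhere with a Borel function, while X_sigma reads its values at the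
    nodes, a null set. Averages ignore null sets, so (I - A)^r f - f depends on the Borel version
    alone, and the values f(x_k) enter only through (I - A)^r f. The pointwise bound on f - g could
    not be used at the nodes in any case: it contains |d| itself, which does not vary slowly. Hence
    the detour through (I - A)^r (f - g), whose remaining terms are all averages. *)

Definition borel f := measurable_fun [set: measurableTypeR R] (f : measurableTypeR R -> R).
Definition intg f := mu.-integrable setT (EFin \o f).
Definition It f : R := \int[mu]_x f x.

Lemma intg_borel f : intg f -> borel f.
Proof. by move=> /integrableP[/measurable_EFinP]. Qed.

Lemma intg_le f g : borel f -> intg g -> (forall x, `|f x| <= g x) -> intg f.
Proof.
move=> mf ig fg; apply: le_integrable ig => //; first exact/measurable_EFinP.
by move=> x _ /=; rewrite lee_fin (le_trans (fg x)) ?ler_norm.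
Qed.

Lemma intgD f g : intg f -> intg g -> intg (fun x => f x + g x).
Proof. by move=> fi gi; have := integrableD measurableT fi gi. Qed.
Lemma intgB f g : intg f -> intg g -> intg (fun x => f x - g x).
Proof. by move=> fi gi; have := integrableB measurableT fi gi. Qed.
Lemma intgZ c f : intg f -> intg (fun x => c * f x).
Proof. by move=> fi; have := integrableZl measurableT c fi. Qed.
Lemma intg_abs f : intg f -> intg (fun x => `|f x|).
Proof. by move=> fi; have := integrable_abse fi. Qed.
Lemma intg0 : intg (fun=> 0).
Proof. by have := @integrable0 _ _ _ mu setT. Qed.

Lemma ItD f g : intg f -> intg g -> It (fun x => f x + g x) = It f + It g.
Proof. by move=> fi gi; rewrite /It RintegralD. Qed.
Lemma ItB f g : intg f -> intg g -> It (fun x => f x - g x) = It f - It g.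
Proof. by move=> fi gi; rewrite /It RintegralB. Qed.
Lemma ItZ c f : intg f -> It (fun x => c * f x) = c * It f.
Proof. by move=> fi; rewrite /It RintegralZl. Qed.
Lemma ItZr c f : intg f -> It (fun x => f x * c) = It f * c.
Proof. by move=> fi; rewrite /It RintegralZr. Qed.
Lemma ItN f : intg f -> It (fun x => - f x) = - It f.
Proof. by move=> fi; under eq_fun do rewrite -mulN1r; rewrite ItZ// mulN1r. Qed.
Lemma It0 : It (fun=> 0) = 0.
Proof. by rewrite /It /Rintegral integral0. Qed.
Lemma ItE f : intg f -> (\int[mu]_x (f x)%:E)%E = (It f)%:E.
Proof. by move=> fi; rewrite /It /Rintegral fineK//; exact: integrable_fin_num. Qed.
Lemma It_ge0 f : (forall x, 0 <= f x) -> 0 <= It f.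
Proof. by move=> f0; apply: Rintegral_ge0. Qed.
Lemma le_It f g : intg f -> intg g -> (forall x, f x <= g x) -> It f <= It g.
Proof. by move=> fi gi fg; apply: le_Rintegral. Qed.
Lemma It_norm f g : borel f -> intg g -> (forall x, `|f x| <= g x) -> `|It f| <= It g.
Proof.
move=> mf gi fg; have fi := intg_le mf gi fg.
apply: (le_trans (le_normr_Rintegral measurableT fi)).
by apply: le_It => //; exact: intg_abs.
Qed.
Lemma eq_It f g : f =1 g -> It f = It g.
Proof. by move=> /funext ->. Qed.

Lemma borel_cst c : borel (fun=> c). Proof. exact: measurable_cst. Qed.
Lemma borel_id : borel id. Proof. exact: measurable_id. Qed.
Lemma borelD f g : borel f -> borel g -> borel (fun x => f x + g x).
Proof. exact: measurable_funD. Qed.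
Lemma borelB f g : borel f -> borel g -> borel (fun x => f x - g x).
Proof. exact: measurable_funB. Qed.
Lemma borelM f g : borel f -> borel g -> borel (fun x => f x * g x).
Proof. exact: measurable_funM. Qed.
Lemma borel_abs f : borel f -> borel (fun x => `|f x|).
Proof. by move=> mf; apply: measurableT_comp mf. Qed.
Lemma borel_cont f : continuous f -> borel f.
Proof. exact: continuous_measurable_fun. Qed.
Lemma borel_comp f g : borel f -> borel g -> borel (fun x => f (g x)).
Proof. by move=> mf mg; apply: measurableT_comp mf mg. Qed.
Lemma borel_indic (A : set (measurableTypeR R)) : measurable A -> borel \1_A.
Proof. by move=> mA; exact: measurable_indic. Qed.

(** * Translations, reflections and dilations of the variable *)

Lemma measurable_shift a : measurable_fun setT
  (fun x : measurableTypeR R => x + a : measurableTypeR R).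
Proof. by apply: measurable_funD => //; exact: measurable_cst. Qed.

Lemma measurable_dilate a : measurable_fun setT
  (fun x : measurableTypeR R => a * x : measurableTypeR R).
Proof. by apply: measurable_funM => //; exact: measurable_cst. Qed.

(* The hypothesis on half-open intervals determines the image of Lebesgue measure. *)
Lemma It_substitution (phi : R -> R) (c : R) f :
  borel phi -> 0 < c ->
  (forall a b, mu (phi @^-1` `]a, b]) = (c^-1)%:E * mu `]a, b])%E ->
  intg f -> intg (fun x => f (phi x)) /\ It f = c * It (fun x => f (phi x)).
Proof.
move=> mphi c0 phiE intf.
pose p : measurableTypeR R -> measurableTypeR R := phi.
pose pf_ : {measure set (measurableTypeR R) -> \bar R} := pushforward mu p.
pose pf := pf_ mphi.
pose nu : {measure set (measurableTypeR R) -> \bar R} := mscale (NngNum (ltW c0)) pf.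
have nuE (A : set (measurableTypeR R)) : measurable A -> mu A = nu A.
  apply: lebesgue_measure_unique => _ [[a b]] _ <-.
  transitivity (c%:E * mu (phi @^-1` `]a, b]))%E; last by [].
  by rewrite phiE muleA -EFinM divff ?gt_eqF// mul1e.
have key (g : R -> \bar R) : measurable_fun [set: measurableTypeR R] g ->
    (forall x, 0 <= g x)%E ->
    (\int[mu]_x g x = c%:E * \int[mu]_x g (phi x))%E.
  move=> mg g0.
  have -> : (\int[mu]_x g x = \int[nu]_x g x)%E.
    by apply: eq_measure_integral => //= A mA _; rewrite nuE.
  rewrite ge0_integral_mscale//; congr (_ * _)%E.
  have := @ge0_integral_pushforward _ _ _ _ _ p mphi mu setT g measurableT mg (fun y _ => g0 y).
  by rewrite preimage_setT.
have mf := intg_borel intf.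
have intf' : intg (fun x => f (phi x)).
  apply/integrableP; split; first by apply/measurable_EFinP; exact: borel_comp.
  move/integrableP: intf => [_].
  rewrite (key (fun x => `|(f x)%:E|%E))//; last first.
    by apply: measurableT_comp => //; exact/measurable_EFinP.
  by rewrite !ltey; apply: contra => /eqP/= ->; rewrite gt0_muley ?lte_fin.
split => //.
apply: EFin_inj; rewrite EFinM -!ItE//.
have mF : measurable_fun [set: measurableTypeR R] (EFin \o f) by exact/measurable_EFinP.
have E1 := integralE mu setT (EFin \o f).
have E2 := integralE mu setT (EFin \o (f \o phi)).
have K1 := key _ (measurable_funepos mF) (fun x => funepos_ge0 _ x).
have K2 := key _ (measurable_funeneg mF) (fun x => funeneg_ge0 _ x).
have P1 : (EFin \o (f \o phi))^\+%E = (fun x => (EFin \o f)^\+%E (phi x)).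
  exact: (funepos_comp (EFin \o f) phi).
have P2 : (EFin \o (f \o phi))^\-%E = (fun x => (EFin \o f)^\-%E (phi x)).
  exact: (funeneg_comp (EFin \o f) phi).
have F2 := integrable_neg_fin_num measurableT intf'.
rewrite P1 P2 in E2; rewrite [X in X \is a fin_num](_ : _ =
  \int[mu]_x (EFin \o f)^\-%E (phi x))%E in F2; last by rewrite -P2.
transitivity (\int[mu]_x (EFin \o f)^\+%E x - \int[mu]_x (EFin \o f)^\-%E x)%E => //.
rewrite K1 K2 -muleBr//; last by rewrite fin_num_adde_defl// fin_numN.
by congr (_ * _)%E; rewrite -E2.
Qed.

Lemma It_shift_intg a f : intg f ->
  intg (fun x => f (x + a)) /\ It (fun x => f (x + a)) = It f.
Proof.
move=> intf; have [|//|i ->] := @It_substitution (fun x => x + a) 1 f (measurable_shift a) ltr01.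
  move=> c b; rewrite invr1 mul1e.
  rewrite (_ : _ @^-1` _ = `]c - a, b - a]%classic); last first.
    by apply/seteqP; split => x /=; rewrite !in_itv/= ltrBlDr lerBrDr.
  rewrite !lebesgue_measure_itv/= !lte_fin ltrD2r.
  by case: ifP => // _; rewrite -!EFinD; congr EFin; ring.
by rewrite mul1r.
Qed.
Definition It_shift a f fi := (@It_shift_intg a f fi).2.
Definition intg_shift a f fi := (@It_shift_intg a f fi).1.

Lemma It_opp_intg f : intg f -> intg (fun x => f (- x)) /\ It (fun x => f (- x)) = It f.
Proof.
move=> intf; have [||//|i ->] := @It_substitution (fun x => - x) 1 f _ ltr01.
- by under eq_fun do rewrite -mulN1r; exact: measurable_dilate.
- move=> c b; rewrite invr1 mul1e -[RHS]lebesgue_measureN//.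
- by rewrite mul1r.
Qed.
Definition It_opp f fi := (@It_opp_intg f fi).2.
Definition intg_opp f fi := (@It_opp_intg f fi).1.

Lemma It_dilate_intg a f : 0 < a -> intg f ->
  intg (fun x => f (a * x)) /\ It (fun x => f (a * x)) = a^-1 * It f.
Proof.
move=> a0 intf; have [||//|i ->] := @It_substitution (fun x => a * x) a f _ a0.
- exact: measurable_dilate.
- move=> c b; rewrite (_ : _ @^-1` _ = `]c / a, b / a]%classic); last first.
    apply/seteqP; split => x /=; rewrite !in_itv/=.
      by rewrite ltr_pdivrMr// ler_pdivlMr// mulrC.
    by rewrite ltr_pdivrMr// ler_pdivlMr// mulrC.
  rewrite !lebesgue_measure_itv/= !lte_fin ltr_pM2r ?invr_gt0//.
  case: ifP => _; last by rewrite mule0.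
  by rewrite -!EFinD -EFinM mulrBr !(mulrC a^-1).
- by rewrite mulKf ?gt_eqF.
Qed.
Definition It_dilate a f (a0 : 0 < a) fi := (@It_dilate_intg a f a0 fi).2.
Definition intg_dilate a f (a0 : 0 < a) fi := (@It_dilate_intg a f a0 fi).1.

Lemma intg_comp_aff a f : intg f -> intg (fun y => f (a - y)).
Proof.
move=> /(intg_shift a)/intg_opp; congr intg.
by apply/funext => y; rewrite addrC.
Qed.
Lemma It_comp_aff a f : intg f -> It (fun y => f (a - y)) = It f.
Proof.
move=> fi; rewrite -(It_shift a fi) -(It_opp (intg_shift a fi)).
by apply: eq_It => y; rewrite addrC.
Qed.

Arguments borel_cont {f}.

(** * Functions of two variables and exchange of integrals *)

Definition borel2 (F : R -> R -> R) := measurable_fun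
  [set: measurableTypeR R * measurableTypeR R]
  (fun z : measurableTypeR R * measurableTypeR R => F z.1 z.2 : measurableTypeR R).
Implicit Types F G : R -> R -> R.

Lemma borel2_fst f : borel f -> borel2 (fun x _ => f x).
Proof. by move=> mf; apply: (measurableT_comp mf); exact: measurable_fst. Qed.
Lemma borel2_snd f : borel f -> borel2 (fun _ y => f y).
Proof. by move=> mf; apply: (measurableT_comp mf); exact: measurable_snd. Qed.
Lemma borel2M F G : borel2 F -> borel2 G -> borel2 (fun x y => F x y * G x y).
Proof. by move=> mF mG; exact: measurable_funM. Qed.
Lemma borel2B F G : borel2 F -> borel2 G -> borel2 (fun x y => F x y - G x y).
Proof. by move=> mF mG; exact: measurable_funB. Qed.
Lemma borel2_comp f F : borel f -> borel2 F -> borel2 (fun x y => f (F x y)).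
Proof. by move=> mf mF; exact: (measurableT_comp mf mF). Qed.
Lemma borel2_swap F : borel2 F -> borel2 (fun x y => F y x).
Proof.
move=> mF; apply: (measurableT_comp mF (f := fun z => F z.1 z.2) (g := fun z => (z.2, z.1))).
by apply/measurable_fun_pairP; split; [exact: measurable_snd|exact: measurable_fst].
Qed.
Lemma borel2_l F y : borel2 F -> borel (F ^~ y).
Proof.
move=> mF; apply: (measurableT_comp mF (f := fun z => F z.1 z.2) (g := fun x => (x, y))).
exact: measurable_pair2.
Qed.
Lemma borel2_r F x : borel2 F -> borel (F x).
Proof. by move=> /borel2_swap/(borel2_l x). Qed.

Lemma borel_It F : borel2 F -> borel (fun x => It (F x)).
Proof.
move=> mF.
have mE : measurable_fun [set: measurableTypeR R * measurableTypeR R]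
   (fun z : measurableTypeR R * measurableTypeR R => (F z.1 z.2)%:E) by exact/measurable_EFinP.
rewrite /borel.
have -> : (fun x => It (F x)) = fine \o
  ((fun x => \int[mu]_y (fun z => (F z.1 z.2)%:E)^\+ (x, y)) \-
   (fun x => \int[mu]_y (fun z => (F z.1 z.2)%:E)^\- (x, y)))%E.
  apply/funext => x.
  have E := integralE mu setT (EFin \o F x).
  have P1 : (EFin \o F x)^\+%E = (fun y => (fun z => (F z.1 z.2)%:E)^\+ (x, y))%E.
    exact: (funepos_comp (fun z => (F z.1 z.2)%:E) (fun y => (x, y))).
  have P2 : (EFin \o F x)^\-%E = (fun y => (fun z => (F z.1 z.2)%:E)^\- (x, y))%E.
    exact: (funeneg_comp (fun z => (F z.1 z.2)%:E) (fun y => (x, y))).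
  by rewrite P1 P2 in E; rewrite /It /Rintegral -[X in fine X = _]/(\int[mu]_y (EFin \o F x) y)%E E.
apply: (measurableT_comp (f := fine)); first exact: fine_measurable.
apply: emeasurable_funB; apply: measurable_fun_fubini_tonelli_F => //.
  exact: measurable_funepos.
exact: measurable_funeneg.
Qed.

(** Integrability of every section, and not only of almost every one, lets the extended inner
    integrals be replaced by [It] everywhere; the majorant [h] of the inner integrals of the modulus
    gives integrability on the product. *)
Lemma It_fubini_intg F h : borel2 F -> (forall x, intg (F x)) ->
  (forall y, intg (F ^~ y)) -> intg h -> (forall x, It (fun y => `|F x y|) <= h x) ->
  [/\ intg (fun x => It (F x)), intg (fun y => It (F ^~ y)) &
     It (fun x => It (F x)) = It (fun y => It (F ^~ y))].
Proof.
move=> mF ix iy hi Fh.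
have mE : measurable_fun [set: measurableTypeR R * measurableTypeR R]
   (fun z : measurableTypeR R * measurableTypeR R => (F z.1 z.2)%:E) by exact/measurable_EFinP.
have bnd : (\int[mu]_x \int[mu]_y `|(F x y)%:E| < +oo)%E.
  apply: (@le_lt_trans _ _ (\int[mu]_x (h x)%:E)%E); last first.
    by rewrite ItE// ltry.
  apply: ge0_le_integral => //.
  - by move=> x _; exact: integral_ge0.
  - have := @measurable_fun_fubini_tonelli_F _ _ _ _ _ mu
      (fun z : measurableTypeR R * measurableTypeR R => `|(F z.1 z.2)%:E|%E).
    by apply => //; exact: measurableT_comp.
  - by apply/measurable_EFinP; exact: intg_borel hi.
  - by move=> x _; have := Fh x; rewrite -lee_fin -ItE//; exact: intg_abs.
have iF : (mu \x mu)%E.-integrable setT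
   (fun z : measurableTypeR R * measurableTypeR R => (F z.1 z.2)%:E).
  exact/integrable12ltyP.
have iF' : (mu \x mu)%E.-integrable setT
   (fun z : measurableTypeR R * measurableTypeR R => (F z.2 z.1)%:E).
  apply/integrable21ltyP => //; apply/measurable_EFinP.
  exact: (borel2_swap mF).
have EF := @integrable_fubini_F _ _ _ _ _ mu mu _ iF.
have EG := @integrable_fubini_F _ _ _ _ _ mu mu _ iF'.
have E := @Fubini _ _ _ _ _ mu mu _ iF.
have e1 x : (\int[mu]_y (F x y)%:E)%E = (It (F x))%:E by rewrite ItE.
have e2 y : (\int[mu]_x (F x y)%:E)%E = (It (F ^~ y))%:E by rewrite -ItE.
have i1 : intg (fun x => It (F x)).
  by move: EF; rewrite /fubini_F; under [X in _.-integrable _ X]eq_fun do rewrite /= e1.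
have i2 : intg (fun y => It (F ^~ y)).
  by move: EG; rewrite /fubini_F; under [X in _.-integrable _ X]eq_fun do rewrite /= e2.
split; [exact: i1|exact: i2|]; apply: EFin_inj; rewrite -(ItE i1) -(ItE i2); move: E => /=.
under eq_integral do rewrite e1.
by under [X in _ = X]eq_integral do rewrite e2.
Qed.
End LineIntegral.
Arguments borel_cont {R f}.

(** * Kernels dominated by 1 / (1 + x^2) *)

Section Kernels.
Variable R : realType.
Local Notation mu := (@lebesgue_measure R).
Implicit Types (f g k u v : R -> R) (a b c x y C : R).

Definition poi x : R := (1 + x ^+ 2)^-1.

Lemma oneD_gt0 x : 0 < 1 + x ^+ 2.
Proof. by rewrite ltr_pwDl// sqr_ge0. Qed.
Lemma poi_gt0 x : 0 < poi x.
Proof. by rewrite invr_gt0 oneD_gt0. Qed.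
Lemma poi_ge0 x : 0 <= poi x. Proof. exact/ltW/poi_gt0. Qed.
Lemma poi_le1 x : poi x <= 1.
Proof. by rewrite invf_le1 ?oneD_gt0// lerDl sqr_ge0. Qed.
Lemma poiN x : poi (- x) = poi x.
Proof. by rewrite /poi sqrrN. Qed.
Lemma poiC x y : poi (x - y) = poi (y - x).
Proof. by rewrite -poiN opprB. Qed.
Hint Resolve poi_gt0 poi_ge0 poi_le1 : core.

Lemma poi_continuous : continuous poi.
Proof. exact: continuous_oneDsqrV. Qed.
Lemma borel_poi : borel poi. Proof. exact: (borel_cont poi_continuous). Qed.

Lemma intg_poi : intg poi.
Proof.
apply/integrableP; split; first by apply/measurable_EFinP; exact: borel_poi.
have -> : (\int[mu]_x `|(EFin \o poi) x| = \int[mu]_x (poi x)%:E)%E.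
  by apply: eq_integral => x _ /=; rewrite ger0_norm.
rewrite ge0_symfun_integralT//; last 2 first.
- exact: poi_continuous.
- by move=> x /=; rewrite poiN.
rewrite -set_itvcy integral0y_oneDsqr -EFinM; exact: ltry.
Qed.

(** Peetre's inequality. It makes averages against [poi] vary slowly, and for fixed x it compares
    [poi (x - y)] with [poi y]. *)
Lemma poi_pert x y : poi x <= 2 * (1 + (x - y) ^+ 2) * poi y.
Proof.
rewrite /poi ler_pdivlMr ?oneD_gt0// mulrC ler_pdivrMr ?oneD_gt0//.
rewrite -subr_ge0.
have -> : 2 * (1 + (x - y) ^+ 2) * (1 + x ^+ 2) - (1 + y ^+ 2) =
  1 + (x - (y - x)) ^+ 2 + 2 * ((x - y) ^+ 2 * x ^+ 2) by ring.
by rewrite !addr_ge0// ?sqr_ge0// mulr_ge0// mulr_ge0 ?sqr_ge0.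
Qed.

(** After division by the three weights this is 1 + x^2 <= 2 ((1 + y^2) + (1 + (x - y)^2)).
    Integrated in y, it shows that [poi] convolved with itself is at most a multiple of [poi], on
    which the convolution algebra rests. *)
Lemma poi_mul x y : poi (x - y) * poi y <= 2 * poi x * (poi y + poi (x - y)).
Proof.
rewrite /poi; set a := 1 + y ^+ 2; set b := 1 + (x - y) ^+ 2; set c := 1 + x ^+ 2.
have a0 : 0 < a by exact: oneD_gt0.
have b0 : 0 < b by exact: oneD_gt0.
have c0 : 0 < c by exact: oneD_gt0.
have -> : b^-1 * a^-1 = c * (a * b * c)^-1 by field; rewrite !gt_eqF.
have -> : 2 * c^-1 * (a^-1 + b^-1) = 2 * (a + b) * (a * b * c)^-1.
  by field; rewrite !gt_eqF.
rewrite ler_pM2r ?invr_gt0 ?mulr_gt0// /a /b /c -subr_ge0.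
have -> : 2 * (1 + y ^+ 2 + (1 + (x - y) ^+ 2)) - (1 + x ^+ 2) =
  3 + (x - 2 * y) ^+ 2 by ring.
by rewrite addr_ge0// sqr_ge0.
Qed.

Definition Ipoi := It poi.
Lemma Ipoi_ge0 : 0 <= Ipoi. Proof. exact: It_ge0. Qed.

Lemma intg_poi_shift x : intg (fun y => poi (x - y)).
Proof. exact: intg_comp_aff intg_poi. Qed.

Lemma borel_aff x : borel (fun y : R => x - y).
Proof. apply: borelB; [exact: borel_cst|exact: borel_id]. Qed.

Lemma intg_poi_poi x : intg (fun y => poi (x - y) * poi y).
Proof.
apply: (intg_le _ intg_poi) => [|y].
  by apply: borelM; [exact: borel_comp borel_poi (borel_aff x)|exact: borel_poi].
by rewrite ger0_norm ?mulr_ge0// ler_piMl.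
Qed.

Lemma It_poi_poi x : It (fun y => poi (x - y) * poi y) <= 4 * Ipoi * poi x.
Proof.
apply: (@le_trans _ _ (It (fun y => 2 * poi x * (poi y + poi (x - y))))).
  apply: le_It (intg_poi_poi x) _ _ => [|y]; last exact: poi_mul.
  by apply: intgZ; apply: intgD; [exact: intg_poi|exact: intg_poi_shift].
rewrite ItZ; last by apply: intgD; [exact: intg_poi|exact: intg_poi_shift].
rewrite ItD ?It_comp_aff -/Ipoi; [|exact: intg_poi..|exact: intg_poi_shift].
by rewrite le_eqVlt; apply/orP; left; apply/eqP; ring.
Qed.

Definition kern C k := borel k /\ forall t, `|k t| <= C * poi t.
(** By Peetre's inequality this single weight makes the convolution with any kernel converge
    absolutely at every point. *)
Definition tame u := borel u /\ intg (fun y => u y * poi y).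
Definition convol k u : R -> R := fun x => It (fun y => k (x - y) * u y).
Definition pmax u : R -> R := convol poi (fun y => `|u y|).

Lemma kern_ge0 C k : kern C k -> 0 <= C.
Proof. by move=> [_ /(_ 0)]; rewrite /poi expr0n addr0 invr1 mulr1; exact: le_trans. Qed.

Lemma kern_poi : kern 1 poi.
Proof. by split=> [|t]; [exact: borel_poi|rewrite mul1r ger0_norm]. Qed.

Lemma kern_intg C k : kern C k -> intg k.
Proof. by move=> [mk kC]; apply: (intg_le mk) kC; exact: intgZ intg_poi. Qed.

Lemma tame_mul f u c : borel f -> (forall y, `|f y| <= c * poi y) -> tame u ->
  intg (fun y => f y * u y).
Proof.
move=> mf fc [mu_ iu]; apply: (@intg_le _ _ (fun y => c * `|u y * poi y|)).
- exact: borelM.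
- exact/intgZ/intg_abs.
- move=> y; rewrite !normrM mulrCA (mulrC `|f y|) ler_wpM2l//.
  by rewrite (ger0_norm (poi_ge0 y)).
Qed.

Lemma tame_abs u : tame u -> tame (fun x => `|u x|).
Proof.
move=> [mu_ iu]; split; first exact: borel_abs.
have := intg_abs iu; congr intg; apply/funext => x.
by rewrite normrM (ger0_norm (poi_ge0 x)).
Qed.
Lemma tameD u v : tame u -> tame v -> tame (fun x => u x + v x).
Proof.
move=> [mu_ iu] [mv iv]; split; first exact: borelD.
by have := intgD iu iv; congr intg; apply/funext => x; rewrite mulrDl.
Qed.
Lemma tameZ c u : tame u -> tame (fun x => c * u x).
Proof.
move=> [mu_ iu]; split; first exact: borelM (borel_cst c) _.
by have := intgZ c iu; congr intg; apply/funext => x; rewrite mulrA.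
Qed.
Lemma tameN u : tame u -> tame (fun x => - u x).
Proof. by move=> /(tameZ (-1)); congr tame; apply/funext => x; rewrite mulN1r. Qed.
Lemma tameB u v : tame u -> tame v -> tame (fun x => u x - v x).
Proof. by move=> tu /tameN; exact: tameD. Qed.
Lemma tame_bounded u c : borel u -> (forall x, `|u x| <= c) -> tame u.
Proof.
move=> mu_ uc; split => //; apply: (@intg_le _ _ (fun x => c * poi x)).
- exact: borelM mu_ borel_poi.
- exact: intgZ intg_poi.
- by move=> x; rewrite normrM (ger0_norm (poi_ge0 x)) ler_wpM2r.
Qed.
Lemma kern_tame C k : kern C k -> tame k.
Proof.
move=> kk; have C0 := kern_ge0 kk; case: kk => mk kC.
apply: (@tame_bounded _ C) => // x; apply: (le_trans (kC x)).
by rewrite ler_piMr.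
Qed.

Lemma kern_aff_bound C k x y : kern C k ->
  `|k (x - y)| <= C * (2 * (1 + x ^+ 2)) * poi y.
Proof.
move=> kk; have C0 := kern_ge0 kk; case: kk => _ /(_ (x - y)) kC.
apply: (le_trans kC); rewrite -mulrA ler_wpM2l//.
have := poi_pert (y - x) y; rewrite (poiC y x).
by rewrite (_ : y - x - y = - x) ?sqrrN//; ring.
Qed.

Lemma convol_intg C k u x : kern C k -> tame u -> intg (fun y => k (x - y) * u y).
Proof.
move=> kk tu; apply: (tame_mul _ _ tu).
- by apply: borel_comp (borel_aff x); case: kk.
- by move=> y; exact: kern_aff_bound kk.
Qed.

Lemma borel2_convol k u : borel k -> borel u -> borel2 (fun x y => k (x - y) * u y).
Proof.
move=> mk mu_; apply: borel2M; last exact: borel2_snd.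
by apply: borel2_comp mk _; apply: borel2B; [apply: borel2_fst|apply: borel2_snd]; exact: borel_id.
Qed.

Lemma borel_convol k u : borel k -> borel u -> borel (convol k u).
Proof. by move=> mk mu_; exact: borel_It (borel2_convol mk mu_). Qed.

Lemma pmax_intg u x : tame u -> intg (fun y => poi (x - y) * `|u y|).
Proof. by move=> /tame_abs tu; exact: convol_intg kern_poi tu. Qed.

Lemma pmax_ge0 u x : 0 <= pmax u x.
Proof. by apply: It_ge0 => y; rewrite mulr_ge0. Qed.

Lemma convol_le C k u x : kern C k -> tame u -> `|convol k u x| <= C * pmax u x.
Proof.
move=> kk tu; rewrite /pmax /convol -ItZ; last exact: pmax_intg.
apply: It_norm => [||y].
- by apply: intg_borel; exact: convol_intg kk tu.
- exact/intgZ/pmax_intg.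
- by rewrite normrM mulrA ler_wpM2r//; case: kk.
Qed.

Lemma convol_fubini_bound C k x y c : kern C k -> `|k (x - y) * c * poi x| <=
  C * `|c| * (poi (x - y) * poi x).
Proof.
move=> kk; rewrite !normrM (ger0_norm (poi_ge0 x)).
rewrite [leRHS](_ : _ = (C * poi (x - y)) * `|c| * poi x); last by ring.
by rewrite !ler_wpM2r//; case: kk.
Qed.

(** Exchanging integrals moves the kernel onto the weight, and [poi] convolved with [poi] is again
    bounded by a multiple of [poi]. *)
Lemma tame_convol C k u : kern C k -> tame u -> tame (convol k u).
Proof.
move=> kk tu; have C0 := kern_ge0 kk.
have [mk _] := kk; have [mu_ iu] := tu; split; first exact: borel_convol.
pose F y x := k (x - y) * u y * poi x.
have mF : borel2 F.
  by apply: borel2M; [exact: borel2_swap (borel2_convol mk mu_)|exact: borel2_snd borel_poi].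
have b y : intg (fun x => C * `|u y| * (poi (x - y) * poi x)).
  by apply: intgZ; under eq_fun do rewrite poiC; exact: intg_poi_poi.
have [||||_ + _] := It_fubini_intg (F := F) (h := fun y => C * (4 * Ipoi) * `|u y * poi y|) mF.
- by move=> y; apply: (intg_le _ (b y)) => [|x]; [exact: borel2_r mF|exact: convol_fubini_bound].
- move=> x; have := intgZ (poi x) (convol_intg x kk tu); congr intg.
  by apply/funext => y; rewrite mulrC.
- by apply: intgZ; exact: intg_abs.
- move=> y; apply: (@le_trans _ _ (It (fun x => C * `|u y| * (poi (x - y) * poi x)))).
    apply: le_It (b y) _ => [|x]; last exact: convol_fubini_bound.
    by apply: intg_abs; apply: (intg_le _ (b y)) => [|x]; [exact: borel2_r mF|exact: convol_fubini_bound].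
  rewrite ItZ; last by under eq_fun do rewrite poiC; exact: intg_poi_poi.
  rewrite -mulrA -[leRHS]mulrA ler_wpM2l// normrM (ger0_norm (poi_ge0 y)).
  rewrite mulrCA ler_wpM2l//.
  by under eq_fun do rewrite poiC; exact: It_poi_poi.
- congr intg; apply/funext => x; rewrite /convol -ItZr//.
  exact: convol_intg kk tu.
Qed.
End Kernels.

(** * The convolution algebra *)

Section Operators.
Variable R : realType.
Implicit Types (f g k u v : R -> R) (a b c x y C : R) (L K : (R -> R) -> R -> R).
Hint Resolve poi_gt0 poi_ge0 poi_le1 : core.

Lemma It_poi_poi2 x z : intg (fun y : R => poi (x - y) * poi (y - z)) /\
  It (fun y => poi (x - y) * poi (y - z)) <= 4 * Ipoi R * poi (x - z).
Proof.
have := It_shift_intg (- z) (intg_poi_poi (x - z)).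
have e : (fun y => poi (x - z - (y + - z)) * poi (y + - z)) =
         (fun y => poi (x - y) * poi (y - z)).
  by apply/funext => y; congr (poi _ * _); ring.
by rewrite e => -[i E]; split=> //; rewrite E; exact: It_poi_poi.
Qed.

Lemma convol_kern C1 C2 k1 k2 : kern C1 k1 -> kern C2 k2 ->
  kern (C1 * C2 * (4 * Ipoi R)) (convol k1 k2).
Proof.
move=> kk1 kk2; have [[m1 b1] [m2 b2]] := (kk1, kk2).
split=> [|x]; first exact: borel_convol.
apply: (@le_trans _ _ (It (fun y => C1 * C2 * (poi (x - y) * poi y)))); last first.
  rewrite ItZ; last exact: intg_poi_poi.
  by rewrite -[leRHS]mulrA ler_wpM2l ?It_poi_poi// mulr_ge0 ?(kern_ge0 kk1) ?(kern_ge0 kk2).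
apply: It_norm => [||y].
- by apply: intg_borel; apply: convol_intg kk1 (kern_tame kk2).
- exact/intgZ/intg_poi_poi.
- by rewrite normrM mulrACA ler_pM.
Qed.

Lemma convol_kernC C1 C2 k1 k2 : kern C1 k1 -> kern C2 k2 -> convol k1 k2 = convol k2 k1.
Proof.
move=> kk1 kk2; apply/funext => x.
rewrite /convol -(It_comp_aff x (convol_intg x kk1 (kern_tame kk2))).
by apply: eq_It => y; rewrite subKr mulrC.
Qed.

(* Fubini, followed by a translation in the inner integral. *)
Lemma convol_convol C1 C2 k1 k2 u : kern C1 k1 -> kern C2 k2 -> tame u ->
  convol k1 (convol k2 u) = convol (convol k1 k2) u.
Proof.
move=> kk1 kk2 tu; apply/funext => x.
have [[[m1 b1] [m2 b2]] [mu_ iu]] := (kk1, kk2, tu).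
have C10 := kern_ge0 kk1; have C20 := kern_ge0 kk2.
pose F z y := k1 (x - y) * k2 (y - z) * u z.
have mF : borel2 F.
  apply: borel2M; last exact: borel2_fst.
  apply: borel2M; first by apply: borel2_snd; exact: borel_comp (borel_aff x).
  by apply: borel2_comp m2 _; apply: borel2B; [apply: borel2_snd|apply: borel2_fst]; exact: borel_id.
have bF z y : `|F z y| <= C1 * C2 * `|u z| * (poi (x - y) * poi (y - z)).
  rewrite /F !normrM (mulrAC _ `|u z|) ler_wpM2r// mulrACA.
  by rewrite ler_pM.
have ib z : intg (fun y => C1 * C2 * `|u z| * (poi (x - y) * poi (y - z))).
  by apply: intgZ; exact: (It_poi_poi2 x z).1.
have iF z : intg (F z).
  by apply: (intg_le _ (ib z)) => // ; exact: borel2_r mF.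
have [||||_ _ E] := It_fubini_intg (F := F)
   (h := fun z => C1 * C2 * (4 * Ipoi R) * (poi (x - z) * `|u z|)) mF.
- exact: iF.
- move=> y; have := intgZ (k1 (x - y)) (convol_intg y kk2 tu).
  by congr intg; apply/funext => z; rewrite /F mulrA.
- by apply: intgZ; exact: pmax_intg.
- move=> z; apply: (le_trans (le_It (intg_abs (iF z)) (ib z) (bF z))).
  rewrite ItZ; last exact: (It_poi_poi2 x z).1.
  apply: (@le_trans _ _ (C1 * C2 * `|u z| * (4 * Ipoi R * poi (x - z)))).
    by rewrite ler_wpM2l ?mulr_ge0// (It_poi_poi2 x z).2.
  by rewrite le_eqVlt; apply/orP; left; apply/eqP; ring.
- transitivity (It (fun y => It (F ^~ y))).
    apply: eq_It => y; rewrite /convol -ItZ; last exact: convol_intg kk2 tu.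
    by apply: eq_It => z; rewrite mulrA.
  rewrite -E; apply: eq_It => z.
  rewrite /convol -[X in _ = X * _](It_shift (- z) (convol_intg (x - z) kk1 (kern_tame kk2))) -ItZr.
    by apply: eq_It => y; rewrite /F; congr (k1 _ * _ * _); ring.
  exact: intg_shift (convol_intg (x - z) kk1 (kern_tame kk2)).
Qed.

Lemma kern0 : kern 0 (fun _ : R => 0).
Proof. by split=> [|t]; [exact: borel_cst|rewrite normr0 mul0r]. Qed.
Lemma kernD C1 C2 k1 k2 : kern C1 k1 -> kern C2 k2 ->
  kern (C1 + C2) (fun x => k1 x + k2 x).
Proof.
move=> [m1 b1] [m2 b2]; split=> [|t]; first exact: borelD.
by rewrite mulrDl (le_trans (ler_normD _ _))// lerD.
Qed.
Lemma kernZ C c k : kern C k -> kern (`|c| * C) (fun x => c * k x).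
Proof.
move=> [m1 b1]; split=> [|t]; first exact: borelM (borel_cst c) _.
by rewrite normrM -mulrA ler_wpM2l.
Qed.

Lemma convolDl C1 C2 k1 k2 u : kern C1 k1 -> kern C2 k2 -> tame u ->
  convol (fun x => k1 x + k2 x) u = (fun x => convol k1 u x + convol k2 u x).
Proof.
move=> kk1 kk2 tu; apply/funext => x; rewrite /convol -ItD.
- by apply: eq_It => y; rewrite mulrDl.
- exact: convol_intg kk1 tu.
- exact: convol_intg kk2 tu.
Qed.
Lemma convolZl C c k u : kern C k -> tame u ->
  convol (fun x => c * k x) u = (fun x => c * convol k u x).
Proof.
move=> kk tu; apply/funext => x; rewrite /convol -ItZ.
- by apply: eq_It => y; rewrite mulrA.
- exact: convol_intg kk tu.
Qed.
Lemma convolDr C k u v : kern C k -> tame u -> tame v ->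
  convol k (fun x => u x + v x) = (fun x => convol k u x + convol k v x).
Proof.
move=> kk tu tv; apply/funext => x; rewrite /convol -ItD.
- by apply: eq_It => y; rewrite mulrDr.
- exact: convol_intg kk tu.
- exact: convol_intg kk tv.
Qed.
Lemma convolZr C c k u : kern C k -> tame u ->
  convol k (fun x => c * u x) = (fun x => c * convol k u x).
Proof.
move=> kk tu; apply/funext => x; rewrite /convol -ItZ.
- by apply: eq_It => y; rewrite mulrCA.
- exact: convol_intg kk tu.
Qed.

(** Operators a I + (convolution with a kernel): a commutative algebra with unit, in which [opk] is
    the ideal a = 0. The ideal matters because its members are bounded by [pmax u] alone, without
    the term |u x|, and only such bounds can be read at the nodes. *)
Definition opc L := exists a k C, kern C k /\
  forall u, tame u -> L u = (fun x => a * u x + convol k u x).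
Definition opk L := exists k C, kern C k /\ forall u, tame u -> L u = convol k u.

Lemma opk_opc L : opk L -> opc L.
Proof.
move=> [k [C [kk LE]]]; exists 0, k, C; split=> // u tu; rewrite LE//.
by apply/funext => x; rewrite mul0r add0r.
Qed.
Lemma opk_convol C k : kern C k -> opk (convol k).
Proof. by move=> kk; exists k, C. Qed.

Lemma opc_tame L u : opc L -> tame u -> tame (L u).
Proof.
move=> [a [k [C [kk LE]]]] tu; rewrite LE//.
by apply: tameD; [exact: tameZ|exact: tame_convol kk tu].
Qed.

Lemma convol0 u : convol (fun=> 0) u = fun=> 0.
Proof. by apply/funext => x; rewrite /convol -[RHS](It0 R); apply: eq_It => y; rewrite mul0r. Qed.

Lemma opc_id : opc id.
Proof.
exists 1, (fun=> 0), 0; split=> [|u _]; first exact: kern0.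
by apply/funext => x; rewrite convol0 mul1r addr0.
Qed.

Lemma opcD L K : opc L -> opc K -> opc (fun u x => L u x + K u x).
Proof.
move=> [a [k [C [kk LE]]]] [b [l [D [ll KE]]]].
exists (a + b), (fun x => k x + l x), (C + D); split=> [|u tu]; first exact: kernD.
by rewrite LE// KE// (convolDl kk ll)//; apply/funext => x; ring.
Qed.
Lemma opcZ c L : opc L -> opc (fun u x => c * L u x).
Proof.
move=> [a [k [C [kk LE]]]].
exists (c * a), (fun x => c * k x), (`|c| * C); split=> [|u tu]; first exact: kernZ.
by rewrite LE// (convolZl _ kk)//; apply/funext => x; ring.
Qed.
Lemma opcB L K : opc L -> opc K -> opc (fun u x => L u x - K u x).
Proof.
move=> oL /(opcZ (-1)) /(opcD oL) [a [k [C [kk LE]]]]; exists a, k, C; split=> // u tu.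
by rewrite -LE//; apply/funext => x; rewrite mulN1r.
Qed.

Lemma opc_comp L K : opc L -> opc K -> opc (fun u => L (K u)).
Proof.
move=> oL oK; have [a [k [C [kk LE]]]] := oL; have [b [l [D [ll KE]]]] := oK.
exists (a * b), (fun x => (a * l x + b * k x) + convol k l x),
  ((`|a| * D + `|b| * C) + C * D * (4 * Ipoi R)).
have kal := kernZ a ll; have kbk := kernZ b kk; have kkl := convol_kern kk ll.
split=> [|u tu]; first by apply: kernD => //; exact: kernD.
rewrite LE; last exact: opc_tame.
rewrite KE// (convolDl (kernD kal kbk) kkl)// (convolDl kal kbk)//.
rewrite (convolZl _ ll)// (convolZl _ kk)//.
rewrite (convolDr kk); [|exact: tameZ|exact: tame_convol ll tu].
rewrite (convolZr _ kk)// (convol_convol kk ll)//.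
by apply/funext => x; ring.
Qed.

Lemma opk_comp L K : opk L -> opc K -> opk (fun u => L (K u)).
Proof.
move=> [k [C [kk LE]]] oK; have [b [l [D [ll KE]]]] := oK.
exists (fun x => b * k x + convol k l x), (`|b| * C + C * D * (4 * Ipoi R)).
split=> [|u tu]; first by apply: kernD; [exact: kernZ|exact: convol_kern].
rewrite LE; last exact: opc_tame.
rewrite KE// (convolDl (kernZ b kk) (convol_kern kk ll))//.
rewrite (convolZl _ kk)// (convolDr kk); [|exact: tameZ|exact: tame_convol ll tu].
by rewrite (convolZr _ kk)// (convol_convol kk ll).
Qed.

Lemma opc_comm L K u : opc L -> opc K -> tame u -> L (K u) = K (L u).
Proof.
move=> oL oK tu; have [a [k [C [kk LE]]]] := oL; have [b [l [D [ll KE]]]] := oK.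
rewrite (LE _ (opc_tame oK tu)) (KE _ (opc_tame oL tu)) (KE u tu) (LE u tu).
rewrite (convolDr kk (tameZ b tu) (tame_convol ll tu)).
rewrite (convolDr ll (tameZ a tu) (tame_convol kk tu)).
rewrite (convolZr b kk tu) (convolZr a ll tu) (convol_convol kk ll tu).
by rewrite (convol_convol ll kk tu) (convol_kernC kk ll); apply/funext => x; ring.
Qed.

Lemma opc_iter n L : opc L -> opc (iter n L).
Proof.
by move=> oL; elim: n => [|n IH]; [exact: opc_id|exact: opc_comp oL IH].
Qed.

Lemma opc_sub L u v : opc L -> tame u -> tame v ->
  L (fun x => u x - v x) = (fun x => L u x - L v x).
Proof.
move=> oL tu tv; have [a [k [C [kk LE]]]] := oL.
rewrite LE ?LE//; last exact: tameB.
rewrite (_ : (fun x => u x - v x) = (fun x => u x + (-1) * v x)); last first.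
  by apply/funext => x; rewrite mulN1r.
rewrite (convolDr kk)//; last exact: tameZ.
by rewrite (convolZr _ kk)//; apply/funext => x; ring.
Qed.

Lemma opc_add L u v : opc L -> tame u -> tame v ->
  L (fun x => u x + v x) = (fun x => L u x + L v x).
Proof.
move=> oL tu tv; have [a [k [C [kk LE]]]] := oL.
rewrite LE ?LE//; last exact: tameD.
by rewrite (convolDr kk)//; apply/funext => x; ring.
Qed.

Lemma opk_bound L : opk L -> exists2 C, 0 <= C &
  forall u x, tame u -> `|L u x| <= C * pmax u x.
Proof.
move=> [k [C [kk LE]]]; exists C; first exact: kern_ge0 kk.
by move=> u x tu; rewrite LE//; exact: convol_le.
Qed.

Lemma opc_bound L : opc L -> exists2 C, 0 <= C &
  forall u x, tame u -> `|L u x| <= C * (`|u x| + pmax u x).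
Proof.
move=> [a [k [C [kk LE]]]]; have C0 := kern_ge0 kk; exists (`|a| + C).
  by rewrite addr_ge0.
move=> u x tu; rewrite LE// (le_trans (ler_normD _ _))// normrM mulrDl !mulrDr.
rewrite lerD//; first by rewrite lerDl mulr_ge0// pmax_ge0.
by rewrite (le_trans (convol_le x kk tu))// lerDr mulr_ge0.
Qed.
End Operators.

(** * Derivatives *)

Section Derivatives.
Variable R : realType.
Implicit Types (f g F G : R -> R) (a b c x y C : R).

Definition der f g := forall x, is_derive x (1 : R) f (g x).

Lemma der_ext f g f' g' : f =1 g -> f' =1 g' -> der f f' -> der g g'.
Proof. by move=> /funext -> /funext ->. Qed.
Lemma der_cst c : der (fun=> c) (fun=> 0).
Proof. by move=> x; exact: is_derive_cst. Qed.
Lemma der_id : der (fun x => x) (fun=> 1).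
Proof. by move=> x; exact: is_derive_id. Qed.
Lemma derD f g f' g' : der f f' -> der g g' ->
  der (fun x => f x + g x) (fun x => f' x + g' x).
Proof. by move=> df dg x; exact: is_deriveD. Qed.
Lemma derN f f' : der f f' -> der (fun x => - f x) (fun x => - f' x).
Proof. by move=> df x; exact: is_deriveN. Qed.
Lemma derB f g f' g' : der f f' -> der g g' ->
  der (fun x => f x - g x) (fun x => f' x - g' x).
Proof. by move=> df dg x; exact: is_deriveB. Qed.
Lemma derM f g f' g' : der f f' -> der g g' ->
  der (fun x => f x * g x) (fun x => f' x * g x + f x * g' x).
Proof.
move=> df dg x; apply: is_derive_eq; first exact: is_deriveM.
by rewrite addrC /GRing.scale/= (mulrC (g x)).
Qed.
Lemma derZ c f f' : der f f' -> der (fun x => c * f x) (fun x => c * f' x).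
Proof.
move=> df; apply: der_ext (derM (der_cst c) df) => x //=; by rewrite mul0r add0r.
Qed.
Lemma der_comp f g f' g' : der f f' -> der g g' ->
  der (fun x => f (g x)) (fun x => g' x * f' (g x)).
Proof.
move=> df dg x; apply: is_derive_eq; first exact: (@is_derive1_comp _ f g).
by rewrite mulrC.
Qed.
Lemma derV f f' : (forall x, f x != 0) -> der f f' ->
  der (fun x => (f x)^-1) (fun x => - (f' x / f x ^+ 2)).
Proof.
move=> f0 df x; apply: is_derive_eq; first exact: is_deriveV.
by rewrite /GRing.scale/= mulNr mulrC.
Qed.
Lemma der_cos : der (@cos R) (fun x => - sin x).
Proof. by move=> x; exact: is_derive_cos. Qed.
Lemma der_sin : der (@sin R) (@cos R).
Proof. by move=> x; exact: is_derive_sin. Qed.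
Lemma der_scale c : der (fun x => c * x) (fun=> c).
Proof. by apply: der_ext (derZ c der_id) => x //=; rewrite mulr1. Qed.
Lemma der_cosZ c : der (fun x => cos (c * x)) (fun x => - (c * sin (c * x))).
Proof. by apply: der_ext (der_comp der_cos (der_scale c)) => x //=; rewrite mulrN. Qed.
Lemma der_sinZ c : der (fun x => sin (c * x)) (fun x => c * cos (c * x)).
Proof. by apply: der_ext (der_comp der_sin (der_scale c)) => x. Qed.

Lemma der_cont f f' : der f f' -> continuous f.
Proof.
by move=> df x; apply/differentiable_continuous/derivable1_diffP; have [] := df x.
Qed.

Lemma der_derive1 f f' : der f f' -> derive1 f = f'.
Proof. by move=> df; apply/funext => x; rewrite derive1E; have [_ ->] := df x. Qed.

Lemma der_mvt f f' a b : der f f' -> a < b ->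
  exists2 c, a < c < b & f b - f a = f' c * (b - a).
Proof.
move=> df ab; have [//||c] := @MVT _ f f' a b ab.
  by apply: continuous_subspaceT; exact: der_cont df.
by rewrite in_itv/= => cab ->; exists c.
Qed.

Lemma It_itv f a b : It (fun x => f x * \1_`[a, b] x) =
  \int[@lebesgue_measure R]_(x in `[a, b]) f x.
Proof.
rewrite Rintegral_mkcond; apply: eq_It => x.
by rewrite patchE indicE; case: ifP; rewrite ?mulr1 ?mulr0.
Qed.

Lemma borel_itv a b : borel (\1_`[a, b]%classic : R -> R).
Proof. by apply: borel_indic; exact: measurable_itv. Qed.

Lemma intg_itv_cont f a b : continuous f -> intg (fun x => f x * \1_`[a, b] x).
Proof.
move=> cf.
have : (@lebesgue_measure R).-integrable `[a, b] (EFin \o f).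
  apply: continuous_compact_integrable; first exact: segment_compact.
  exact: continuous_subspaceT.
rewrite integrable_mkcond// => i; move: i; congr (_.-integrable _ _).
apply/funext => x; rewrite patchE /= indicE.
by case: ifP; rewrite ?mulr1 ?mulr0.
Qed.

Lemma ftc F f a b : der F f -> continuous f -> a <= b ->
  It (fun x => f x * \1_`[a, b] x) = F b - F a.
Proof.
move=> dF cf; rewrite It_itv le_eqVlt => /predU1P[->|ab].
  by rewrite set_itv1 Rintegral_set1 subrr.
rewrite /Rintegral (@continuous_FTC2 _ f F a b)//.
- exact: continuous_subspaceT.
- split.
  + by move=> x _; have [] := dF x.
  + by apply: cvg_at_right_filter; exact: (der_cont dF).
  + by apply: cvg_at_left_filter; exact: (der_cont dF).
- by move=> x _; rewrite (der_derive1 dF).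
Qed.

Lemma der_It (G G1 : R -> R -> R) (h : R -> R) a :
  (forall x, intg (G x)) -> (forall y, der (G ^~ y) (G1 ^~ y)) -> intg h ->
  (forall x y, `|x - a| < 1 -> `|G1 x y| <= h y) ->
  is_derive a (1 : R) (fun x => It (G x)) (It (G1 a)).
Proof.
move=> iG dG ih Gh.
have Ia : `]a - 1, a + 1[%classic a by rewrite /= in_itv/= ltrBlDr ltrDl ltr01.
have h0 y : 0 <= h y.
  by rewrite (le_trans (normr_ge0 (G1 a y)))// Gh// subrr normr0.
have dE x y : partial1of2 G x y = G1 x y by rewrite partial1of2E -derive1E (der_derive1 (dG y)).
have A1 x : `]a - 1, a + 1[%classic x -> (@lebesgue_measure R).-integrable setT (EFin \o G x).
  by move=> _; exact: iG.
have A2 x y : `]a - 1, a + 1[%classic x -> setT y -> derivable (G ^~ y) x 1.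
  by move=> _ _; have [] := dG y x.
have A3 x y : `]a - 1, a + 1[%classic x -> setT y -> `|partial1of2 G x y| <= h y.
  rewrite /= in_itv/= => xa _; rewrite dE; apply: Gh.
  by rewrite ltr_distl.
apply: DeriveDef.
  exact: (@derivable_under_integral _ _ _ (@lebesgue_measure R) G setT measurableT _ _ _ Ia A1 A2 h h0 ih A3).
rewrite -derive1E.
have := @differentiation_under_integral _ _ _ (@lebesgue_measure R) G setT measurableT _ _ _ Ia A1 A2 h h0 ih A3.
rewrite /It => ->; congr Rintegral.
by apply/funext => y; rewrite dE.
Qed.
End Derivatives.
Arguments der_cont {R f f'} _ x : rename.

(** * Cosine and sine transforms *)

Section Symbols.
Variable R : realType.
Implicit Types (f g h F G H w : R -> R) (a b c d x y t C K : R).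
Hint Resolve poi_gt0 poi_ge0 poi_le1 : core.

Definition bnd f := exists C, forall x, `|f x| <= C.

Lemma bnd_ge0 f : bnd f -> exists2 C, 0 <= C & forall x, `|f x| <= C.
Proof. by move=> [C fC]; exists C => //; rewrite (le_trans _ (fC 0)). Qed.
Lemma bnd_cst c : bnd (fun=> c). Proof. by exists `|c|. Qed.
Lemma bndD f g : bnd f -> bnd g -> bnd (fun x => f x + g x).
Proof. by move=> [C fC] [D gD]; exists (C + D) => x; rewrite (le_trans (ler_normD _ _))// lerD. Qed.
Lemma bndN f : bnd f -> bnd (fun x => - f x).
Proof. by move=> [C fC]; exists C => x; rewrite normrN. Qed.
Lemma bndM f g : bnd f -> bnd g -> bnd (fun x => f x * g x).
Proof. by move=> [C fC] [D gD]; exists (C * D) => x; rewrite normrM ler_pM. Qed.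
Lemma bnd_ext f g : f =1 g -> bnd f -> bnd g.
Proof. by move=> /funext ->. Qed.

(** Two bounded derivatives are what [second_difference] will ask for. The class is an algebra,
    closed under inversion of functions bounded below ([B0V]), so symbols can be treated factor by
    factor. *)
Definition B0 F := exists F1 F2, [/\ der F F1, der F1 F2, bnd F, bnd F1 & bnd F2].

Lemma B0_ext F G : F =1 G -> B0 F -> B0 G.
Proof. by move=> /funext ->. Qed.
Lemma B0_bnd F : B0 F -> bnd F. Proof. by move=> [F1 [F2 []]]. Qed.
Lemma B0_cont F : B0 F -> continuous F.
Proof. by move=> [F1 [F2 [dF _ _ _ _]]]; exact: der_cont dF. Qed.
Lemma B0_borel F : B0 F -> borel F. Proof. by move=> /B0_cont; exact: borel_cont. Qed.
Lemma B0_cst c : B0 (fun=> c).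
Proof.
exists (fun=> 0), (fun=> 0); split; try exact: der_cst; exact: bnd_cst.
Qed.
Lemma B0D F G : B0 F -> B0 G -> B0 (fun x => F x + G x).
Proof.
move=> [F1 [F2 [? ? ? ? ?]]] [G1 [G2 [? ? ? ? ?]]].
by exists (fun x => F1 x + G1 x), (fun x => F2 x + G2 x); split; do ?[exact: derD|exact: bndD].
Qed.
Lemma B0N F : B0 F -> B0 (fun x => - F x).
Proof.
move=> [F1 [F2 [? ? ? ? ?]]].
by exists (fun x => - F1 x), (fun x => - F2 x); split; do ?[exact: derN|exact: bndN].
Qed.
Lemma B0B F G : B0 F -> B0 G -> B0 (fun x => F x - G x).
Proof. by move=> bF /B0N; exact: B0D. Qed.
Lemma B0M F G : B0 F -> B0 G -> B0 (fun x => F x * G x).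
Proof.
move=> [F1 [F2 [? ? ? ? ?]]] [G1 [G2 [? ? ? ? ?]]].
exists (fun x => F1 x * G x + F x * G1 x),
  (fun x => (F2 x * G x + F1 x * G1 x) + (F1 x * G1 x + F x * G2 x)).
by split; do ?[exact: derM|apply: derD|exact: bndM|apply: bndD].
Qed.
Lemma B0V F c : 0 < c -> (forall x, c <= F x) -> B0 F -> B0 (fun x => (F x)^-1).
Proof.
move=> c0 cF [F1 [F2 [dF dF1 bF bF1 bF2]]].
pose V x := (F x)^-1; pose V1 x := - (F1 x * (V x * V x)).
have F0 x : 0 < F x by exact: lt_le_trans c0 (cF x).
have dV : der V V1.
  apply: der_ext (derV _ dF) => x //=; last by rewrite gt_eqF.
  by rewrite /V1 /V expr2 invfM.
have bV : bnd V.
  by exists c^-1 => x; rewrite /V gtr0_norm ?invr_gt0// lef_pV2 ?posrE.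
have bV1 : bnd V1 by apply: bndN; do ?apply: bndM.
exists V1, (fun x => - (F2 x * (V x * V x) + F1 x * (V1 x * V x + V x * V1 x))).
split => //; first by apply: derN; apply: derM => //; exact: derM.
by apply: bndN; apply: bndD; do ?[apply: bndM|apply: bndD].
Qed.

(** With this bounded function all derivatives of [poi] become polynomials in [poi] and [xpoi]. *)
Definition xpoi x : R := x * poi x.
Lemma poi1P x : poi x * (1 + x ^+ 2) = 1.
Proof. by rewrite /poi mulVf// gt_eqF// oneD_gt0. Qed.

Lemma bnd_poi : bnd (@poi R).
Proof. by exists 1 => x; rewrite ger0_norm ?poi_ge0 ?poi_le1. Qed.
Lemma bnd_xpoi : bnd xpoi.
Proof.
exists 1 => x; rewrite /xpoi /poi ler_norml.
rewrite ler_pdivrMr ?oneD_gt0// ler_pdivlMr ?oneD_gt0//.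
have := sqr_ge0 (x + 1); have := sqr_ge0 (x - 1).
by rewrite sqrrB1 sqrrD1 => *; apply/andP; split; have := sqr_ge0 x; lra.
Qed.

Local Ltac bounded := repeat (first [assumption | exact: bnd_poi | exact: bnd_xpoi |
  exact: bnd_cst | apply: bndM | apply: bndN | apply: bndD]).

Lemma der_poi : der (@poi R) (fun x => -2 * (xpoi x * poi x)).
Proof.
apply: der_ext (derV (f := fun x => 1 + x * x) (f' := fun x => 0 + (1 * x + x * 1)) _ _) => [x|x|x|] //=.
- by rewrite /xpoi /poi -!expr2; field; rewrite gt_eqF// oneD_gt0.
- by rewrite -expr2 gt_eqF// oneD_gt0.
- by apply: derD; [exact: der_cst|apply: derM; exact: der_id].
Qed.

Lemma der_xpoi : der xpoi (fun x => poi x - 2 * (xpoi x * xpoi x)).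
Proof.
apply: der_ext (derM (@der_id R) der_poi) => x //=.
by rewrite /xpoi; ring.
Qed.

Lemma B0_poi : B0 (@poi R).
Proof.
have [b p] := (bnd_xpoi, bnd_poi).
exists (fun x => -2 * (xpoi x * poi x)),
 (fun x => -2 * ((poi x - 2 * (xpoi x * xpoi x)) * poi x + xpoi x * (-2 * (xpoi x * poi x)))).
split; [exact: der_poi| |exact: bnd_poi| |].
- by apply: derZ; exact: derM der_xpoi der_poi.
- by bounded.
- by bounded.
Qed.

Lemma B0_xpoi : B0 xpoi.
Proof.
have [b p] := (bnd_xpoi, bnd_poi).
exists (fun x => poi x - 2 * (xpoi x * xpoi x)),
 (fun x => -2 * (xpoi x * poi x) - 2 * ((poi x - 2 * (xpoi x * xpoi x)) * xpoi x +
    xpoi x * (poi x - 2 * (xpoi x * xpoi x)))).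
split; [exact: der_xpoi| |exact: bnd_xpoi| |].
- by apply: derB; [exact: der_poi|apply: derZ; exact: derM der_xpoi der_xpoi].
- by bounded.
- by bounded.
Qed.

Lemma B0_cos c : B0 (fun x => cos (c * x)).
Proof.
have bc : bnd (fun x => cos (c * x)) by exists 1 => x; exact: cos_max.
have bs : bnd (fun x => sin (c * x)) by exists 1 => x; exact: sin_max.
exists (fun x => - (c * sin (c * x))), (fun x => - (c * (c * cos (c * x)))); split => //.
- exact: der_cosZ.
- by apply: derN; apply: derZ; exact: der_sinZ.
- by bounded.
- by bounded.
Qed.
Lemma B0_sin c : B0 (fun x => sin (c * x)).
Proof.
have bc : bnd (fun x => cos (c * x)) by exists 1 => x; exact: cos_max.
have bs : bnd (fun x => sin (c * x)) by exists 1 => x; exact: sin_max.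
exists (fun x => c * cos (c * x)), (fun x => c * - (c * sin (c * x))); split => //.
- exact: der_sinZ.
- by apply: derZ; exact: der_cosZ.
- by bounded.
- by bounded.
Qed.

Definition FC F t := It (fun x => F x * cos (t * x)).
Definition FS F t := It (fun x => F x * sin (t * x)).

Lemma intg_trig F w t : intg F -> continuous w -> (forall y, `|w y| <= 1) ->
  intg (fun x => F x * w (t * x)).
Proof.
move=> iF cw w1; apply: (intg_le _ (intg_abs iF)) => [|x].
  apply: borelM (intg_borel iF) _; apply: borel_comp (borel_cont cw) _.
  by apply: borelM; [exact: borel_cst|exact: borel_id].
by rewrite normrM ler_piMr.
Qed.
Lemma intg_cos F t : intg F -> intg (fun x => F x * cos (t * x)).
Proof. by move=> iF; apply: intg_trig iF (@continuous_cos R) _ => y; exact: cos_max. Qed.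
Lemma intg_sin F t : intg F -> intg (fun x => F x * sin (t * x)).
Proof. by move=> iF; apply: intg_trig iF (@continuous_sin R) _ => y; exact: sin_max. Qed.

Lemma der_FC F : intg F -> intg (fun x => x * F x) ->
  der (FC F) (fun t => - FS (fun x => x * F x) t).
Proof.
move=> iF ixF t.
have := @der_It R (fun t x => F x * cos (t * x)) (fun t x => - (x * F x * sin (t * x)))
  (fun x => `|x * F x|) t (fun t => intg_cos t iF) _ (intg_abs ixF) _.
rewrite ItN; last exact: intg_sin.
apply => [x|s x _]; last by rewrite normrN [leLHS]normrM ler_piMr// sin_max.
apply: der_ext (derZ (F x) (der_comp (@der_cos R) (der_scale x))) => y /=.
  by rewrite (mulrC x).
by rewrite (mulrC x y); ring.
Qed.
Lemma der_FS F : intg F -> intg (fun x => x * F x) ->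
  der (FS F) (FC (fun x => x * F x)).
Proof.
move=> iF ixF t.
have := @der_It R (fun t x => F x * sin (t * x)) (fun t x => x * F x * cos (t * x))
  (fun x => `|x * F x|) t (fun t => intg_sin t iF) _ (intg_abs ixF) _.
apply => [x|s x _]; last by rewrite [leLHS]normrM ler_piMr// cos_max.
apply: der_ext (derZ (F x) (der_comp (@der_sin R) (der_scale x))) => y /=.
  by rewrite (mulrC x).
by rewrite (mulrC x y); ring.
Qed.
Lemma bnd_FC F : intg F -> bnd (FC F).
Proof.
move=> iF; exists (It (fun x => `|F x|)) => t; apply: It_norm => [||x].
- by apply: intg_borel; exact: intg_cos.
- exact: intg_abs.
- by rewrite normrM ler_piMr// cos_max.
Qed.
Lemma bnd_FS F : intg F -> bnd (FS F).
Proof.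
move=> iF; exists (It (fun x => `|F x|)) => t; apply: It_norm => [||x].
- by apply: intg_borel; exact: intg_sin.
- exact: intg_abs.
- by rewrite normrM ler_piMr// sin_max.
Qed.
Lemma B0_FC F : intg F -> intg (fun x => x * F x) -> intg (fun x => x * (x * F x)) ->
  B0 (FC F).
Proof.
move=> i0 i1 i2.
exists (fun t => - FS (fun x => x * F x) t), (fun t => - FC (fun x => x * (x * F x)) t).
split; [exact: der_FC|by apply: derN; exact: der_FS|exact: bnd_FC| |].
  by apply: bndN; exact: bnd_FS.
by apply: bndN; exact: bnd_FC.
Qed.
Lemma B0_FS F : intg F -> intg (fun x => x * F x) -> intg (fun x => x * (x * F x)) ->
  B0 (FS F).
Proof.
move=> i0 i1 i2.
exists (FC (fun x => x * F x)), (fun t => - FS (fun x => x * (x * F x)) t).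
split; [exact: der_FS|exact: der_FC|exact: bnd_FS|exact: bnd_FC|].
by apply: bndN; exact: bnd_FS.
Qed.

(** The second derivative carries the same decay as the function because transforms are estimated
    through second differences. *)
Definition decay F := exists F1 F2 C, [/\ der F F1, der F1 F2,
  forall x, `|F x| <= C * poi x & forall x, `|F2 x| <= C * poi x].

(** Each term of the second derivative keeps a factor [poi], since the derivatives of [poi] are
    [poi] times polynomials in [poi] and [xpoi]. This is how all symbols below are shown to
    decay. *)
Lemma decay_poi G : B0 G -> decay (fun x => poi x * G x).
Proof.
move=> [G1 [G2 [dG dG1 bG bG1 bG2]]].
have [b p] := (bnd_xpoi, bnd_poi).
(* [p1] and [p2] are the first two derivatives of [poi], and [q2] is [p2] divided by [poi]. *)
pose p1 x := -2 * (xpoi x * poi x).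
pose q2 x := -2 * ((poi x - 2 * (xpoi x * xpoi x)) + xpoi x * (-2 * xpoi x)).
pose p2 x := -2 * ((poi x - 2 * (xpoi x * xpoi x)) * poi x + xpoi x * (-2 * (xpoi x * poi x))).
have dp1 : der p1 p2 by apply: derZ; exact: derM der_xpoi der_poi.
pose H x := q2 x * G x + (-2 * xpoi x) * G1 x + ((-2 * xpoi x) * G1 x + G2 x).
have [C0 C00 GC] := bnd_ge0 bG.
have bH : bnd H.
  by rewrite /H /q2; bounded.
have [C1 C10 HC] := bnd_ge0 bH.
exists (fun x => p1 x * G x + poi x * G1 x),
  (fun x => (p2 x * G x + p1 x * G1 x) + (p1 x * G1 x + poi x * G2 x)), (C0 + C1); split.
- by apply: derM => //; exact: der_poi.
- by apply: derD; apply: derM => //; exact: der_poi.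
- move=> x /=; rewrite normrM (ger0_norm (poi_ge0 x)) mulrC ler_wpM2r ?poi_ge0//.
  by apply: (le_trans (GC x)); rewrite lerDl.
- move=> x; rewrite (_ : _ + _ = poi x * H x); last first.
    by rewrite /H /q2 /p2 /p1; ring.
  rewrite normrM (ger0_norm (poi_ge0 x)) mulrC ler_wpM2r ?poi_ge0//.
  by apply: (le_trans (HC x)); rewrite lerDr.
Qed.

Lemma decay_borel F : decay F -> borel F.
Proof. by move=> [F1 [F2 [C [dF _ _ _]]]]; apply: borel_cont; exact: der_cont dF. Qed.
Lemma decay_intg F : decay F -> intg F.
Proof.
move=> dF; have mF := decay_borel dF; move: dF => [F1 [F2 [C [_ _ bF _]]]].
by apply: (intg_le mF) bF; apply: intgZ; exact: intg_poi.
Qed.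

(** Two applications of the mean value theorem give [F2 e * d ^+ 2] with [e] within 1 of [x]; then
    [poi_pert] replaces [poi e] by [4 * poi x]. *)
Lemma second_difference F : decay F -> exists2 C, 0 <= C & forall x d, 0 < d -> d <= 1 ->
  `|F (x + d) + F (x - d) - 2 * F x| <= C * d ^+ 2 * poi x.
Proof.
move=> [F1 [F2 [C [dF dF1 bF bF2]]]].
have C0 : 0 <= C.
  have := bF 0; rewrite /poi expr0n addr0 invr1 mulr1; exact: le_trans.
exists (C * 4); first by rewrite mulr_ge0.
move=> x d d0 d1.
have dG : der (fun t => F (t + d) - F t) (fun t => F1 (t + d) - F1 t).
  apply: derB => //; apply: der_ext (der_comp dF (derD (@der_id R) (der_cst d))) => t //=.
  by rewrite addr0 mul1r.
have [|c /andP[c1 c2] E] := der_mvt dG (a := x - d) (b := x); first by rewrite ltrBlDr ltrDl.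
have [|e /andP[e1 e2] E'] := der_mvt dF1 (a := c) (b := c + d); first by rewrite ltrDl.
rewrite (_ : _ - _ = F2 e * d ^+ 2); last first.
  transitivity (F (x + d) - F x - (F (x - d + d) - F (x - d))).
    by rewrite subrK; ring.
  by rewrite E E'; ring.
rewrite normrM (ger0_norm (sqr_ge0 d)) mulrAC ler_wpM2r ?sqr_ge0//.
rewrite (le_trans (bF2 e))// -mulrA ler_wpM2l//.
apply: (le_trans (poi_pert e x)); rewrite ler_wpM2r ?poi_ge0//.
have : (e - x) ^+ 2 <= 1.
  have a1 : 0 <= 1 - (e - x) by lra.
  have a2 : 0 <= 1 + (e - x) by lra.
  by rewrite -subr_ge0 (_ : 1 - _ = (1 - (e - x)) * (1 + (e - x))) ?mulr_ge0//; ring.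
by move=> ?; lra.
Qed.
End Symbols.
Arguments B0_cont {R F} _ x : rename.

(** * Decay of transforms and the convolution theorem *)

Section TrigKernels.
Variable R : realType.
Implicit Types (f g h F G H w : R -> R) (a b c d x y t C K : R).

Lemma poi_sqr_ge t : 1 <= `|t| -> (t ^+ 2)^-1 <= 2 * poi t.
Proof.
move=> t1; have t2 : 1 <= t ^+ 2 by rewrite -real_normK ?num_real// expr_ge1.
rewrite /poi ler_pdivlMr ?oneD_gt0// mulrC ler_pdivrMr; last by lra.
by lra.
Qed.

(* A shift of the variable by half a period [pi / t] changes the sign of
   [w (t x)], so two integrations by parts are replaced by a second difference. *)
Lemma trig_kernel F w : decay F -> continuous w -> (forall y, `|w y| <= 1) ->
  (forall y, w (y + pi) = - w y) ->
  exists C, kern C (fun t => It (fun x => F x * w (t * x))).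
Proof.
move=> dF cw w1 wpi; have iF := decay_intg dF.
have iFw t : intg (fun x => F x * w (t * x)) by exact: intg_trig.
have [K K0 FK] := second_difference dF.
have [F1 [F2 [C [_ _ bF _]]]] := dF.
have C0 : 0 <= C.
  by have := bF 0; rewrite /poi expr0n addr0 invr1 mulr1; exact: le_trans.
have wmpi y : w (y - pi) = - w y by rewrite -[y in RHS](subrK pi) wpi opprK.
exists (C * Ipoi R * (1 + pi ^+ 2) + K * pi ^+ 2 * Ipoi R); split.
  apply: borel_It; apply: borel2M; first by apply: borel2_snd; apply: intg_borel.
  apply: borel2_comp; first exact: borel_cont.
  by apply: borel2M; [apply: borel2_fst|apply: borel2_snd]; exact: borel_id.
move=> t; rewrite mulrDl.
have Ip := Ipoi_ge0 R.
have A0 : 0 <= C * Ipoi R * (1 + pi ^+ 2) * poi t.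
  by rewrite !mulr_ge0 ?poi_ge0// ltW// oneD_gt0.
have A1 : 0 <= K * pi ^+ 2 * Ipoi R * poi t.
  have P0 := sqr_ge0 (@pi R); have T0 := poi_ge0 t.
  by apply: mulr_ge0 => //; apply: mulr_ge0 => //; apply: mulr_ge0.
(* For |t| at most pi the integral of the modulus is enough, as [poi t] is then bounded below.
   Beyond pi the half period [d] is at most 1, as [second_difference] requires. *)
have [tpi|tpi] := leP `|t| pi.
  rewrite (@le_trans _ _ (C * Ipoi R * (1 + pi ^+ 2) * poi t))// ?lerDl//.
  apply: (@le_trans _ _ (C * Ipoi R)).
    rewrite /Ipoi -ItZ; last exact: intg_poi.
    apply: It_norm => [||x]; first by apply: intg_borel; apply: iFw.
      by apply: intgZ; exact: intg_poi.
    by rewrite normrM (le_trans _ (bF x))// ler_piMr.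
  rewrite -mulrA ler_peMr ?mulr_ge0//.
  rewrite /poi ler_pdivlMr ?oneD_gt0// mul1r lerD2l.
  by rewrite -(real_normK (num_real t)) ler_sqr ?nnegrE// pi_ge0.
have t0 : 0 < `|t| by rewrite (lt_trans _ tpi)// pi_gt0.
pose d := pi / `|t|.
have d0 : 0 < d by rewrite divr_gt0// pi_gt0.
have d1 : d <= 1 by rewrite ler_pdivrMr// mul1r ltW.
have wd y : w (y + t * d) = - w y /\ w (y - t * d) = - w y.
  have [t1|t1] := ltP 0 t.
    rewrite /d gtr0_norm// mulrCA divff ?gt_eqF// mulr1; by rewrite wpi wmpi.
  have tn0 : t != 0 by rewrite -normr_gt0.
  have -> : t * d = - pi by rewrite /d ler0_norm//; field.
  by rewrite opprK wpi wmpi.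
have S1 : It (fun x => F (x + d) * w (t * x)) = - It (fun x => F x * w (t * x)).
  rewrite -(It_shift d (iFw t)) -ItN; last by have := intg_shift d (iFw t).
  by apply: eq_It => x; rewrite mulrDr (wd _).1 mulrN opprK.
have S2 : It (fun x => F (x - d) * w (t * x)) = - It (fun x => F x * w (t * x)).
  rewrite -(It_shift (- d) (iFw t)) -ItN; last by have := intg_shift (- d) (iFw t).
  by apply: eq_It => x; rewrite mulrDr mulrN (wd _).2 mulrN opprK.
have i1 : intg (fun x => F (x + d) * w (t * x)).
  by apply: intg_trig => //; exact: intg_shift.
have i2 : intg (fun x => F (x - d) * w (t * x)).
  by apply: intg_trig => //; exact: intg_shift.
(* Both translates contribute the negative of the integral, and the middle term contributes it twice
   negatively: hence - 4. *)
have S : It (fun x => (F (x + d) + F (x - d) - 2 * F x) * w (t * x)) =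
    - 4 * It (fun x => F x * w (t * x)).
  transitivity (It (fun x => (F (x + d) * w (t * x) + F (x - d) * w (t * x)) - 2 * (F x * w (t * x)))).
    by apply: eq_It => x; ring.
  rewrite ItB; [|exact: intgD|exact: intgZ].
  by rewrite ItD// ItZ// S1 S2; ring.
have B : `|It (fun x => (F (x + d) + F (x - d) - 2 * F x) * w (t * x))| <= K * d ^+ 2 * Ipoi R.
  rewrite /Ipoi -ItZ; last exact: intg_poi.
  apply: It_norm => [||x].
  - apply: intg_borel; apply: intg_trig => //; apply: intgB; last exact: intgZ.
    by apply: intgD; exact: intg_shift.
  - by apply: intgZ; exact: intg_poi.
  - by rewrite normrM (le_trans _ (FK x d d0 d1))// ler_piMr.
rewrite (@le_trans _ _ (K * pi ^+ 2 * Ipoi R * poi t))// ?lerDr//.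
move: B; rewrite S normrM normrN [X in X * _]ger0_norm// => B.
have t2 : 1 <= `|t| by rewrite (le_trans _ (ltW tpi))// (le_trans _ (pi_ge2 R))// ler1n.
have dp : d ^+ 2 <= pi ^+ 2 * (2 * poi t).
  rewrite /d expr_div_n real_normK ?num_real// ler_wpM2l ?sqr_ge0//.
  exact: poi_sqr_ge.
have : K * d ^+ 2 * Ipoi R <= K * (pi ^+ 2 * (2 * poi t)) * Ipoi R.
  by rewrite ler_wpM2r// ler_wpM2l.
have -> : K * (pi ^+ 2 * (2 * poi t)) * Ipoi R = 2 * (K * pi ^+ 2 * Ipoi R * poi t) by ring.
move: A1 B; lra.
Qed.

Lemma FC_kern F : decay F -> exists C, kern C (FC F).
Proof.
move=> dF; apply: (trig_kernel dF (@continuous_cos R)) => y; first exact: cos_max.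
exact: cosDpi.
Qed.
Lemma FS_kern F : decay F -> exists C, kern C (FS F).
Proof.
move=> dF; apply: (trig_kernel dF (@continuous_sin R)) => y; first exact: sin_max.
exact: sinDpi.
Qed.

Lemma FCD F G t : intg F -> intg G -> FC (fun x => F x + G x) t = FC F t + FC G t.
Proof.
move=> iF iG; rewrite /FC -ItD; [|exact: intg_cos..].
by apply: eq_It => x; rewrite mulrDl.
Qed.
Lemma FSD F G t : intg F -> intg G -> FS (fun x => F x + G x) t = FS F t + FS G t.
Proof.
move=> iF iG; rewrite /FS -ItD; [|exact: intg_sin..].
by apply: eq_It => x; rewrite mulrDl.
Qed.
Lemma FCZ c F t : intg F -> FC (fun x => c * F x) t = c * FC F t.
Proof.
move=> iF; rewrite /FC -ItZ; last exact: intg_cos.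
by apply: eq_It => x; rewrite mulrA.
Qed.
Lemma FSZ c F t : intg F -> FS (fun x => c * F x) t = c * FS F t.
Proof.
move=> iF; rewrite /FS -ItZ; last exact: intg_sin.
by apply: eq_It => x; rewrite mulrA.
Qed.

Lemma FC_borel F : borel F -> borel (FC F).
Proof.
move=> mF; apply: borel_It; apply: borel2M; first exact: borel2_snd.
apply: borel2_comp; first by apply: borel_cont; apply: continuous_cos.
by apply: borel2M; [apply: borel2_fst|apply: borel2_snd]; exact: borel_id.
Qed.
Lemma FS_borel F : borel F -> borel (FS F).
Proof.
move=> mF; apply: borel_It; apply: borel2M; first exact: borel2_snd.
apply: borel2_comp; first by apply: borel_cont; apply: continuous_sin.
by apply: borel2M; [apply: borel2_fst|apply: borel2_snd]; exact: borel_id.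
Qed.

Lemma It_trig_fubini F w (T : R -> R) t : intg F -> intg w -> continuous T ->
  (forall y, `|T y| <= 1) ->
  It (fun s => w s * It (fun x => F x * T ((t - s) * x))) =
  It (fun x => F x * It (fun s => w s * T ((t - s) * x))).
Proof.
move=> iF iw cT T1.
have mT : borel2 (fun s x => T ((t - s) * x)).
  apply: borel2_comp; first exact: borel_cont.
  apply: borel2M; last by apply: borel2_snd; exact: borel_id.
  by apply: borel2_fst; exact: borel_aff.
have i1 s : intg (fun x => F x * T ((t - s) * x)) by exact: intg_trig.
have i2 x : intg (fun s => w s * T ((t - s) * x)).
  apply: (intg_le _ (intg_abs iw)) => [|s].
    by apply: borelM; [exact: intg_borel|exact: borel2_l mT].
  by rewrite normrM ler_piMr.
pose G s x := w s * (F x * T ((t - s) * x)).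
have mG : borel2 G.
  apply: borel2M; first by apply: borel2_fst; apply: intg_borel.
  by apply: borel2M => //; by apply: borel2_snd; apply: intg_borel.
have [||||_ _ E] := It_fubini_intg (F := G)
   (h := fun s => It (fun x => `|F x|) * `|w s|) mG.
- by move=> s; exact: intgZ.
- move=> x; have := intgZ (F x) (i2 x); congr intg; apply/funext => s.
  by rewrite /G mulrCA.
- by apply: intgZ; exact: intg_abs.
- move=> s; rewrite -ItZr; last exact: intg_abs.
  apply: le_It => [||x]; first by apply: intg_abs; exact: intgZ.
    by under eq_fun do rewrite mulrC; apply: intgZ; exact: intg_abs.
  by rewrite /G !normrM mulrC ler_wpM2r// ler_piMr.
- transitivity (It (fun s => It (G s))).
    by apply: eq_It => s; rewrite -ItZ.
  rewrite E; apply: eq_It => x; rewrite -ItZ//.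
  by apply: eq_It => s; rewrite /G mulrCA.
Qed.

Lemma convol_refl f g x : intg (fun y => f (x - y) * g y) ->
  convol f g x = It (fun s => f s * g (x - s)).
Proof.
move=> i; rewrite /convol -(It_comp_aff x i); apply: eq_It => y.
by rewrite subKr.
Qed.

(** Convolving a transform with [w] multiplies the function under it by the transform of [w]: after
    an exchange of integrals the addition formula splits cos (t x - s x). *)
Lemma convol_FC C w F t : kern C w -> intg F ->
  convol w (FC F) t = FC (fun x => F x * FC w x) t + FS (fun x => F x * FS w x) t.
Proof.
move=> kw iF; have iw := kern_intg kw; have mF := intg_borel iF.
have [B FB] := bnd_FC iF.
have tF : tame (FC F) by apply: (tame_bounded _ FB); exact: FC_borel.
rewrite convol_refl; last exact: convol_intg kw tF.
rewrite (It_trig_fubini t iF iw (@continuous_cos R) (@cos_max R)).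
have bnd_int (G : R -> R) : borel G -> bnd G -> intg (fun x => F x * G x).
  move=> mG [D GD]; apply: (@intg_le _ _ (fun x => D * `|F x|)); [exact: borelM|by apply: intgZ; apply: intg_abs|].
  by move=> x; rewrite normrM mulrC ler_wpM2r.
have j1 : intg (fun x => F x * FC w x).
  by apply: bnd_int; [by apply: FC_borel; apply: intg_borel|exact: bnd_FC].
have j2 : intg (fun x => F x * FS w x).
  by apply: bnd_int; [by apply: FS_borel; apply: intg_borel|exact: bnd_FS].
rewrite [in RHS]/FC [X in _ + X]/FS -ItD; [|exact: intg_cos|exact: intg_sin].
apply: eq_It => x; rewrite -!mulrA -mulrDr; congr (_ * _).
transitivity (It (fun s => cos (t * x) * (w s * cos (x * s)) + sin (t * x) * (w s * sin (x * s)))).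
  by apply: eq_It => s; rewrite mulrBl cosB (mulrC s x); ring.
rewrite ItD; [|by apply: intgZ; apply: intg_cos|by apply: intgZ; apply: intg_sin].
by rewrite !ItZ; [rewrite /FC /FS; ring|exact: intg_sin|exact: intg_cos].
Qed.

Lemma convol_FS C w F t : kern C w -> intg F ->
  convol w (FS F) t = FS (fun x => F x * FC w x) t - FC (fun x => F x * FS w x) t.
Proof.
move=> kw iF; have iw := kern_intg kw; have mF := intg_borel iF.
have [B FB] := bnd_FS iF.
have tF : tame (FS F) by apply: (tame_bounded _ FB); exact: FS_borel.
rewrite convol_refl; last exact: convol_intg kw tF.
rewrite (It_trig_fubini t iF iw (@continuous_sin R) (@sin_max R)).
have bnd_int (G : R -> R) : borel G -> bnd G -> intg (fun x => F x * G x).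
  move=> mG [D GD]; apply: (@intg_le _ _ (fun x => D * `|F x|)); [exact: borelM|by apply: intgZ; apply: intg_abs|].
  by move=> x; rewrite normrM mulrC ler_wpM2r.
have j1 : intg (fun x => F x * FC w x).
  by apply: bnd_int; [by apply: FC_borel; apply: intg_borel|exact: bnd_FC].
have j2 : intg (fun x => F x * FS w x).
  by apply: bnd_int; [by apply: FS_borel; apply: intg_borel|exact: bnd_FS].
rewrite [X in X - _]/FS [X in _ - X]/FC -ItB; [|exact: intg_sin|exact: intg_cos].
apply: eq_It => x; rewrite -!mulrA -mulrBr; congr (_ * _).
transitivity (It (fun s => sin (t * x) * (w s * cos (x * s)) - cos (t * x) * (w s * sin (x * s)))).
  by apply: eq_It => s; rewrite mulrBl sinB (mulrC s x); ring.
rewrite ItB; [|by apply: intgZ; apply: intg_cos|by apply: intgZ; apply: intg_sin].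
by rewrite !ItZ; [rewrite /FC /FS; ring|exact: intg_sin|exact: intg_cos].
Qed.
End TrigKernels.

(** * Symbols of the Steklov averages *)

Section StekSymbols.
Variable R : realType.
Implicit Types (f g h F G u : R -> R) (a b c d v x y t C K : R).

(** Windows of the forward and of the central average at h = 1: convolution with [w1] averages over
    [x, x + 1], convolution with [w2] over [x - 1/2, x + 1/2]. *)
Definition w1 : R -> R := \1_`[-1, 0]%classic.
Definition w2 : R -> R := \1_`[- 2^-1, 2^-1]%classic.
(** [h1] and [h2] are successive antiderivatives of [w1] on [-1, 0] that vanish at -1. Integration
    by parts with them extracts the powers of x from 1 - m. *)
Definition h1 v := (1 + v) * w1 v.
Definition h2 v := (1 + v) ^+ 2 / 2 * w1 v.
(* With [m = mr + i mi] the symbol of the forward average and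
   [n = nr + i ni]: [1 - m = - i x n]. *)
Definition mr : R -> R := FC w1.
Definition mi x := - FS w1 x.
Definition nr : R -> R := FC h1.
Definition ni x := - FS h1 x.

Lemma itvE a b x : \1_(`[a, b]%classic) x = (a <= x <= b)%R%:R :> R.
Proof. by rewrite indicE mem_setE. Qed.

Lemma kern_itv a b : exists C, kern C (\1_`[a, b]%classic : R -> R).
Proof.
exists (1 + (`|a| + `|b|) ^+ 2); split=> [|t]; first exact: borel_itv.
rewrite itvE; case: (boolP (a <= t <= b)) => [/andP[at_ tb]|_]; last first.
  by rewrite normr0 mulr_ge0 ?poi_ge0// ltW// oneD_gt0.
rewrite normr1 /poi ler_pdivlMr ?oneD_gt0// mul1r lerD2l.
rewrite -(real_normK (num_real t)) ler_sqr ?nnegrE ?addr_ge0//.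
rewrite ler_norml; apply/andP; split.
  by rewrite lerNl (le_trans _ (_ : `|a| <= _)) ?lerDl// lerNl -normrN (le_trans _ at_)// lerNl ler_norm.
by rewrite (le_trans tb)// (le_trans (ler_norm b))// lerDr.
Qed.

Lemma intg_w (f : R -> R) a b : continuous f ->
  [/\ intg (fun x => f x * \1_(`[a, b]%classic) x),
      intg (fun x => x * (f x * \1_(`[a, b]%classic) x)) &
      intg (fun x => x * (x * (f x * \1_(`[a, b]%classic) x)))].
Proof.
move=> cf; have c1 : continuous (fun x : R => x) by exact: der_cont (@der_id R).
have c2 : continuous (fun x : R => x * x) by exact: der_cont (derM (@der_id R) (@der_id R)).
split; first exact: intg_itv_cont.
  under eq_fun do rewrite mulrA; apply: intg_itv_cont => x.
  exact: (@continuousM _ _ _ f x (c1 x) (cf x)).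
have i : intg (fun x => x * x * f x * \1_`[a, b] x).
  by apply: intg_itv_cont => x; exact: (@continuousM _ _ _ f x (c2 x) (cf x)).
by under eq_fun do rewrite !mulrA.
Qed.

Lemma der_1v : der (fun v => 1 + v) (fun=> 1).
Proof. by apply: der_ext (derD (@der_cst R 1) (@der_id R)) => x //=; rewrite add0r. Qed.
Lemma der_1v2 : der (fun v => (1 + v) ^+ 2 / 2) (fun v => 1 + v).
Proof.
apply: der_ext (derZ 2^-1 (derM der_1v der_1v)) => x /=; first by field.
by field.
Qed.

Lemma intg_w1 : [/\ intg w1, intg (fun x => x * w1 x) & intg (fun x => x * (x * w1 x))].
Proof.
have := @intg_w (fun=> 1) (-1) 0 (der_cont (der_cst 1)).
have -> : (fun x => 1 * \1_(`[-1, 0]%classic) x) = w1 by apply/funext => x; rewrite mul1r.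
have e x : 1 * \1_(`[-1, 0]%classic) x = w1 x by rewrite mul1r.
by under eq_fun do rewrite e; under [X in [/\ _, _ & intg X]]eq_fun do rewrite e.
Qed.
Lemma intg_w2 : [/\ intg w2, intg (fun x => x * w2 x) & intg (fun x => x * (x * w2 x))].
Proof.
have := @intg_w (fun=> 1) (- 2^-1) 2^-1 (der_cont (der_cst 1)).
have -> : (fun x => 1 * \1_(`[- 2^-1, 2^-1]%classic) x) = w2 by apply/funext => x; rewrite mul1r.
have e x : 1 * \1_(`[- 2^-1, 2^-1]%classic) x = w2 x by rewrite mul1r.
by under eq_fun do rewrite e; under [X in [/\ _, _ & intg X]]eq_fun do rewrite e.
Qed.
Lemma intg_h1 : [/\ intg h1, intg (fun x => x * h1 x) & intg (fun x => x * (x * h1 x))].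
Proof. exact: intg_w (der_cont der_1v). Qed.
Lemma intg_h2 : [/\ intg h2, intg (fun x => x * h2 x) & intg (fun x => x * (x * h2 x))].
Proof. exact: intg_w (der_cont der_1v2). Qed.

Lemma B0_mr : B0 mr. Proof. by have [] := intg_w1; exact: B0_FC. Qed.
Lemma B0_mi : B0 mi. Proof. by have [] := intg_w1 => *; apply: B0N; exact: B0_FS. Qed.
Lemma B0_nr : B0 nr. Proof. by have [] := intg_h1; exact: B0_FC. Qed.
Lemma B0_ni : B0 ni. Proof. by have [] := intg_h1 => *; apply: B0N; exact: B0_FS. Qed.

Lemma ftc_w1 F f : der F f -> continuous f ->
  It (fun v => f v * w1 v) = F 0 - F (-1).
Proof. by move=> dF cf; apply: ftc => //; rewrite lerN10. Qed.

(** The primitive [(1 + v) * cos (x * v)] has boundary values 1 at v = 0 and 0 at v = -1. *)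
Lemma mr_ni x : 1 - mr x = x * ni x.
Proof.
have dF := derM der_1v (der_cosZ x).
have cf : continuous (fun v => 1 * cos (x * v) + (1 + v) * - (x * sin (x * v))).
  apply: der_cont (derD (derZ 1 (der_cosZ x)) (derM der_1v (derN (derZ x (der_sinZ x))))).
have := ftc_w1 dF cf; rewrite mulr0 cos0 subrr mul0r subr0 addr0 mulr1 => E.
apply/eqP; rewrite subr_eq eq_sym; apply/eqP; rewrite -E /mr /ni /FC /FS.
have [i1 _ _] := intg_w1; have [j1 _ _] := intg_h1.
rewrite mulrN -ItZ; last exact: intg_sin.
rewrite addrC -ItB; [|exact: intg_cos|by apply: intgZ; exact: intg_sin].
by apply: eq_It => v; rewrite /h1; ring.
Qed.

Lemma mi_nr x : mi x = x * nr x.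
Proof.
have dF := derM der_1v (der_sinZ x).
have cf : continuous (fun v => 1 * sin (x * v) + (1 + v) * (x * cos (x * v))).
  apply: der_cont (derD (derZ 1 (der_sinZ x)) (derM der_1v (derZ x (der_cosZ x)))).
have := ftc_w1 dF cf; rewrite mulr0 sin0 mulr0 subrr mul0r subr0 => E.
have [i1 _ _] := intg_w1; have [j1 _ _] := intg_h1.
rewrite /mi /nr /FC /FS -ItZ; last exact: intg_cos.
apply/eqP; rewrite eq_sym -addr_eq0 -ItD; [|by apply: intgZ; exact: intg_cos|exact: intg_sin].
by apply/eqP; rewrite -[RHS]E; apply: eq_It => v; rewrite /h1; ring.
Qed.

Lemma mr_sin x : x * mr x = sin x.
Proof.
have := ftc_w1 (der_sinZ x) (der_cont (derZ x (der_cosZ x))).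
rewrite mulr0 sin0 mulrN1 sinN sub0r opprK => <-.
have [i1 _ _] := intg_w1; rewrite /mr /FC -ItZ; last exact: intg_cos.
by apply: eq_It => v; ring.
Qed.

Lemma mi_cos x : x * mi x = 1 - cos x.
Proof.
have := ftc_w1 (der_cosZ x) (der_cont (derN (derZ x (der_sinZ x)))).
rewrite mulr0 cos0 mulrN1 cosN => <-.
have [i1 _ _] := intg_w1; rewrite /mi /FS mulrN -ItZ; last exact: intg_sin.
rewrite -ItN; last by apply: intgZ; exact: intg_sin.
by apply: eq_It => v; ring.
Qed.

(** A second integration by parts. With [mr_ni] it shows that [1 - mr] vanishes to second order at
    0, and at x / 2 this is the symbol of I - A ([av_bb]). *)
Lemma ni_h2 x : ni x = x * FC h2 x.
Proof.
have dF := derM der_1v2 (der_sinZ x).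
have cf : continuous (fun v => (1 + v) * sin (x * v) + (1 + v) ^+ 2 / 2 * (x * cos (x * v))).
  apply: der_cont (derD (derM der_1v (der_sinZ x)) (derM der_1v2 (derZ x (der_cosZ x)))).
have := ftc_w1 dF cf; rewrite mulr0 sin0 mulr0 subrr expr0n/= !mul0r subr0 => E.
have [i1 _ _] := intg_h1; have [j1 _ _] := intg_h2.
rewrite /ni /FC /FS -ItZ; last exact: intg_cos.
apply/eqP; rewrite eq_sym -addr_eq0 -ItD; [|by apply: intgZ; exact: intg_cos|exact: intg_sin].
by apply/eqP; rewrite -[RHS]E; apply: eq_It => v; rewrite /h1 /h2; ring.
Qed.

Lemma nr_cos x : x ^+ 2 * nr x = 1 - cos x.
Proof. by rewrite -mi_cos mi_nr; ring. Qed.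

Lemma nr0 : nr 0 = 2^-1.
Proof.
have := ftc_w1 der_1v2 (der_cont der_1v).
rewrite subrr addr0 expr0n expr1n/= mul0r subr0 mul1r => <-.
by apply: eq_It => v; rewrite mul0r cos0 mulr1.
Qed.

(** Both sides are sin (x / 2) / (x / 2); the point 0 is treated apart because the identity is
    obtained after multiplication by x / 2. *)
Lemma w2_sin x : FC w2 x = mr (x / 2).
Proof.
have [->|x0] := eqVneq x 0.
  rewrite mul0r /mr /FC.
  transitivity (It (fun v => 1 * w2 v)).
    by apply: eq_It => v; rewrite mul0r cos0 mulr1 mul1r.
  rewrite (ftc (@der_id R)); [|exact: (der_cont (der_cst _))|by lra].
  transitivity (It (fun v => 1 * w1 v)).
    rewrite (ftc (@der_id R)); [by field|exact: (der_cont (der_cst _))|by lra].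
  by apply: eq_It => v; rewrite mul0r cos0 mulr1 mul1r.
have x20 : x / 2 != 0 by rewrite mulf_neq0// invr_neq0.
apply: (mulfI x20); rewrite mr_sin.
have : It (fun v => x * cos (x * v) * w2 v) = sin (x * 2^-1) - sin (x * - 2^-1).
  by apply: (ftc (der_sinZ x) (der_cont (derZ x (der_cosZ x)))); lra.
rewrite mulrN sinN opprK => E.
have [i1 _ _] := intg_w2.
have {}E : x * FC w2 x = sin (x / 2) + sin (x / 2).
  by rewrite -E /FC -ItZ; [apply: eq_It => v; ring|exact: intg_cos].
by rewrite mulrAC E; field.
Qed.

Lemma w2_odd x : FS w2 x = 0.
Proof.
have [i1 _ _] := intg_w2.
have := It_opp (intg_sin x i1).
have -> : It (fun v => w2 (- v) * sin (x * - v)) = - FS w2 x.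
  rewrite /FS -ItN; last exact: intg_sin.
  apply: eq_It => v; rewrite mulrN sinN mulrN /w2 !itvE.
  by rewrite lerN2 lerNl [in RHS]andbC.
by rewrite -[X in _ = X -> _]/(FS w2 x) => E; lra.
Qed.

(** As 1 - m = - i x n, this is |n|^2 + |1 - m|^2 ([QnE]). The weight compensates the decay of n, so
    that [Qn] is bounded from above and away from 0, and 1 / |n|^2 = (1 + x^2) / Qn. *)
Definition Qn x := (nr x ^+ 2 + ni x ^+ 2) * (1 + x ^+ 2).
Lemma QnE x : Qn x = nr x * nr x + ni x * ni x + ((1 - mr x) * (1 - mr x) + mi x * mi x).
Proof. by rewrite /Qn mr_ni mi_nr; ring. Qed.
Lemma B0_Qn : B0 Qn.
Proof.
apply: (B0_ext (F := fun x => nr x * nr x + ni x * ni x +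
  ((1 - mr x) * (1 - mr x) + mi x * mi x))) => [x|]; first by rewrite QnE.
have [[? ?] [? ?]] := ((B0_mr, B0_mi), (B0_nr, B0_ni)).
by apply: B0D; apply: B0D; apply: B0M => //; apply: B0B => //; exact: B0_cst.
Qed.

Lemma cos_half_gt0 : 0 < cos (2^-1 : R).
Proof. by apply: cos_gt0_pihalf; have := pi_ge2 R => p2; apply/andP; split; lra. Qed.

Lemma cos_decr x y : 0 <= x -> x < y -> y <= pi -> cos y < cos x.
Proof.
move=> x0 xy yp.
have hx : x \in `[0, pi].
  by rewrite in_itv/=; apply/andP; split; [exact: x0|exact: le_trans (ltW xy) yp].
have hy : y \in `[0, pi].
  by rewrite in_itv/=; apply/andP; split; [exact: le_trans x0 (ltW xy)|exact: yp].
by rewrite ltr_cos.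
Qed.

Lemma cos_half_lt1 : cos (2^-1 : R) < 1.
Proof.
rewrite -[ltRHS]cos0; apply: cos_decr => //.
by have p2 := pi_ge2 R; lra.
Qed.

Lemma cos_ge_half x : `|x| <= 2^-1 -> cos (2^-1) <= cos x.
Proof.
rewrite -(cos_norm x) le_eqVlt => /predU1P[->//|x1].
apply/ltW/cos_decr => //; by have p2 := pi_ge2 R; lra.
Qed.

Lemma cos_le_half x : 2^-1 <= `|x| -> `|x| <= 2 -> cos x <= cos (2^-1).
Proof.
rewrite -(cos_norm x) le_eqVlt => /predU1P[->//|x1] x2.
apply/ltW/cos_decr => //; by have p2 := pi_ge2 R; lra.
Qed.

Lemma nr_ge_half x : `|x| <= 2^-1 -> cos (2^-1) / 2 <= nr x.
Proof.
move=> x1; rewrite -[X in _ * X <= _]nr0 /nr /FC; have [i1 _ _] := intg_h1.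
rewrite mulrC -ItZr; last exact: intg_cos.
apply: le_It => [||v].
- by under eq_fun do rewrite mulrC; apply: intgZ; exact: intg_cos.
- exact: intg_cos.
- rewrite mul0r cos0 mulr1 /h1 /w1 itvE.
  case: (boolP (-1 <= v <= 0)) => [/andP[v1 v2]|_]; last by rewrite !mulr0 !mul0r.
  rewrite mulr1 ler_wpM2l//; first by lra.
  apply: cos_ge_half; rewrite normrM (le_trans _ x1)// ler_piMr//.
  by rewrite ler_norml v1 (le_trans v2).
Qed.

Lemma nr_ge0 x : 0 <= nr x.
Proof.
have [->|x0] := eqVneq x 0; first by rewrite nr0 invr_ge0.
have x2 : 0 < x ^+ 2 by rewrite exprn_even_gt0.
by rewrite -(pmulr_rge0 _ x2) nr_cos subr_ge0 cos_le1.
Qed.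

(** Three ranges of |x|. Up to 1/2, [nr] stays above a multiple of its value at 0. Between 1/2 and
    2, x^2 nr = 1 - cos x is bounded below. Beyond 2, |mr| = |sin x / x| is at most 1/2, so 1 - mr
    is at least 1/2. *)
Lemma Qn_lb : exists2 c : R, 0 < c & forall x, c <= Qn x.
Proof.
have c1 := cos_half_gt0; have c2 := cos_half_lt1.
pose a := cos (2^-1 : R) / 2; pose b := (1 - cos (2^-1 : R)) / 4.
have a0 : 0 < a by rewrite divr_gt0.
have b0 : 0 < b by rewrite divr_gt0// subr_gt0.
exists (Num.min (4^-1) (Num.min (a ^+ 2) (b ^+ 2))).
  by rewrite !lt_min invr_gt0 ltr0n !exprn_gt0.
have nrQ x : nr x ^+ 2 <= Qn x.
  rewrite /Qn mulrDl mulrDr mulr1 -addrA lerDl addr_ge0//.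
    by rewrite mulr_ge0// sqr_ge0.
  by rewrite mulr_ge0 ?sqr_ge0// ltW// oneD_gt0.
move=> x; have [x1|x1] := leP `|x| 2^-1.
  rewrite !ge_min; apply/orP; right; apply/orP; left.
  by rewrite (le_trans _ (nrQ x))// ler_sqr ?nnegrE ?nr_ge0 ?(ltW a0)// nr_ge_half.
have [x2|x2] := leP `|x| 2.
  rewrite !ge_min; apply/orP; right; apply/orP; right.
  rewrite (le_trans _ (nrQ x))// ler_sqr ?nnegrE ?nr_ge0 ?(ltW b0)//.
  have x20 : 0 < x ^+ 2 by rewrite exprn_even_gt0//= -normr_gt0 (lt_trans _ x1).
  rewrite -(ler_pM2l x20) nr_cos.
  have x4 : x ^+ 2 <= 4.
    by rewrite -(real_normK (num_real x)) (_ : 4 = 2 ^+ 2) ?ler_sqr ?nnegrE//; ring.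
  have := cos_le_half (ltW x1) x2; have : x ^+ 2 * b <= 4 * b by rewrite ler_pM2r.
  by rewrite {2}/b; lra.
rewrite !ge_min; apply/orP; left.
have mx : `|mr x| <= 2^-1.
  have := sin_max x; rewrite -mr_sin normrM => H.
  have : 2 * `|mr x| <= `|x| * `|mr x| by rewrite ler_wpM2r// ltW.
  by lra.
have : 2^-1 <= 1 - mr x by move: mx; rewrite ler_norml => /andP[_]; lra.
move=> H; rewrite QnE.
have : 2^-1 * 2^-1 <= (1 - mr x) * (1 - mr x) by rewrite ler_pM.
have := sqr_ge0 (nr x); have := sqr_ge0 (ni x); have := sqr_ge0 (mi x).
by rewrite !expr2 (_ : 4^-1 = 2^-1 * 2^-1); [lra|field].
Qed.

(** From nr = poi (nr + x^2 nr), where x^2 nr = 1 - cos x has bounded derivatives. *)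
Lemma decay_nr : decay nr.
Proof.
have : decay (fun x => poi x * (nr x + (1 - cos (1 * x)))).
  apply: decay_poi; apply: B0D; first exact: B0_nr.
  by apply: B0B; [exact: B0_cst|exact: B0_cos].
congr decay; apply/funext => x; rewrite mul1r -nr_cos -[X in X + _]mul1r -mulrDl.
by rewrite mulrA poi1P mul1r.
Qed.

(* Normalising constant of the Fourier transform; only its positivity is used. *)
Definition c0 := It nr.
Lemma c0_gt0 : 0 < c0.
Proof.
have a0 : 0 < cos (2^-1 : R) / 2 by rewrite divr_gt0// cos_half_gt0.
apply: (lt_le_trans a0).
have <- : It (fun v => cos (2^-1 : R) / 2 * w2 v) = cos (2^-1 : R) / 2.
  rewrite (ftc (der_scale _)); [by field|exact: (der_cont (der_cst _))|by lra].
apply: le_It => [||v].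
- by apply: intgZ; have [] := intg_w2.
- exact: decay_intg decay_nr.
- rewrite /w2 itvE; case: (boolP (_ <= v <= _)) => [|_]; last by rewrite mulr0 nr_ge0.
  by move=> v1; rewrite mulr1 nr_ge_half// ler_norml.
Qed.

Lemma nr_even x : nr (- x) = nr x.
Proof. by rewrite /nr /FC; apply: eq_It => v; rewrite mulNr cosN. Qed.

(** The integrand is (1 - cos (a x)) / x^2, whose integral is proportional to |a|. Piecewise linear
    kernels are thereby recovered from their transforms. *)
Lemma It_nr_scale a : intg (fun x => a ^+ 2 * nr (a * x)) /\
  It (fun x => a ^+ 2 * nr (a * x)) = `|a| * c0.
Proof.
have i := decay_intg decay_nr.
have pos b : 0 < b -> intg (fun x => b ^+ 2 * nr (b * x)) /\
  It (fun x => b ^+ 2 * nr (b * x)) = b * c0.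
  move=> b0; have [j E] := It_dilate_intg b0 i.
  split; first exact: intgZ.
  by rewrite (ItZ _ j) E -[It nr]/c0 mulrA expr2 mulfK// gt_eqF.
have [a0|a0|->] := ltrgt0P a.
- exact: pos.
- have na0 : 0 < - a by rewrite oppr_gt0.
  have [] := pos _ na0; rewrite sqrrN.
  have -> : (fun x => a ^+ 2 * nr (- a * x)) = (fun x => a ^+ 2 * nr (a * x)).
    by apply/funext => x; rewrite mulNr nr_even.
  by [].
- have -> : (fun x => 0 ^+ 2 * nr (0 * x)) = (fun=> 0 : R).
    by apply/funext => x; rewrite expr0n mul0r.
  by rewrite mul0r It0; split => //; exact: intg0.
Qed.
End StekSymbols.

(** * Kernels of the Steklov averages *)

Section StekKernels.
Variable R : realType.
Implicit Types (f g h k F G H u Fr Fi : R -> R) (a b c d v x y t C K : R).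

Lemma der_convol C C' k k' u : kern C k -> kern C' k' -> der k k' -> tame u ->
  der (convol k u) (convol k' u).
Proof.
move=> kk kk' dk tu a; have C0 := kern_ge0 kk'.
apply: (@der_It R (fun x y => k (x - y) * u y) (fun x y => k' (x - y) * u y)
  (fun y => C' * 4 * (poi (a - y) * `|u y|))).
- by move=> x; exact: convol_intg kk tu.
- move=> y; apply: der_ext (derM (der_comp dk (derB (@der_id R) (der_cst y))) (der_cst (u y))) => x //=.
  by rewrite mulr0 addr0 subr0 mul1r.
- by apply: intgZ; exact: pmax_intg.
- move=> x y xa; rewrite normrM mulrA ler_wpM2r//; case: kk' => _ /(_ (x - y)) => H.
  apply: (le_trans H); rewrite -mulrA ler_wpM2l//.
  apply: (le_trans (poi_pert _ (a - y))); rewrite ler_wpM2r ?poi_ge0//.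
  have -> : x - y - (a - y) = x - a by ring.
  have : (x - a) ^+ 2 <= 1.
    by rewrite -(real_normK (num_real _)) expr_le1// ltW.
  by move=> ?; lra.
Qed.

Definition Ad u := convol (@w1 R) u.
Definition Av u := convol (@w2 R) u.
Definition Dd u := fun x => u x - Ad u x.

Lemma kern_w1 : exists C, kern C (@w1 R). Proof. exact: kern_itv. Qed.
Lemma kern_w2 : exists C, kern C (@w2 R). Proof. exact: kern_itv. Qed.

Lemma opk_Ad : opk Ad.
Proof. by have [C kw] := kern_w1; exact: opk_convol kw. Qed.
Lemma opk_Av : opk Av.
Proof. by have [C kw] := kern_w2; exact: opk_convol kw. Qed.
Lemma opc_Dd : opc Dd.
Proof. by apply: opcB; [exact: opc_id|apply: opk_opc; exact: opk_Ad]. Qed.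

(** Moves the difference onto the kernel. Dividing a symbol by 1 - m thus reduces to computing
    [Dd k] for a candidate kernel k. *)
Lemma convol_Dd C k u : kern C k -> tame u -> convol k (Dd u) = convol (Dd k) u.
Proof.
move=> kk tu; have [Cw kw] := kern_w1.
have kwk := convol_kern kw kk.
transitivity (fun x => convol k u x - convol (Ad k) u x); last first.
  rewrite (_ : convol (Dd k) u = convol (fun x => k x + (-1) * Ad k x) u); last first.
    by congr convol; apply/funext => x; rewrite mulN1r.
  rewrite (convolDl kk (kernZ (-1) kwk) tu) (convolZl (-1) kwk tu).
  by apply/funext => x; rewrite mulN1r.
have tA : tame (Ad u) by exact: tame_convol kw tu.
rewrite (opc_sub (opk_opc (opk_convol kk)) tu tA).
apply/funext => x; congr (_ - _ x).
by rewrite /Ad -(convol_convol kw kk tu) (convol_convol kk kw tu) (convol_convol kw kk tu) (convol_kernC kk kw).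
Qed.

(* The real part of the transform of [Fr + i Fi]. *)
Definition kS Fr Fi t := FC Fr t - FS Fi t.

Lemma intg_B0M F G : intg F -> B0 G -> intg (fun x => F x * G x).
Proof.
move=> iF bG; have mG := B0_borel bG; have [C GC] := B0_bnd bG.
apply: (@intg_le _ _ (fun x => C * `|F x|)).
- by apply: borelM => //; exact: intg_borel.
- by apply: intgZ; exact: intg_abs.
- by move=> x; rewrite normrM mulrC ler_wpM2r.
Qed.

Lemma kS_kern Fr Fi : decay Fr -> decay Fi -> exists C, kern C (kS Fr Fi).
Proof.
move=> /FC_kern[C kC] /FS_kern[C' kC']; exists (C + `|-1| * C').
have := kernD kC (kernZ (-1) kC'); congr kern; apply/funext => x.
by rewrite mulN1r.
Qed.

(** The convolution theorem in complex form: the pair is multiplied by m = mr + i mi. Accordingly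
    [Dd_kS] multiplies it by 1 - m. *)
Lemma Ad_kS Fr Fi : intg Fr -> intg Fi -> Ad (kS Fr Fi) =
  kS (fun x => Fr x * mr x - Fi x * mi x) (fun x => Fr x * mi x + Fi x * mr x).
Proof.
move=> ir ii; have [Cw kw] := kern_w1.
have tC F : intg F -> tame (FC F).
  by move=> iF; have [B FB] := bnd_FC iF; apply: (tame_bounded _ FB); apply: FC_borel; exact: intg_borel.
have tS F : intg F -> tame (FS F).
  by move=> iF; have [B FB] := bnd_FS iF; apply: (tame_bounded _ FB); apply: FS_borel; exact: intg_borel.
apply/funext => t; rewrite /Ad /kS.
rewrite (opc_sub (opk_opc (opk_convol kw)) (tC _ ir) (tS _ ii)).
rewrite (convol_FC t kw ir) (convol_FS t kw ii).
have bmr := @B0_mr R; have bmi := @B0_mi R.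
have j1 := intg_B0M ir bmr; have j2 := intg_B0M ir bmi.
have j3 := intg_B0M ii bmr; have j4 := intg_B0M ii bmi.
have e1 : FS (fun x => Fr x * FS (@w1 R) x) t = - FS (fun x => Fr x * mi x) t.
  rewrite -[RHS]mulN1r -FSZ//; congr FS; apply/funext => x.
  by rewrite /mi; ring.
have e2 : FC (fun x => Fi x * FS (@w1 R) x) t = - FC (fun x => Fi x * mi x) t.
  rewrite -[RHS]mulN1r -FCZ//; congr FC; apply/funext => x.
  by rewrite /mi; ring.
have e3 : FC (fun x => Fr x * mr x - Fi x * mi x) t =
    FC (fun x => Fr x * mr x) t - FC (fun x => Fi x * mi x) t.
  rewrite -[X in _ - X]mul1r -mulNr -FCZ// -FCD//; last exact: intgZ.
  by congr FC; apply/funext => x; rewrite mulN1r.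
rewrite e1 e2 e3 FSD// -/mr; ring.
Qed.

Lemma kSB Fr Fi Gr Gi t : intg Fr -> intg Fi -> intg Gr -> intg Gi ->
  kS Fr Fi t - kS Gr Gi t = kS (fun x => Fr x - Gr x) (fun x => Fi x - Gi x) t.
Proof.
move=> *; rewrite /kS.
rewrite (_ : FC (fun x => Fr x - Gr x) t = FC Fr t - FC Gr t); last first.
  rewrite -[X in _ - X]mul1r -mulNr -FCZ// -FCD//; last exact: intgZ.
  by congr FC; apply/funext => x; rewrite mulN1r.
rewrite (_ : FS (fun x => Fi x - Gi x) t = FS Fi t - FS Gi t); last first.
  rewrite -[X in _ - X]mul1r -mulNr -FSZ// -FSD//; last exact: intgZ.
  by congr FS; apply/funext => x; rewrite mulN1r.
by ring.
Qed.

Lemma Dd_kS Fr Fi : intg Fr -> intg Fi -> Dd (kS Fr Fi) =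
  kS (fun x => (1 - mr x) * Fr x + mi x * Fi x) (fun x => (1 - mr x) * Fi x - mi x * Fr x).
Proof.
move=> ir ii; apply/funext => t; rewrite /Dd Ad_kS//.
have bmr := @B0_mr R; have bmi := @B0_mi R.
have j1 := intg_B0M ir bmr; have j2 := intg_B0M ir bmi.
have j3 := intg_B0M ii bmr; have j4 := intg_B0M ii bmi.
rewrite kSB//; [|exact: intgB|exact: intgD].
by congr kS; apply/funext => x; ring.
Qed.

Lemma AdZ c u : tame u -> Ad (fun x => c * u x) = (fun x => c * Ad u x).
Proof. by move=> tu; have [C kw] := kern_w1; exact: convolZr kw tu. Qed.

Lemma DdZ c u : tame u -> Dd (fun x => c * u x) = (fun x => c * Dd u x).
Proof. by move=> tu; rewrite /Dd AdZ//; apply/funext => x; rewrite mulrBr. Qed.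

Definition m2r x : R := mr x * mr x - mi x * mi x.
Definition m2i x : R := 2 * (mr x * mi x).
(* [er + i ei = (1 + x^2) m^2] is bounded because [x m] is, by [mr_sin] and
   [mi_cos]; this exhibits the decay of [m^2]. *)
Definition er x : R := m2r x + (sin (1 * x) * sin (1 * x) - (1 - cos (1 * x)) * (1 - cos (1 * x))).
Definition ei x : R := m2i x + 2 * (sin (1 * x) * (1 - cos (1 * x))).

Lemma erE x : er x = (1 + x ^+ 2) * m2r x.
Proof. by rewrite /er !mul1r -mr_sin -mi_cos /m2r; ring. Qed.
Lemma eiE x : ei x = (1 + x ^+ 2) * m2i x.
Proof. by rewrite /ei !mul1r -mr_sin -mi_cos /m2i; ring. Qed.
Lemma m2rE x : m2r x = poi x * er x.
Proof. by rewrite erE mulrA poi1P mul1r. Qed.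
Lemma m2iE x : m2i x = poi x * ei x.
Proof. by rewrite eiE mulrA poi1P mul1r. Qed.

Lemma B0_er : B0 er.
Proof.
have [[? ?] [? ?]] := ((@B0_mr R, @B0_mi R), (@B0_sin R 1, @B0_cos R 1)).
by apply: B0D; apply: B0B; apply: B0M => //; apply: B0B => //; exact: B0_cst.
Qed.
Lemma B0_ei : B0 ei.
Proof.
have [[? ?] [? ?]] := ((@B0_mr R, @B0_mi R), (@B0_sin R 1, @B0_cos R 1)).
by apply: B0D; apply: B0M; try exact: B0_cst; apply: B0M => //; apply: B0B => //; exact: B0_cst.
Qed.
Lemma decay_m2r : decay m2r.
Proof. by have := decay_poi B0_er; congr decay; apply/funext => x; rewrite m2rE. Qed.
Lemma decay_m2i : decay m2i.
Proof. by have := decay_poi B0_ei; congr decay; apply/funext => x; rewrite m2iE. Qed.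

(** The factor 1 / (2 pi) of Fourier inversion, expressed through [c0]. *)
Definition ck : R := (2 * c0 R)^-1.

(** A tent on [-2, 0], written as a second difference of |t| because each |t + j| is an integral of
    the form computed in [It_nr_scale]. *)
Lemma w1_w1 t : convol (@w1 R) (@w1 R) t =
  (`|t + 2| - 2 * `|t + 1| + `|t|) / 2.
Proof.
have E a b : a <= b -> It (\1_`[a, b]%classic : R -> R) = b - a.
  move=> ab; rewrite -(ftc (@der_id R) (der_cont (@der_cst R 1)) ab).
  by apply: eq_It => x; rewrite mul1r.
have P (p q : bool) : p%:R * q%:R = (p && q)%:R :> R by case: p q => -[]; rewrite ?mulr1 ?mulr0.
rewrite /convol.
have [t1|t1] := ltP t (-2).
  rewrite (@eq_It R _ (fun=> 0)); last first.
    move=> y; rewrite /w1 !itvE P.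
    case: (boolP ((-1 <= t - y <= 0) && (-1 <= y <= 0))) => // /andP[/andP[? ?] /andP[? ?]].
    by exfalso; lra.
  rewrite It0 !ltr0_norm; [by field|lra..].
have [t2|t2] := ltP t (-1).
  rewrite (@eq_It R _ (\1_`[-1, t + 1]%classic)); last first.
    move=> y; rewrite /w1 !itvE P.
    suff -> : ((-1 <= t - y <= 0) && (-1 <= y <= 0)) = (-1 <= y <= t + 1) by [].
    by apply/idP/idP => [/andP[/andP[? ?] /andP[? ?]]|/andP[? ?]]; repeat (apply/andP; split); lra.
  rewrite E; last by lra.
  rewrite ger0_norm ?(ltr0_norm (_ : t + 1 < 0)) ?(ltr0_norm (_ : t < 0)); [by field|lra..].
have [t3|t3] := ltP t 0.
  rewrite (@eq_It R _ (\1_`[t, 0]%classic)); last first.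
    move=> y; rewrite /w1 !itvE P.
    suff -> : ((-1 <= t - y <= 0) && (-1 <= y <= 0)) = (t <= y <= 0) by [].
    by apply/idP/idP => [/andP[/andP[? ?] /andP[? ?]]|/andP[? ?]]; repeat (apply/andP; split); lra.
  rewrite E; last by lra.
  rewrite ger0_norm ?(@ger0_norm _ (t + 1)) ?(ltr0_norm (_ : t < 0)); [by field|lra..].
have [t00|t0] := eqVneq t 0.
  rewrite (@eq_It R _ (\1_`[0, 0]%classic)); last first.
    move=> y; rewrite /w1 !itvE P.
    suff -> : ((-1 <= t - y <= 0) && (-1 <= y <= 0)) = (0 <= y <= 0) by [].
    by apply/idP/idP => [/andP[/andP[? ?] /andP[? ?]]|/andP[? ?]]; repeat (apply/andP; split); lra.
  by rewrite E// t00 normr0 !add0r normr1 normr_nat; field.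
have {t0 t3}t3 : 0 < t by rewrite lt_def t0.
  rewrite (@eq_It R _ (fun=> 0)); last first.
    move=> y; rewrite /w1 !itvE P.
    case: (boolP ((-1 <= t - y <= 0) && (-1 <= y <= 0))) => // /andP[/andP[? ?] /andP[? ?]].
    by exfalso; lra.
rewrite It0 !gtr0_norm; [by field|lra..].
Qed.

(** Fourier inversion for m^2; the symbol m itself is not absolutely integrable. The integrand is a
    second difference in a of (1 - cos (a x)) / x^2, at a = t, t + 1, t + 2. *)
Lemma kS_m2 t : ck * kS m2r m2i t = convol (@w1 R) (@w1 R) t.
Proof.
have [i1 i2] := (decay_intg decay_m2r, decay_intg decay_m2i).
rewrite w1_w1 /kS /FC /FS -ItB; [|exact: intg_cos|exact: intg_sin].
pose z a x := a ^+ 2 * nr (a * x).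
have zi a : intg (z a) by exact: (It_nr_scale a).1.
have zE a : It (z a) = `|a| * c0 R by exact: (It_nr_scale a).2.
rewrite (_ : It _ = It (fun x => z (t + 2) x - 2 * z (t + 1) x + z t x)).
  rewrite ItD//; last by apply: intgB => //; exact: intgZ.
  rewrite ItB//; last exact: intgZ.
  rewrite ItZ// !zE /ck; have := c0_gt0 R => c00.
  by field; rewrite gt_eqF.
apply: eq_It => x; rewrite /z.
have [->|x0] := eqVneq x 0.
  rewrite !mulr0 !cos0 !sin0 nr0 /m2r mi_nr mul0r.
  have -> : mr 0 = 1 :> R by apply/eqP; rewrite eq_sym -subr_eq0 mr_ni mul0r.
  by field.
have x2 : x ^+ 2 != 0 by rewrite expf_neq0.
apply: (mulfI x2).
have Z a : x ^+ 2 * (a ^+ 2 * nr (a * x)) = 1 - cos (a * x).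
  by rewrite mulrA -exprMn (mulrC x) nr_cos.
rewrite [RHS](_ : _ = x ^+ 2 * ((t + 2) ^+ 2 * nr ((t + 2) * x)) -
    2 * (x ^+ 2 * ((t + 1) ^+ 2 * nr ((t + 1) * x))) + x ^+ 2 * (t ^+ 2 * nr (t * x))); last by ring.
rewrite !Z.
transitivity (((x * mr x) ^+ 2 - (x * mi x) ^+ 2) * cos (t * x) -
    2 * (x * mr x) * (x * mi x) * sin (t * x)).
  by rewrite /m2r /m2i; ring.
rewrite mr_sin mi_cos.
have -> : cos ((t + 1) * x) = cos (t * x) * cos x - sin (t * x) * sin x.
  by rewrite mulrDl mul1r cosD.
have -> : cos ((t + 2) * x) = (cos (t * x) * cos x - sin (t * x) * sin x) * cos x -
   (sin (t * x) * cos x + cos (t * x) * sin x) * sin x.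
  by rewrite (_ : (t + 2) * x = t * x + x + x); [rewrite cosD cosD sinD|ring].
by ring.
Qed.
End StekKernels.

(** * The band-limiting operator J *)

Section BandlimitingOperator.
Variable R : realType.
Implicit Types (f g h k F G H u Fr Fi : R -> R) (a b c d v x y t C K : R).
Variables (gamma : R) (q : R -> R).
Hypothesis gamma_gt0 : 0 < gamma.
Hypothesis q_ge0 : forall x, 0 <= q x.
Hypothesis q_one : forall x, `|x| <= gamma / 2 -> q x = 1.
Hypothesis q_B0 : forall n, B0 (fun x => x ^+ n * q x).

(** The factor [poi] makes [den] bounded from above and away from 0. With it [eta] is q / (x^2 + q)
    and [theta] is x / (x^2 + q), so that 1 - eta = x theta. *)
Definition den x := (x ^+ 2 + q x) * poi x.
Definition eta x := q x * poi x / den x.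
Definition theta x := xpoi x / den x.

Lemma B0_q : B0 q.
Proof. by have := q_B0 0; congr B0; apply/funext => x; rewrite expr0 mul1r. Qed.

Lemma denE x : den x = 1 - poi x + q x * poi x.
Proof.
rewrite /den mulrDl; congr (_ + _).
by apply/eqP; rewrite eq_sym subr_eq -(poi1P x); apply/eqP; ring.
Qed.
Lemma B0_den : B0 den.
Proof.
apply: (B0_ext (F := fun x => 1 - poi x + q x * poi x)) => [x|]; first by rewrite denE.
have bp := @B0_poi R; have bq := B0_q.
by apply: B0D; [apply: B0B => //; exact: B0_cst|exact: B0M].
Qed.
Lemma den_lb : exists2 c : R, 0 < c & forall x, c <= den x.
Proof.
have g2 : 0 < gamma / 2 by rewrite divr_gt0.
have g4 : 0 < (gamma / 2) ^+ 2 by rewrite exprn_gt0.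
exists (Num.min ((1 + (gamma / 2) ^+ 2)^-1) ((gamma / 2) ^+ 2 / (1 + (gamma / 2) ^+ 2))).
  by rewrite lt_min invr_gt0 divr_gt0 ?oneD_gt0.
move=> x; rewrite ge_min; have [x1|x1] := leP `|x| (gamma / 2).
  have x2 : x ^+ 2 <= (gamma / 2) ^+ 2.
    by rewrite -(real_normK (num_real x)) ler_sqr ?nnegrE// ltW.
  apply/orP; left; rewrite /den q_one// /poi (addrC (x ^+ 2)) mulfV ?gt_eqF ?oneD_gt0//.
  by rewrite invf_le1 ?oneD_gt0// lerDl sqr_ge0.
have x2 : (gamma / 2) ^+ 2 <= x ^+ 2.
  by rewrite -(real_normK (num_real x)) ler_sqr ?nnegrE// ltW.
apply/orP; right; rewrite /den.
apply: (@le_trans _ _ (x ^+ 2 * poi x)); last first.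
  by rewrite ler_wpM2r ?poi_ge0// lerDl.
rewrite /poi ler_pdivrMr ?oneD_gt0// mulrAC ler_pdivlMr ?oneD_gt0//.
by rewrite !mulrDr !mulr1 (mulrC _ (x ^+ 2)) lerD2r.
Qed.
Lemma den_gt0 x : 0 < den x.
Proof. by have [c c0 /(_ x)] := den_lb; exact: lt_le_trans. Qed.
Lemma B0_Vden : B0 (fun x => (den x)^-1).
Proof. by have [c c0 cd] := den_lb; exact: B0V c0 cd B0_den. Qed.
Lemma Qn_gt0 x : 0 < Qn x.
Proof. by have [c c0' /(_ x)] := @Qn_lb R; exact: lt_le_trans. Qed.
Lemma B0_VQn : B0 (fun x => (Qn x)^-1).
Proof. by have [c c0' cd] := @Qn_lb R; exact: B0V c0' cd (@B0_Qn R). Qed.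

Lemma eta_theta x : 1 - eta x = x * theta x.
Proof.
have d0 : den x != 0 by rewrite gt_eqF// den_gt0.
rewrite /eta /theta /xpoi -[X in X - _](divff d0) -mulrBl.
have -> : den x - q x * poi x = x ^+ 2 * poi x by rewrite /den; ring.
by ring.
Qed.

Lemma B0_theta : B0 theta.
Proof. exact: B0M (@B0_xpoi R) B0_Vden. Qed.

(** Each division by n costs a factor 1 + x^2, which the bump [q] absorbs: [p2] serves for 1 / n and
    [p3] for 1 / n^2. *)
Definition p2 x := (1 + x ^+ 2) * q x.
Definition p3 x := (1 + x ^+ 2) ^+ 2 * q x.
Lemma B0_p2 : B0 p2.
Proof.
apply: (B0_ext (F := fun x => x ^+ 0 * q x + x ^+ 2 * q x)) => [x|].
  by rewrite /p2; ring.
exact: B0D.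
Qed.
Lemma B0_p3 : B0 p3.
Proof.
apply: (B0_ext (F := fun x => x ^+ 0 * q x + 2 * (x ^+ 2 * q x) + x ^+ 4 * q x)) => [x|].
  by rewrite /p3; ring.
by apply: B0D => //; apply: B0D => //; apply: B0M => //; exact: B0_cst.
Qed.

Lemma decay_eta : decay eta.
Proof.
have := decay_poi (B0M B0_q B0_Vden); congr decay; apply/funext => x.
by rewrite /eta; ring.
Qed.
Lemma decay_xeta : decay (fun x => x * eta x).
Proof.
have := decay_poi (B0M (q_B0 1) B0_Vden); congr decay; apply/funext => x.
by rewrite /eta; ring.
Qed.

Local Notation E2r x := (er x * er x - ei x * ei x).
Local Notation E2i x := (2 * (er x * ei x)).
(* With [m] and [n] the symbols above, [1 - m = - i x n] and
   [1 / n = conj n / |n|^2], [|n|^2 = Qn * poi], the pairs below are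
   - fK: (1 - eta) m^4 / (1 - m) = i theta m^4 / n,
   - f2: - eta / n, the symbol of d/dx J divided by 1 - m,
   - f5: - bb eta / n^2, the symbol of (I - A) J divided by (1 - m)^2, where
     x^2 bb is the symbol of I - A. *)
Definition fKr x := poi x * ((E2r x * ni x - E2i x * nr x) * (theta x * (Qn x)^-1)).
Definition fKi x := poi x * ((E2r x * nr x + E2i x * ni x) * (theta x * (Qn x)^-1)).
Definition f2r x := poi x * (-1 * (p2 x * ((den x)^-1 * ((Qn x)^-1 * nr x)))).
Definition f2i x := poi x * (p2 x * ((den x)^-1 * ((Qn x)^-1 * ni x))).
Definition bb x : R := 4^-1 * FC (@h2 R) (2^-1 * x).
Definition f5r x := poi x * (bb x * (p3 x * ((den x)^-1 * ((Qn x)^-1 * ((Qn x)^-1 *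
  (ni x * ni x - nr x * nr x)))))).
Definition f5i x := poi x * (bb x * (p3 x * ((den x)^-1 * ((Qn x)^-1 * ((Qn x)^-1 *
  (2 * (nr x * ni x))))))).

Lemma B0_scale F a : B0 F -> B0 (fun x => F (a * x)).
Proof.
move=> [F1 [F2 [dF dF1 [C0 b0] [C1 b1] [C2 b2]]]].
exists (fun x => a * F1 (a * x)), (fun x => a * (a * F2 (a * x))); split.
- exact: der_comp dF (der_scale a).
- by apply: derZ; exact: der_comp dF1 (der_scale a).
- by exists C0.
- by apply: bndM; [exact: bnd_cst|exists C1].
- by do 2?[apply: bndM; first exact: bnd_cst]; exists C2.
Qed.

Lemma B0_bb : B0 bb.
Proof.
apply: B0M; first exact: B0_cst.
by apply: B0_scale; have [] := @intg_h2 R; exact: B0_FC.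
Qed.

Lemma decay_symbols : [/\ decay fKr, decay fKi, decay f2r & decay f2i] /\
  decay f5r /\ decay f5i.
Proof.
have bc := @B0_cst R.
have [[br bi] [ber bei]] := ((@B0_nr R, @B0_ni R), (@B0_er R, @B0_ei R)).
have [[bd bQ] [bt b2]] := ((B0_Vden, B0_VQn), (B0_theta, B0_p2)).
have [b3 b5] := (B0_p3, B0_bb).
have bE2r : B0 (fun x => E2r x) by apply: B0B; exact: B0M.
have bE2i : B0 (fun x => E2i x) by apply: B0M => //; exact: B0M.
split; [split|split]; apply: decay_poi.
- by apply: B0M; [apply: B0B; exact: B0M|exact: B0M].
- by apply: B0M; [apply: B0D; exact: B0M|exact: B0M].
- by apply: B0M => //; apply: B0M => //; apply: B0M => //; exact: B0M.
- by apply: B0M => //; apply: B0M => //; exact: B0M.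
- apply: B0M => //; apply: B0M => //; apply: B0M => //; apply: B0M => //; apply: B0M => //.
  by apply: B0B; exact: B0M.
- apply: B0M => //; apply: B0M => //; apply: B0M => //; apply: B0M => //; apply: B0M => //.
  by apply: B0M => //; exact: B0M.
Qed.

Definition kJ t := ck R * FC eta t.
Definition kJ' t := ck R * - FS (fun x => x * eta x) t.
Definition kK t := ck R * kS fKr fKi t.
Definition kK2 t := ck R * kS f2r f2i t.
Definition kK5 t := ck R * kS f5r f5i t.
Definition J u := convol kJ u.

Lemma kerns : [/\ exists C, kern C kJ, exists C, kern C kJ', exists C, kern C kK,
   exists C, kern C kK2 & exists C, kern C kK5].
Proof.
have [[? ? ? ?] [? ?]] := decay_symbols.
have Z k : (exists C, kern C k) -> exists C, kern C (fun t => ck R * k t).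
  by move=> [C kC]; exists (`|ck R| * C); exact: kernZ.
split; apply: Z; [exact: FC_kern decay_eta| |exact: kS_kern..].
have [C kC] := FS_kern decay_xeta; exists (`|-1| * C).
by have := kernZ (-1) kC; congr kern; apply/funext => x; rewrite mulN1r.
Qed.

Lemma der_kJ : der kJ kJ'.
Proof. exact: derZ (der_FC (decay_intg decay_eta) (decay_intg decay_xeta)). Qed.

Lemma QnV x : (1 + x ^+ 2) * (nr x * nr x + ni x * ni x) = Qn x.
Proof. by rewrite /Qn !expr2 mulrC. Qed.

Lemma tame_kS Fr Fi : decay Fr -> decay Fi -> tame (kS Fr Fi).
Proof. by move=> dr di; have [C kC] := kS_kern dr di; exact: kern_tame kC. Qed.

Lemma kS0 F t : kS F (fun=> 0) t = FC F t.
Proof.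
rewrite /kS (_ : FS _ t = 0) ?subr0// -[RHS](It0 R).
by apply: eq_It => x; rewrite mul0r.
Qed.

(** In symbols, (1 - m) (- eta / n) = i x eta, since 1 - m = - i x n; the right-hand side is the
    symbol of d/dx J. *)
Lemma Dd_kK2 : Dd kK2 = kJ'.
Proof.
have [[_ _ dr di] _] := decay_symbols.
rewrite /kK2 DdZ; last exact: tame_kS.
rewrite Dd_kS; [|exact: decay_intg..].
apply/funext => t; congr (_ * _); rewrite /kS -[RHS]sub0r; congr (_ - _).
  rewrite -[RHS](It0 R); apply: eq_It => x.
  rewrite (_ : _ + _ = 0) ?mul0r//.
  by rewrite mr_ni mi_nr /f2r /f2i; ring.
apply: eq_It => x; congr (_ * _).
rewrite mr_ni mi_nr /f2r /f2i.
transitivity (x * (poi x * q x / den x) * (((1 + x ^+ 2) * (nr x * nr x + ni x * ni x)) / Qn x)).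
  by rewrite /p2; ring.
by rewrite QnV divff ?gt_eqF ?Qn_gt0// mulr1 /eta (mulrC (q x)).
Qed.

Lemma av_bb x : 1 - FC (@w2 R) x = x ^+ 2 * bb x.
Proof. by rewrite w2_sin mr_ni ni_h2 /bb (mulrC _ x); field. Qed.

(** In symbols, (1 - m)^2 = - x^2 n^2 turns - bb eta / n^2 into x^2 bb eta, which is the symbol of
    (I - A) J by [av_bb]. *)
Lemma DdDd_kK5 : Dd (Dd kK5) = (fun t => kJ t - Av kJ t).
Proof.
have [_ [dr di]] := decay_symbols.
have ie := decay_intg decay_eta.
have [C2 k2] := @kern_w2 R.
rewrite /kK5 DdZ; last exact: tame_kS.
rewrite DdZ; last by apply: opc_tame; [exact: opc_Dd|exact: tame_kS].
have [bmr bmi] := (@B0_mr R, @B0_mi R).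
have b1m : B0 (fun x => 1 - mr x) by apply: B0B => //; exact: B0_cst.
have [i1 i2] := (decay_intg dr, decay_intg di).
have [j1 j2] := (intg_B0M i1 bmi, intg_B0M i2 bmi).
have [j3 j4] := (intg_B0M i1 b1m, intg_B0M i2 b1m).
have l1 : intg (fun x => (1 - mr x) * f5r x + mi x * f5i x).
  by have := intgD j3 j2; congr intg; apply/funext => x; ring.
have l2 : intg (fun x => (1 - mr x) * f5i x - mi x * f5r x).
  by have := intgB j4 j1; congr intg; apply/funext => x; ring.
rewrite Dd_kS// Dd_kS//.
rewrite /kJ /Av (convolZr _ k2); last by have [C kC] := FC_kern decay_eta; exact: kern_tame kC.
apply/funext => t; rewrite -mulrBr; congr (_ * _).
rewrite (convol_FC t k2 ie).
have -> : FS (fun x => eta x * FS (@w2 R) x) t = 0.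
  rewrite -[RHS](It0 R); apply: eq_It => x; by rewrite w2_odd mulr0 mul0r.
rewrite addr0 /kS.
have -> : FC eta t - FC (fun x => eta x * FC (@w2 R) x) t =
    FC (fun x => eta x - eta x * FC (@w2 R) x) t.
  rewrite /FC -ItB; [|exact: intg_cos|].
    by apply: eq_It => x; ring.
  apply: intg_cos; apply: intg_B0M => //.
  by have [] := @intg_w2 R; exact: B0_FC.
rewrite (_ : FS _ t = 0) ?subr0; last first.
  rewrite -[RHS](It0 R); apply: eq_It => x.
  rewrite (_ : _ - _ = 0) ?mul0r//.
  by rewrite mr_ni mi_nr /f5r /f5i; ring.
apply: eq_It => x; congr (_ * _).
have -> : eta x - eta x * FC (@w2 R) x = eta x * (x ^+ 2 * bb x).
  by rewrite -av_bb; ring.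
rewrite mr_ni mi_nr /f5r /f5i.
transitivity (x ^+ 2 * bb x * (poi x * q x / den x) *
    (((1 + x ^+ 2) * (nr x * nr x + ni x * ni x)) / Qn x) ^+ 2).
  by rewrite /p3; ring.
by rewrite QnV divff ?gt_eqF ?Qn_gt0// expr1n mulr1 /eta; ring.
Qed.

Lemma opk_J : opk J.
Proof. by have [[C kC] _ _ _ _] := kerns; exact: opk_convol kC. Qed.

Definition ig Fr Fi := intg Fr /\ intg Fi.
Definition mulr_m Fr Fi x := Fr x * mr x - Fi x * mi x.
Definition muli_m Fr Fi x := Fr x * mi x + Fi x * mr x.

Lemma ig_m Fr Fi : ig Fr Fi -> ig (mulr_m Fr Fi) (muli_m Fr Fi).
Proof.
move=> [ir ii]; have [bmr bmi] := (@B0_mr R, @B0_mi R).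
by split; [apply: intgB|apply: intgD]; exact: intg_B0M.
Qed.

Lemma tame_igS Fr Fi : ig Fr Fi -> tame (kS Fr Fi).
Proof.
move=> [ir ii].
have [C FC] := bnd_FC ir; have [D GD] := bnd_FS ii.
apply: (@tame_bounded _ _ (C + D)) => [|t].
  by apply: borelB; [apply: FC_borel|apply: FS_borel]; exact: intg_borel.
by rewrite (le_trans (ler_normB _ _))// lerD.
Qed.

Lemma Ad_ckS Fr Fi : ig Fr Fi -> Ad (fun t => ck R * kS Fr Fi t) =
  fun t => ck R * kS (mulr_m Fr Fi) (muli_m Fr Fi) t.
Proof. by move=> i; rewrite AdZ; [case: i => *; rewrite Ad_kS|exact: tame_igS]. Qed.

Local Notation W := (convol (@w1 R) (@w1 R)).

(** In symbols, (1 - m) (i theta m^4 / n) = x theta m^4 = (1 - eta) m^4. The term m^4 is realised as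
    two averages of [W], since [W] is the transform of the integrable pair m^2. *)
Lemma Dd_kK : Dd kK = (fun t => Ad (Ad W) t - Ad (Ad (Ad (Ad kJ))) t).
Proof.
have [[dr di _ _] _] := decay_symbols.
have i2 : ig (@m2r R) (@m2i R) by split; apply: decay_intg; [exact: decay_m2r|exact: decay_m2i].
have ie : ig eta (fun=> 0) by split; [exact: decay_intg decay_eta|exact: intg0].
have -> : W = (fun t => ck R * kS (@m2r R) (@m2i R) t).
  by apply/funext => t; rewrite kS_m2.
have -> : kJ = (fun t => ck R * kS eta (fun=> 0) t).
  by apply/funext => t; rewrite kS0.
have [j1 j2] := (ig_m i2, ig_m (ig_m i2)).
have e1 := ig_m ie; have e2 := ig_m e1; have e3 := ig_m e2; have e4 := ig_m e3.
rewrite (Ad_ckS i2) (Ad_ckS j1) (Ad_ckS ie) (Ad_ckS e1) (Ad_ckS e2) (Ad_ckS e3).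
have ik : ig fKr fKi by split; exact: decay_intg.
rewrite /kK (DdZ _ (tame_igS ik)) (Dd_kS ik.1 ik.2).
apply/funext => t; rewrite -mulrBr kSB; [|exact: j2.1|exact: j2.2|exact: e4.1|exact: e4.2].
congr (_ * _).
(* Both identities multiply and divide by [Qn] and insert [poi x * (1 + x ^+ 2) = 1], so that |n|^2
   cancels. *)
have key x : x * theta x * ((poi x * er x) * (poi x * er x) - (poi x * ei x) * (poi x * ei x)) =
    x * (poi x * (er x * er x - ei x * ei x) * (theta x * (Qn x)^-1)) * (nr x * nr x + ni x * ni x).
  rewrite -[RHS]mulr1 -[X in _ = _ * X](poi1P x) -[LHS]mulr1.
  rewrite -[X in _ * X = _](divff (lt0r_neq0 (Qn_gt0 x))) -{1}QnV; ring.
have key2 x : x * theta x * (2 * ((poi x * er x) * (poi x * ei x))) =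
    x * (poi x * (2 * (er x * ei x)) * (theta x * (Qn x)^-1)) * (nr x * nr x + ni x * ni x).
  rewrite -[RHS]mulr1 -[X in _ = _ * X](poi1P x) -[LHS]mulr1.
  rewrite -[X in _ * X = _](divff (lt0r_neq0 (Qn_gt0 x))) -{1}QnV; ring.
congr kS; apply/funext => x.
  rewrite mr_ni mi_nr /fKr /fKi.
  transitivity (x * (poi x * (er x * er x - ei x * ei x) * (theta x * (Qn x)^-1)) *
     (nr x * nr x + ni x * ni x)); first by ring.
  rewrite -key -m2rE -m2iE -eta_theta /mulr_m /muli_m /m2r /m2i; ring.
rewrite mr_ni mi_nr /fKr /fKi.
transitivity (x * (poi x * (2 * (er x * ei x)) * (theta x * (Qn x)^-1)) *
     (nr x * nr x + ni x * ni x)); first by ring.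
rewrite -key2 -m2rE -m2iE -eta_theta /mulr_m /muli_m /m2r /m2i; ring.
Qed.

Opaque convol.
Definition ad4 u := Ad (Ad (Ad (Ad u))).

Lemma convol_Ad C k u : kern C k -> tame u -> convol (Ad k) u = Ad (convol k u).
Proof. by move=> kk tu; have [Cw kw] := @kern_w1 R; rewrite /Ad (convol_convol kw kk tu). Qed.

Lemma convol_kK_Dd u : tame u -> convol kK (Dd u) = (fun x => ad4 u x - ad4 (J u) x).
Proof.
move=> tu; have [[CJ kkJ] _ [C kk] _ _] := kerns.
have [Cw kw] := @kern_w1 R; have kW := convol_kern kw kw.
have AdK k D : kern D k -> exists D', kern D' (Ad k).
  by move=> kD; have := convol_kern kw kD; exists (Cw * D * (4 * Ipoi R)).
have [D1 l1] := AdK _ _ kW; have [D2 l2] := AdK _ _ l1.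
have [B1 b1] := AdK _ _ kkJ; have [B2 b2] := AdK _ _ b1.
have [B3 b3] := AdK _ _ b2; have [B4 b4] := AdK _ _ b3.
have E : Dd kK = (fun t => Ad (Ad W) t + (-1) * Ad (Ad (Ad (Ad kJ))) t).
  by rewrite Dd_kK; apply/funext => t; rewrite mulN1r.
have e1 : convol (Ad (Ad W)) u = ad4 u := etrans (convol_Ad l1 tu) (congr1 (@Ad R)
  (etrans (convol_Ad kW tu) (congr1 (@Ad R) (esym (convol_convol kw kw tu))))).
have e2 : convol (Ad (Ad (Ad (Ad kJ)))) u = ad4 (J u) := etrans (convol_Ad b3 tu) (congr1 (@Ad R)
  (etrans (convol_Ad b2 tu) (congr1 (@Ad R) (etrans (convol_Ad b1 tu) (congr1 (@Ad R) (convol_Ad kkJ tu)))))).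
transitivity (convol (fun t => Ad (Ad W) t + (-1) * Ad (Ad (Ad (Ad kJ))) t) u).
  by rewrite (convol_Dd kk tu) E.
transitivity (fun x => convol (Ad (Ad W)) u x +
    convol (fun t => -1 * Ad (Ad (Ad (Ad kJ))) t) u x).
  exact: convolDl l2 (kernZ (-1) b4) tu.
apply/funext => x.
have e3 : convol (fun t => -1 * Ad (Ad (Ad (Ad kJ))) t) u x =
    -1 * convol (Ad (Ad (Ad (Ad kJ)))) u x := congr1 (fun f => f x) (convolZl (-1) b4 tu).
have e1x : convol (Ad (Ad W)) u x = ad4 u x := congr1 (fun f => f x) e1.
have e2x : convol (Ad (Ad (Ad (Ad kJ)))) u x = ad4 (J u) x := congr1 (fun f => f x) e2.
transitivity (ad4 u x + -1 * ad4 (J u) x); last by rewrite mulN1r.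
exact: congr2 e1x (etrans e3 (congr1 ( *%R (-1)) e2x)).
Qed.

Definition psum u := fun x => u x + (Ad u x + (Ad (Ad u) x + Ad (Ad (Ad u)) x)).
(* From [(I - J) (I + Ad + Ad^2 + Ad^3) (I - Ad) = (I - J) (I - Ad^4)]: the remaining
   term [(I - J) Ad^4 u] is the convolution of [kK] with [(I - Ad) u]. *)
Definition Sop u := fun x => (psum u x - J (psum u) x) + convol kK u x.

Lemma opc_psum : opc psum.
Proof.
have oA := opk_opc (@opk_Ad R).
apply: opcD; first exact: opc_id.
apply: opcD => //; apply: opcD; first exact: (opc_comp oA oA).
exact: (opc_comp oA (opc_comp oA oA)).
Qed.

Lemma opc_Sop : opc Sop.
Proof.
have oJ := opk_opc opk_J; have op := opc_psum.
apply: opcD; last by have [_ _ [C kC] _ _] := kerns; exact: opk_opc (opk_convol kC).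
by apply: opcB => //; exact: opc_comp oJ op.
Qed.

Lemma psum_Dd u : tame u -> psum (Dd u) = (fun x => u x - ad4 u x).
Proof.
move=> tu; have oA := opk_opc (@opk_Ad R).
have t1 := opc_tame oA tu; have t2 := opc_tame oA t1; have t3 := opc_tame oA t2.
have e1 : Ad (Dd u) = (fun x => Ad u x - Ad (Ad u) x) := opc_sub oA tu t1.
have e2 : Ad (Ad (Dd u)) = (fun x => Ad (Ad u) x - Ad (Ad (Ad u)) x).
  by rewrite e1; exact: opc_sub oA t1 t2.
have e3 : Ad (Ad (Ad (Dd u))) = (fun x => Ad (Ad (Ad u)) x - Ad (Ad (Ad (Ad u))) x).
  by rewrite e2; exact: opc_sub oA t2 t3.
rewrite /psum e3 e2 e1; apply/funext => x; rewrite /Dd /ad4.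
move: (Ad (Ad (Ad (Ad u))) x) (Ad (Ad (Ad u)) x) (Ad (Ad u) x) (Ad u x) => a b c d.
by ring.
Qed.

Lemma I_J u : tame u -> (fun x => u x - J u x) = Sop (Dd u).
Proof.
move=> tu; have oA := opk_opc (@opk_Ad R); have oJ := opk_opc opk_J.
have t1 := opc_tame oA tu; have t2 := opc_tame oA t1.
have t3 := opc_tame oA t2; have t4 : tame (ad4 u) := opc_tame oA t3.
have e4 : J (ad4 u) = ad4 (J u).
  rewrite /ad4 (opc_comm oJ oA t3) (opc_comm oJ oA t2) (opc_comm oJ oA t1).
  by rewrite (opc_comm oJ oA tu).
have e5 : J (fun x => u x - ad4 u x) = (fun x => J u x - ad4 (J u) x).
  by rewrite (opc_sub oJ tu t4) e4.
rewrite /Sop (psum_Dd tu) (convol_kK_Dd tu) e5; apply/funext => x.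
by move: (J u x) (ad4 u x) (ad4 (J u) x) => a b c; ring.
Qed.

Definition K2D u := convol kK2 (Dd u).
Lemma der_J u : tame u -> der (J u) (K2D u).
Proof.
move=> tu; have [[C1 k1] [C2 k2] _ [C4 k4] _] := kerns.
rewrite /K2D (convol_Dd k4 tu) Dd_kK2.
exact: der_convol k1 k2 der_kJ tu.
Qed.

Definition IA u := fun x => u x - Av u x.
Lemma opc_IA : opc IA.
Proof. by apply: opcB; [exact: opc_id|exact: opk_opc (@opk_Av R)]. Qed.

Lemma IA_J u : tame u -> IA (J u) = convol kK5 (Dd (Dd u)).
Proof.
move=> tu; have [[C1 k1] _ _ _ [C5 k5]] := kerns.
have [Cw kw] := @kern_w2 R.
have tD := opc_tame (@opc_Dd R) tu.
rewrite (convol_Dd k5 tD).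
have [Cw1 kw1] := @kern_w1 R.
have kD5 : exists C, kern C (Dd kK5).
  exists (C5 + `|-1| * (Cw1 * C5 * (4 * Ipoi R))).
  have := kernD k5 (kernZ (-1) (convol_kern kw1 k5)).
  by congr kern; apply/funext => x; rewrite mulN1r.
have [C6 k6] := kD5.
have E : Dd (Dd kK5) = (fun t => kJ t + (-1) * convol (@w2 R) kJ t).
  by rewrite DdDd_kK5; apply/funext => t; rewrite mulN1r.
rewrite (convol_Dd k6 tu) E.
rewrite (convolDl k1 (kernZ (-1) (convol_kern kw k1)) tu) (convolZl (-1) (convol_kern kw k1) tu).
by rewrite -(convol_convol kw k1 tu); apply/funext => x; rewrite mulN1r.
Qed.
End BandlimitingOperator.

(** * Approximation by band-limited functions at scale 1 *)

Section Realization.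
Variable R : realType.
Implicit Types (f g h k u v : R -> R) (a b c x y t C : R) (L K : (R -> R) -> R -> R).

Fixpoint nder n f g : Prop :=
  if n is m.+1 then exists2 f', der f f' & nder m f' g else f = g.

Lemma iter_comm n L K u : opc L -> opc K -> tame u ->
  iter n (fun v => L (K v)) u = iter n L (iter n K u).
Proof.
move=> oL oK tu; elim: n => // n IH; rewrite !iterS IH; congr (L _).
have oKn := opc_iter n oK.
by rewrite (opc_comm oK (opc_iter n oL) (opc_tame oKn tu)).
Qed.

(** [Z] is the sum I + L + ... + L^(n-1), built by Z' = I + L Z. *)
Lemma telescope_iter n L : opc L -> exists2 Z, opc Z &
  forall u, tame u -> (fun x => u x - iter n L u x) = Z (fun x => u x - L u x).
Proof.
move=> oL; elim: n => [|n [Z oZ ZE]].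
  exists (fun u x => u x - u x); first by apply: opcB; exact: opc_id.
  by move=> u _; apply/funext => x /=; rewrite !subrr.
exists (fun u x => u x + L (Z u) x); first by apply: opcD; [exact: opc_id|exact: (opc_comp oL oZ)].
move=> u tu; rewrite -(ZE _ tu).
rewrite (opc_sub oL tu (opc_tame (opc_iter n oL) tu)).
by apply/funext => x; rewrite iterS; move: (iter n L u) => w; ring.
Qed.

Variables (gamma : R) (q : R -> R).
Hypothesis gamma_gt0 : 0 < gamma.
Hypothesis q_ge0 : forall x, 0 <= q x.
Hypothesis q_one : forall x, `|x| <= gamma / 2 -> q x = 1.
Hypothesis q_B0 : forall n, B0 (fun x => x ^+ n * q x).

Local Notation J := (J q).
Local Notation Dd := (@Dd R).
Local Notation IA := (@IA R).
Let oJ : opc J := opk_opc (opk_J gamma_gt0 q_ge0 q_one q_B0).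
Let oD : opc Dd := @opc_Dd R.
Let oI : opc IA := @opc_IA R.
Let kk2 : exists C, kern C (kK2 q).
Proof. by have [_ _ _ ] := kerns gamma_gt0 q_ge0 q_one q_B0. Qed.
Let kk5 : exists C, kern C (kK5 q).
Proof. by have [_ _ _ _] := kerns gamma_gt0 q_ge0 q_one q_B0. Qed.
Let o2 : opk (convol (kK2 q)). Proof. by have [C kC] := kk2; exact: opk_convol kC. Qed.
Let o5 : opk (convol (kK5 q)). Proof. by have [C kC] := kk5; exact: opk_convol kC. Qed.
Opaque convol.

(** The recursion E' = E + (I - J^n E) gives I - J^n E' = (I - J^n) (I - J^n E), so I - J^n E is the
    s-th power of I - J^n. Every factor I - J^n = Z Sop Dd supplies one [Dd]. *)
Lemma approximate_inverse n s : exists E Ou, [/\ opc E, opc Ou & forall u, tame u ->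
  (fun x => u x - iter n J (E u) x) = Ou (iter s Dd u)].
Proof.
have oJn := opc_iter n oJ.
have [Z oZ ZE] := telescope_iter n oJ.
have oS := opc_Sop gamma_gt0 q_ge0 q_one q_B0.
have oT := opc_comp oZ oS.
have TE v : tame v -> (fun x => v x - iter n J v x) = Z (Sop q (Dd v)).
  move=> tv; rewrite (ZE _ tv); congr (Z _).
  exact: (I_J gamma_gt0 q_ge0 q_one q_B0 tv).
elim: s => [|s [E [Ou [oE oO EO]]]].
  exists (fun u x => u x - u x), id; split.
  - by apply: opcB; exact: opc_id.
  - exact: opc_id.
  - move=> u tu /=; rewrite (opc_sub oJn tu tu).
    by apply/funext => x; rewrite subrr subr0.
exists (fun u x => E u x + (u x - iter n J (E u) x)), (fun u => Z (Sop q (Ou u))); split.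
- apply: opcD => //; apply: opcB; first exact: opc_id.
  exact: (opc_comp oJn oE).
- exact: (opc_comp oZ (opc_comp oS oO)).
move=> u tu.
have tE := opc_tame oE tu; have tJE := opc_tame oJn tE.
have ty := tameB tu tJE.
have H := TE _ ty.
rewrite (opc_add oJn tE ty).
have tDs := opc_tame (opc_iter s oD) tu.
transitivity (Z (Sop q (Dd (Ou (iter s Dd u))))); last first.
  by rewrite iterS (opc_comm oD oO tDs).
rewrite -(EO _ tu) -H; apply/funext => x.
by move: (iter n J _ x) (iter n J _ x) => a b; ring.
Qed.

Lemma nder_J (k : nat) v : tame v -> nder k (iter k J v) (iter k (K2D q) v).
Proof.
have oK : opc (K2D q) by exact: (opc_comp (opk_opc o2) oD).
elim: k v => //= k IH v tv; exists (K2D q (iter k J v)).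
  apply: (der_J gamma_gt0 q_ge0 q_one q_B0).
  exact: opc_tame (opc_iter k oJ) tv.
rewrite (opc_comm oK (opc_iter k oJ) tv) -/(iter k.+1 (K2D q) v) iterSr.
by apply: IH; exact: opc_tame oK tv.
Qed.

Lemma IA_iter n v : tame v -> iter n IA (iter n J v) =
  iter n (convol (kK5 q)) (iter (2 * n) Dd v).
Proof.
move=> tv; rewrite -(iter_comm n oI oJ tv).
rewrite mul2n -addnn iterD.
have -> : iter n Dd (iter n Dd v) = iter n (fun v => Dd (Dd v)) v.
  by rewrite iter_comm.
rewrite -(iter_comm n (opk_opc o5) (opc_comp oD oD) tv).
elim: n => //= n ->.
apply: (IA_J gamma_gt0 q_ge0 q_one q_B0).
have oK : opc (fun v => convol (kK5 q) (Dd (Dd v))).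
  exact: (opc_comp (opk_opc o5) (opc_comp oD oD)).
exact: opc_tame (opc_iter n oK) tv.
Qed.

(** The function g is J^(s+1) E u. For the derivative, s of the factors J are turned into kernels
    times [Dd]; the one left over keeps the resulting operators in [opk], so that the last two
    bounds involve [pmax d] only. *)
Theorem realization (r s : nat) : (s <= 2 * r)%N -> exists W C, [/\ opc W, 0 <= C &
  forall u, tame u -> let g := J (W u) in let d := iter s Dd u in
  [/\ forall x, `|u x - g x| <= C * (`|d x| + pmax d x),
      exists2 gs, nder s g gs /\ borel gs & forall x, `|gs x| <= C * pmax d x &
      forall x, `|iter r IA g x| <= C * pmax d x]].
Proof.
move=> sr.
have [E [Ou [oE oO EO]]] := approximate_inverse s.+1 s.
have [C1 C10 B1] := opc_bound oO.
(* Here m is s / 2 rounded up: m factors I - A, each paired with a factor J, yield 2 m factors [Dd],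
   which is at least s, and both m <= r and m <= s leave enough factors of either kind. *)
have [m [m1 m2 m3]] : exists m, [/\ (s <= 2 * m)%N, (m <= r)%N & (m <= s)%N].
  exists (uphalf s); rewrite uphalf_half; split.
  - by rewrite -{1}(odd_double_half s) -muln2 mulnC; case: (odd s); lia.
  - by have := odd_double_half s; rewrite -muln2; case: (odd s) => /=; lia.
  - by have := odd_double_half s; rewrite -muln2; case: (odd s) => /=; lia.
pose L2 v := J (E (iter s (convol (kK2 q)) v)).
have oL2 : opk L2.
  exact: (opk_comp (opk_J gamma_gt0 q_ge0 q_one q_B0) (opc_comp oE (opc_iter s (opk_opc o2)))).
have [C2 C20 B2] := opk_bound oL2.
(* What remains of (I - A)^r J^(s+1) E once the factor Dd^s has been split off. *)
pose L3 v := J (iter (r - m) IA (iter (s - m) J (E (iter m (convol (kK5 q)) (iter (2 * m - s) Dd v))))).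
have oL3 : opk L3.
  apply: (opk_comp (opk_J gamma_gt0 q_ge0 q_one q_B0)).
  apply: (opc_comp (opc_iter (r - m) oI)); apply: (opc_comp (opc_iter (s - m) oJ)).
  apply: (opc_comp oE); apply: (opc_comp (opc_iter m (opk_opc o5))).
  exact: opc_iter oD.
have [C3 C30 B3] := opk_bound oL3.
exists (fun u => iter s J (E u)), (C1 + C2 + C3); split.
- exact: (opc_comp (opc_iter s oJ) oE).
- by rewrite !addr_ge0.
move=> u tu g d.
have tE := opc_tame oE tu.
have td : tame d := opc_tame (opc_iter s oD) tu.
have pd x := pmax_ge0 d x.
split.
- move=> x; have := congr1 (fun f => f x) (EO _ tu); rewrite iterS -/g => /= ->.
  apply: (le_trans (B1 d x td)); rewrite ler_wpM2r ?addr_ge0//.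
  by rewrite -addrA lerDl addr_ge0.
- exists (L2 d); first (split; last exact: (opc_tame (opk_opc oL2) td).1).
    rewrite /g -iterS iterSr.
    have -> : L2 d = iter s (K2D q) (J (E u)); last first.
      by apply: nder_J; exact: opc_tame oJ tE.
    have tJE := opc_tame oJ tE.
    rewrite (iter_comm s (opk_opc o2) oD tJE).
    have oDs := opc_iter s oD; have o2s := opc_iter s (opk_opc o2).
    rewrite (opc_comm oDs oJ tE) (opc_comm oDs oE tu) -/d.
    by rewrite (opc_comm o2s oJ (opc_tame oE td)) (opc_comm o2s oE td).
  move=> x; apply: (le_trans (B2 d x td)); rewrite ler_wpM2r//.
  by rewrite addrAC lerDr addr_ge0.
- move=> x.
  have -> : iter r IA g = L3 d.
    have o5m := opc_iter m (opk_opc o5); have oIm := opc_iter m oI.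
    have oIr := opc_iter (r - m) oI; have oJs := opc_iter (s - m) oJ.
    have oJm := opc_iter m oJ; have oDm := opc_iter (2 * m - s) oD.
    have oD2 := opc_iter (2 * m) oD.
    rewrite /g -{1}(subnK m2) iterD -{1}(subnK m3) iterD.
    have tJm := opc_tame oJm tE; have tJs := opc_tame oJs tJm.
    rewrite (opc_comm oIm oJ tJs) (opc_comm oIm oJs tJm) (IA_iter m tE).
    rewrite (opc_comm oD2 oE tu).
    have -> : iter (2 * m) Dd u = iter (2 * m - s) Dd d by rewrite /d -iterD subnK.
    have tdm := opc_tame oDm td.
    rewrite (opc_comm o5m oE tdm).
    have t5 := opc_tame oE (opc_tame o5m tdm).
    by rewrite (opc_comm oIr oJ (opc_tame oJs t5)).
  apply: (le_trans (B3 d x td)); rewrite ler_wpM2r//.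
  by rewrite lerDr addr_ge0.
Qed.
End Realization.

(** * Smooth functions *)

Section SmoothFunctions.
Variable R : realType.
Implicit Types (f g h : R -> R) (a b c x y t C : R) (n : nat) (p : {poly R}).

Fixpoint smN n f : Prop :=
  if n is m.+1 then exists2 f', der f f' & smN m f' else True.
Definition smooth f := forall n, smN n f.

Lemma der_uniq f g h : der f g -> der f h -> g = h.
Proof. by move=> fg fh; rewrite -(der_derive1 fg) -(der_derive1 fh). Qed.

Lemma smooth_der f f' : der f f' -> smooth f -> smooth f'.
Proof. by move=> ff sf n; have [g fg] := sf n.+1; rewrite (der_uniq ff fg). Qed.
Lemma smooth_exder f : smooth f -> exists2 f', der f f' & smooth f'.
Proof. by move=> sf; have [g fg _] := sf 1; exists g => //; exact: smooth_der sf. Qed.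

Lemma smNW n f : smN n.+1 f -> smN n f.
Proof.
elim: n f => // n IH f [f' ff' sf']; exists f' => //; exact: IH.
Qed.
Lemma smN_cst n c : smN n (fun=> c).
Proof. by elim: n c => // n IH c; exists (fun=> 0) => //; exact: der_cst. Qed.
Lemma smN_D n f g : smN n f -> smN n g -> smN n (fun x => f x + g x).
Proof.
elim: n f g => // n IH f g [f' ff sf] [g' gg sg].
by exists (fun x => f' x + g' x); [exact: derD|exact: IH].
Qed.
Lemma smN_M n f g : smN n f -> smN n g -> smN n (fun x => f x * g x).
Proof.
elim: n f g => // n IH f g sf sg; have [sf1 sg1] := (smNW sf, smNW sg).
case: sf sg => [f' ff sf] [g' gg sg].
exists (fun x => f' x * g x + f x * g' x); first exact: derM.
by apply: smN_D; exact: IH.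
Qed.
Lemma smN_comp_aff n f a b : smN n f -> smN n (fun x => f (a * x + b)).
Proof.
elim: n f => // n IH f [f' ff sf]; exists (fun x => a * f' (a * x + b)).
  apply: der_ext (der_comp ff (derD (der_scale a) (der_cst b))) => x //=.
  by rewrite addr0.
by apply: smN_M; [exact: smN_cst|exact: IH].
Qed.
Lemma smN_V n f : (forall x, f x != 0) -> smN n f -> smN n (fun x => (f x)^-1).
Proof.
move=> f0; elim: n f f0 => // n IH f f0 sf; have sf1 := smNW sf.
case: sf => [f' ff sf]; exists (fun x => -1 * (f' x * ((f x)^-1 * (f x)^-1))).
  by apply: der_ext (derV f0 ff) => x //=; rewrite mulN1r expr2 invfM.
apply: smN_M; first exact: smN_cst.
by apply: smN_M => //; apply: smN_M; exact: IH.
Qed.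

Lemma smooth_cst c : smooth (fun=> c). Proof. by move=> n; exact: smN_cst. Qed.
Lemma smoothD f g : smooth f -> smooth g -> smooth (fun x => f x + g x).
Proof. by move=> sf sg n; exact: smN_D. Qed.
Lemma smoothM f g : smooth f -> smooth g -> smooth (fun x => f x * g x).
Proof. by move=> sf sg n; exact: smN_M. Qed.
Lemma smoothN f : smooth f -> smooth (fun x => - f x).
Proof.
move=> sf; have := smoothM (smooth_cst (-1)) sf; congr smooth.
by apply/funext => x; rewrite mulN1r.
Qed.
Lemma smoothB f g : smooth f -> smooth g -> smooth (fun x => f x - g x).
Proof. by move=> sf /smoothN; exact: smoothD. Qed.
Lemma smooth_comp_aff f a b : smooth f -> smooth (fun x => f (a * x + b)).
Proof. by move=> sf n; exact: smN_comp_aff. Qed.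
Lemma smoothV f : (forall x, f x != 0) -> smooth f -> smooth (fun x => (f x)^-1).
Proof. by move=> f0 sf n; exact: smN_V. Qed.
Lemma smooth_id : smooth (fun x => x).
Proof. by case=> // n; exists (fun=> 1); [exact: der_id|exact: smN_cst]. Qed.
Lemma smN_trig n a : smN n (fun x => cos (a * x)) /\ smN n (fun x => sin (a * x)).
Proof.
elim: n => // n [c s]; split.
  exists (fun x => - a * sin (a * x)).
    by apply: der_ext (der_cosZ a) => x //=; rewrite mulNr.
  by apply: smN_M => //; exact: smN_cst.
exists (fun x => a * cos (a * x)); first exact: der_sinZ.
by apply: smN_M => //; exact: smN_cst.
Qed.
Lemma smooth_cos a : smooth (fun x => cos (a * x)).
Proof. by move=> n; case: (smN_trig n a). Qed.
Lemma smooth_sin a : smooth (fun x => sin (a * x)).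
Proof. by move=> n; case: (smN_trig n a). Qed.

Lemma smooth_derive1n f n : smooth f ->
  der (derive1n n f) (derive1n n.+1 f) /\ smooth (derive1n n f).
Proof.
move=> sf; elim: n => [|n [IH IH2]].
  have [f' ff sf'] := smooth_exder sf; split; last exact: sf.
  by rewrite derive1nS !derive1n0 (der_derive1 ff).
have s1 := smooth_der IH IH2; split; last exact: s1.
have [f' ff sf'] := smooth_exder s1.
by rewrite [X in der _ X]derive1nS (der_derive1 ff).
Qed.

(** The polynomial in 1 / x makes the family of functions p (1 / x) exp (- 1 / x) stable under
    differentiation, so that smoothness is an induction over all p at once. *)
Definition expinv p x := if 0 < x then p.[x^-1] * expR (- x^-1) else 0.

(** The n-th power of y / (n + 1) <= exp (y / (n + 1)); dividing by n + 1 covers n = 0 as well. *)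
Lemma expR_pow_bound n : exists2 C, 0 <= C & forall y, 0 < y -> y ^+ n * expR (- y) <= C.
Proof.
exists (n.+1%:R ^+ n); first by rewrite exprn_ge0.
move=> y y0; rewrite expRN ler_pdivrMr ?expR_gt0//.
have n0 : 0 < n.+1%:R :> R by rewrite ltr0n.
have : (y / n.+1%:R) ^+ n <= expR (y / n.+1%:R) ^+ n.
  rewrite lerXn2r ?nnegrE ?expR_ge0//; first by rewrite divr_ge0 ?ltW.
  by rewrite (le_trans _ (expR_ge1Dx _))// lerDr.
rewrite expr_div_n ler_pdivrMr ?exprn_gt0// => H.
apply: (le_trans H); rewrite mulrC ler_wpM2l ?exprn_ge0//.
rewrite -expRM_natl ler_expR mulrCA ler_piMr ?(ltW y0)//.
by rewrite ler_pdivrMr// mul1r ler_nat.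
Qed.

Lemma poly_exp_bound p : exists2 C, 0 <= C & forall y, 0 < y -> `|p.[y]| * expR (- y) <= C.
Proof.
have /boolp.choice[F FP] : forall n, exists C, 0 <= C /\ forall y, 0 < y -> y ^+ n * expR (- y) <= C.
  by move=> n; have [C C0 CP] := expR_pow_bound n; exists C.
exists (\sum_(i < size p) `|p`_i| * F i).
  by apply: sumr_ge0 => i _; rewrite mulr_ge0//; case: (FP i).
move=> y y0; rewrite horner_coef.
apply: (@le_trans _ _ ((\sum_(i < size p) `|p`_i| * y ^+ i) * expR (- y))).
  rewrite ler_wpM2r ?expR_ge0// (le_trans (ler_norm_sum _ _ _))// ler_sum// => i _.
  by rewrite normrM (ger0_norm (exprn_ge0 _ (ltW y0))).
rewrite mulr_suml ler_sum// => i _; rewrite -mulrA ler_wpM2l//.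
by case: (FP i) => _; exact.
Qed.

Lemma der_horner p : der (horner p) (horner p^`()).
Proof. by move=> x; exact: is_derive_poly. Qed.

Lemma near_dist x d (P : R -> Prop) : 0 < d -> (forall t, `|t - x| < d -> P t) ->
  \forall t \near x, P t.
Proof. by move=> d0 H; exists d => //= t /=; rewrite distrC; exact: H. Qed.

Lemma der_expinv p : der (expinv p) (expinv ('X^2 * (p - p^`()))).
Proof.
move=> x; have [x0|x0|->] := ltrgt0P x.
- have xn0 : x != 0 by rewrite gt_eqF.
  pose f t := p.[t^-1] * expR (- t^-1).
  apply: (@near_eq_is_derive _ _ _ f).
    apply: (near_dist x0) => t tx; rewrite /expinv /f ifT//.
    by move: tx; rewrite ltr_distl => /andP[+ _]; rewrite subrr.
  have dV : is_derive x (1 : R) (fun t => t^-1) (- (x ^+ 2)^-1).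
    apply: is_derive_eq; first exact: is_deriveV.
    by rewrite /GRing.scale/= mulr1.
  have d1 : is_derive x (1 : R) (fun t => p.[t^-1]) (p^`().[x^-1] * - (x ^+ 2)^-1).
    exact: (@is_derive1_comp _ (horner p) (fun t => t^-1) x _ _ (der_horner p x^-1) dV).
  have d2 : is_derive x (1 : R) (fun t => expR (- t^-1)) (expR (- x^-1) * (x ^+ 2)^-1).
    have dN : is_derive x (1 : R) (fun t => - t^-1) (- - (x ^+ 2)^-1) by exact: is_deriveN.
    rewrite -[X in _ * X]opprK.
    exact: (@is_derive1_comp _ expR (fun t => - t^-1) x _ _ (is_derive_expR _) dN).
  have d3 := is_deriveM d1 d2.
  apply: (@is_derive_eq _ _ _ f x 1 _ _ d3).
  rewrite /expinv x0 /GRing.scale/= !hornerE /= exprVn; ring.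
- apply: (@near_eq_is_derive _ _ _ (fun=> 0)).
    apply: (@near_dist x (- x)) => [|t tx]; first by rewrite oppr_gt0.
    rewrite /expinv ifF//; apply/negbTE; rewrite -leNgt ltW//.
    by move: tx; rewrite ltr_distl => /andP[_]; rewrite subrr.
  by rewrite /expinv ifF; [exact: is_derive_cst|apply/negbTE; rewrite -leNgt ltW].
(* At 0 the difference quotient is h times (1 / h)^2 p (1 / h) exp (- 1 / h), and the factor after h
   is bounded: hence the bound for ['X^2 * p]. *)
- have [C C0 CP] := poly_exp_bound ('X^2 * p).
  rewrite [X in is_derive _ _ _ X](_ : _ = 0); last by rewrite /expinv ltxx.
  have L : h^-1 *: (expinv p (h *: 1 + 0) - expinv p 0) @[h --> 0^'] --> (0 : R).
    apply/cvgr0Pnorm_le => e e0; rewrite near_withinE.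
    have d0 : 0 < e / (C + 1) by rewrite divr_gt0// ltr_wpDl.
    apply: (near_dist d0) => h; rewrite subr0 => hd _.
    have -> : h *: (1 : R) = h by rewrite /GRing.scale/= mulr1.
    rewrite /expinv ltxx subr0 addr0.
    case: ltP => h0; last by rewrite scaler0 normr0 ltW.
    rewrite /GRing.scale/= normrM normfV (gtr0_norm h0) normrM (gtr0_norm (expR_gt0 _)).
    have := CP h^-1; rewrite invr_gt0 => /(_ h0).
    rewrite !hornerE /= normrM ger0_norm ?exprn_ge0 ?invr_ge0 ?(ltW h0)// => H.
    apply: (@le_trans _ _ (h * C)).
      apply: le_trans (ler_wpM2l (ltW h0) H).
      by rewrite exprVn expr2 !mulrA invfM mulrA divff ?gt_eqF// mul1r.
    have : h * (C + 1) < e.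
      by rewrite -ltr_pdivlMr ?ltr_wpDl// (le_lt_trans _ hd)// ler_norm.
    move=> H2; rewrite (le_trans _ (ltW H2))// ler_wpM2l ?(ltW h0)// lerDl.
    exact: ler01.
  apply: DeriveDef; first by apply/cvg_ex; exists 0.
  exact: cvg_lim L.
Qed.

Lemma smooth_expinv p : smooth (expinv p).
Proof.
move=> n; elim: n p => // n IH p.
by exists (expinv ('X^2 * (p - p^`()))); [exact: der_expinv|exact: IH].
Qed.

Definition einv := expinv 1.
Lemma einv_ge0 x : 0 <= einv x.
Proof. by rewrite /einv /expinv hornerC mul1r; case: ifP => // _; exact: expR_ge0. Qed.
Lemma einv_gt0 x : 0 < x -> 0 < einv x.
Proof. by move=> x0; rewrite /einv /expinv hornerC mul1r x0 expR_gt0. Qed.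
Lemma einv_eq0 x : x <= 0 -> einv x = 0.
Proof. by move=> x0; rewrite /einv /expinv ltNge x0. Qed.

Definition step x := einv x * (einv x + einv (1 - x))^-1.
Lemma step_den x : 0 < einv x + einv (1 - x).
Proof.
have [x0|x0] := ltP 0 x; first by rewrite ltr_pwDl ?einv_gt0 ?einv_ge0.
by rewrite ltr_wpDl ?einv_ge0// einv_gt0// subr_gt0 (le_lt_trans x0).
Qed.
Lemma step0 x : x <= 0 -> step x = 0.
Proof. by move=> x0; rewrite /step einv_eq0// mul0r. Qed.
Lemma step1 x : 1 <= x -> step x = 1.
Proof.
move=> x1; rewrite /step [einv (1 - x)]einv_eq0 ?subr_le0// addr0 mulfV//.
by rewrite gt_eqF// einv_gt0// (lt_le_trans ltr01).
Qed.
Lemma step_ge0 x : 0 <= step x.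
Proof. by rewrite mulr_ge0 ?einv_ge0// invr_ge0 ltW// step_den. Qed.
Lemma smooth_step : smooth step.
Proof.
have se := smooth_expinv 1; apply: smoothM => //.
apply: smoothV => [x|]; first by rewrite gt_eqF// step_den.
apply: smoothD => //; have := smooth_comp_aff (-1) 1 se; congr smooth.
by apply/funext => x; rewrite mulN1r addrC.
Qed.

Definition bumpR x := step (1 * x + 2) * step (-1 * x + 2).
Lemma smooth_bump : smooth bumpR.
Proof. by apply: smoothM; apply: smooth_comp_aff; exact: smooth_step. Qed.
Lemma bump_ge0 x : 0 <= bumpR x.
Proof. by rewrite mulr_ge0 ?step_ge0. Qed.
Lemma bump1 x : `|x| <= 1 -> bumpR x = 1.
Proof.
by rewrite ler_norml => /andP[x1 x2]; rewrite /bumpR !step1 ?mulr1//; lra.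
Qed.
Lemma bump0 x : 2 <= `|x| -> bumpR x = 0.
Proof.
rewrite ler_normr /bumpR => /orP[x2|x2].
  by rewrite [X in _ * X]step0 ?mulr0//; lra.
by rewrite step0 ?mul0r//; lra.
Qed.
Lemma bump_even x : bumpR (- x) = bumpR x.
Proof. by rewrite /bumpR mulrC; congr (step _ * step _); ring. Qed.

Definition csmth a f := smooth f /\ forall x, a <= `|x| -> f x = 0.

(** Where |x| > a the function vanishes in a neighbourhood; the two points |x| = a are reached by
    continuity of the derivative. *)
Lemma csmth_der a f f' : csmth a f -> der f f' -> csmth a f'.
Proof.
move=> [sf f0] ff; have sf' := smooth_der ff sf; split => // x.
have key t : a < `|t| -> f' t = 0.
  move=> at_; have d0 : 0 < `|t| - a by rewrite subr_gt0.
  have : is_derive t (1 : R) f 0.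
    apply: (@near_eq_is_derive R R R (fun=> 0) f t 1 0).
    apply: (near_dist d0) => s st; rewrite f0//.
    have := ler_distD t 0 s; rewrite !sub0r !normrN.
    have := lerB_dist t s; move: st; rewrite (distrC s t); lra.
  by move=> d1; have [_ <-] := ff t; have [_ ->] := d1.
rewrite le_eqVlt => /predU1P[E|]; last exact: key.
have cf' : continuous f'.
  by have [g gg _] := smooth_exder sf'; exact: (der_cont gg).
apply/eqP; rewrite -normr_eq0 eq_le normr_ge0 andbT; apply/ler_addgt0Pl => e e0.
have := cf' x; move/cvgrPdist_lt => /(_ e e0) /nbhs_ballP[d /= d0 H].
have [x0|x0] := leP 0 x.
  have : ball x d (x + d / 2).
    by rewrite /ball /= opprD addNKr normrN ger0_norm ?divr_ge0 ?(ltW d0)// ltr_pdivrMr// ltr_pMr// ltr1n.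
  move=> /H; rewrite (key (x + d / 2)) ?subr0 => [/ltW|]; first by rewrite addr0.
  by rewrite E ger0_norm// ger0_norm ?addr_ge0 ?divr_ge0 ?(ltW d0)// ltrDl divr_gt0.
have : ball x d (x - d / 2).
  by rewrite /ball /= opprB addrCA subrr addr0 ger0_norm ?divr_ge0 ?(ltW d0)// ltr_pdivrMr// ltr_pMr// ltr1n.
have dd : 0 < d / 2 by rewrite divr_gt0.
move=> /H; rewrite (key (x - d / 2)) ?subr0 => [/ltW|]; first by rewrite addr0.
by rewrite E !ltr0_norm//; lra.
Qed.

Lemma csmth_M a f g : csmth a f -> smooth g -> csmth a (fun x => f x * g x).
Proof.
by move=> [sf f0] sg; split=> [|x /f0->]; [exact: smoothM|rewrite mul0r].
Qed.

Lemma smooth_cont f : smooth f -> continuous f.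
Proof. by move=> /smooth_exder[f' ff _]; exact: (der_cont ff). Qed.

Lemma csmth_bnd a f : csmth a f -> bnd f.
Proof.
move=> [sf f0]; have cf := smooth_cont sf.
have [a0|a0] := ltP a 0.
  by exists 0 => x; rewrite f0 ?normr0// (le_trans (ltW a0)).
have aa : - a <= a by rewrite (le_trans _ a0)// oppr_le0.
have cn : {within `[- a, a], continuous (fun x => `|f x|)}.
  apply: continuous_subspaceT => x; apply: cvg_norm; exact: cf.
have [c _ cP] := EVT_max aa cn; exists `|f c| => x.
have [xa|xa] := leP `|x| a; last by rewrite f0 ?normr0// ltW.
by apply: cP; rewrite in_itv/= -ler_norml.
Qed.

Lemma csmth_B0 a f : csmth a f -> B0 f.
Proof.
move=> cf; have [f1 d1 s1] := smooth_exder cf.1; have c1 := csmth_der cf d1.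
have [f2 d2 s2] := smooth_exder s1; have c2 := csmth_der c1 d2.
by exists f1, f2; split=> //; apply: csmth_bnd; [exact: cf|exact: c1|exact: c2].
Qed.

Lemma smooth_exp n : smooth (fun x => x ^+ n).
Proof.
elim: n => [|n IH]; first by under eq_fun do rewrite expr0; exact: smooth_cst.
by under eq_fun do rewrite exprS; apply: smoothM => //; exact: smooth_id.
Qed.

Lemma csmth_decay a f : csmth a f -> decay f.
Proof.
move=> cf.
have h : csmth a (fun x => f x * (1 + x ^+ 2)).
  by apply: csmth_M cf _; apply: smoothD; [exact: smooth_cst|exact: smooth_exp].
have := decay_poi (csmth_B0 h); congr decay; apply/funext => x.
by rewrite mulrCA poi1P mulr1.
Qed.
End SmoothFunctions.

(** * Averages on the Banach lattice *)

Section Lattice.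
Variable R : realType.
Implicit Types (u v w : R -> R) (f g : R -> R[i]) (a b c h x y t C L : R).
Local Notation leb := (@lebesgue_measure R).

(** Monotone convergence for kernels cut off to growing windows, which at each point eventually
    coincide with their limit. *)
Lemma mono_intg (g_ : nat -> R -> R) (g : R -> R) c :
  (forall n, intg (g_ n)) -> (forall n y, 0 <= g_ n y) ->
  (forall n m y, (n <= m)%N -> g_ n y <= g_ m y) ->
  (forall y, exists N, forall n, (N <= n)%N -> g_ n y = g y) ->
  (forall n, It (g_ n) <= c) -> intg g /\ It g <= c.
Proof.
move=> ig g0 gm gE gc.
have gcv y : (g_ n y)%:E @[n --> \oo] --> (g y)%:E.
  have [N NE] := gE y; apply: cvg_near_cst; exists N => // n /= Nn.
  by rewrite NE.
have mg : measurable_fun [set: measurableTypeR R] (EFin \o g).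
  apply: (@emeasurable_fun_cvg _ _ _ setT (fun n y => (g_ n y)%:E)) => [n|y _]; last exact: gcv.
  by apply/measurable_EFinP; exact: intg_borel (ig n).
have g0' y : 0 <= g y by have [N /(_ N (leqnn N)) <-] := gE y.
have H : (\int[leb]_y (g y)%:E <= c%:E)%E.
  rewrite (_ : (\int[leb]_y (g y)%:E = \int[leb]_y limn (fun n => (g_ n y)%:E))%E); last first.
    by apply: eq_integral => y _; apply/esym/cvg_lim => //; exact: gcv.
  rewrite (@monotone_convergence _ _ _ leb setT measurableT (fun n y => (g_ n y)%:E)).
  - apply: lime_le.
      apply: ereal_nondecreasing_is_cvgn => n m nm.
      apply: ge0_le_integral => //.
      + by move=> y _; rewrite lee_fin.
      + by apply/measurable_EFinP; exact: intg_borel (ig n).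
      + by apply/measurable_EFinP; exact: intg_borel (ig m).
      + by move=> y _; rewrite lee_fin gm.
    by apply: nearW => n; rewrite (ItE (ig n)) lee_fin.
  - by move=> n; apply/measurable_EFinP; exact: intg_borel (ig n).
  - by move=> n y _; rewrite lee_fin.
  - by move=> y _ n m nm; rewrite lee_fin gm.
have i : intg g.
  apply/integrableP; split => //.
  rewrite (_ : (\int[leb]_x `|(EFin \o g) x| = \int[leb]_y (g y)%:E)%E); last first.
    by apply: eq_integral => y _ /=; rewrite ger0_norm.
  by rewrite (le_lt_trans H)// ltry.
by split => //; rewrite -lee_fin -ItE.
Qed.

Lemma absc_real a : absc a%:C = `|a|.
Proof. by rewrite /absc /ComplexField.Normc.normc /= expr0n addr0 sqrtr_sqr. Qed.
Lemma absc_ofreal u x : absc (ofreal u x) = `|u x|.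
Proof. exact: absc_real. Qed.
Lemma absc_Re (z : R[i]) : `|complex.Re z| <= absc z.
Proof.
by case: z => a b; rewrite /absc /ComplexField.Normc.normc /= -sqrtr_sqr ler_wsqrtr// lerDl sqr_ge0.
Qed.
Lemma absc_Im (z : R[i]) : `|complex.Im z| <= absc z.
Proof.
by case: z => a b; rewrite /absc /ComplexField.Normc.normc /= -sqrtr_sqr ler_wsqrtr// lerDr sqr_ge0.
Qed.
Lemma absc_le (z : R[i]) : absc z <= `|complex.Re z| + `|complex.Im z|.
Proof.
case: z => a b; rewrite /absc /ComplexField.Normc.normc /=.
rewrite -[leRHS]ger0_norm ?addr_ge0// -sqrtr_sqr ler_wsqrtr//.
rewrite sqrrD !real_normK ?num_real// addrAC lerDl mulrn_wge0// mulr_ge0//.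
Qed.
Lemma absc_ge0 (z : R[i]) : 0 <= absc z.
Proof. by case: z => a b; rewrite /absc /ComplexField.Normc.normc /= sqrtr_ge0. Qed.

Lemma lmeas_borel u : borel u -> lmeasurable u.
Proof. by move=> mu_; exists u => //; exact: aeW. Qed.
Lemma cmeas_ofreal u : borel u -> cmeasurable (ofreal u).
Proof. by move=> mu_; split; apply: lmeas_borel => //; exact: borel_cst. Qed.

Lemma ofrealD u v : ofreal u \+ ofreal v = ofreal (fun x => u x + v x).
Proof. by apply/funext => x /=; rewrite /ofreal rmorphD. Qed.
Lemma ofrealZ c u : (fun x => c%:C * ofreal u x) = ofreal (fun x => c * u x).
Proof. by apply/funext => x; rewrite /ofreal rmorphM. Qed.

Definition win L : R -> R := \1_`[- (L / 2), L / 2]%classic.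
Definition avg L u x := L^-1 * convol (win L) u x.

Lemma winE L x y : win L (x - y) = \1_`[x - L / 2, x + L / 2]%classic y :> R.
Proof.
rewrite /win !itvE; congr (nat_of_bool _)%:R.
by apply/idP/idP => /andP[? ?]; apply/andP; split; lra.
Qed.
Lemma win_ge0 L x : 0 <= win L x.
Proof. by rewrite /win itvE. Qed.

Lemma steklov_real L u : steklov L (ofreal u) = ofreal (avg L u).
Proof.
apply/funext => x; rewrite /steklov /cintegral /ofreal /avg.
have -> : \int[Defs.mu R]_(t in `[x - L / 2, x + L / 2]) imfun (ofreal u) t = 0.
  by rewrite /imfun /ofreal /= /Rintegral integral0.
have -> : \int[Defs.mu R]_(t in `[x - L / 2, x + L / 2]) refun (ofreal u) t = convol (win L) u x.
  transitivity (It (fun y => u y * \1_`[x - L / 2, x + L / 2] y)); first by rewrite It_itv.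
  by apply: eq_It => y; rewrite winE mulrC.
by rewrite rmorphM.
Qed.

Variable X : banach_lattice R.
Hypothesis hA : assumption_A X.
Local Notation nm u := (bl_norm X (ofreal u)).

Lemma X_dom u g : borel u -> X g -> (forall x, `|u x| <= absc (g x)) ->
  X (ofreal u) /\ nm u <= bl_norm X g.
Proof.
move=> mu_ Xg ug; apply: bl_ideal => //; first exact: cmeas_ofreal.
by apply: aeW => x; rewrite absc_ofreal.
Qed.
Lemma X_domr u v : borel u -> X (ofreal v) -> (forall x, `|u x| <= v x) ->
  X (ofreal u) /\ nm u <= nm v.
Proof.
by move=> mu_ Xv uv; apply: X_dom => // x; rewrite absc_ofreal (le_trans (uv x))// ler_norm.
Qed.
Lemma X_add u v : X (ofreal u) -> X (ofreal v) ->
  X (ofreal (fun x => u x + v x)) /\ nm (fun x => u x + v x) <= nm u + nm v.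
Proof. by move=> Xu Xv; rewrite -ofrealD; split; [exact: bl_add|exact: bl_norm_add]. Qed.
Lemma X_scale c u : X (ofreal u) ->
  X (ofreal (fun x => c * u x)) /\ nm (fun x => c * u x) = `|c| * nm u.
Proof.
move=> Xu; rewrite -ofrealZ; split; first exact: bl_scale.
by rewrite bl_norm_scale// absc_real.
Qed.
Lemma X_abs u : borel u -> X (ofreal u) ->
  X (ofreal (fun x => `|u x|)) /\ nm (fun x => `|u x|) <= nm u.
Proof.
move=> mu_ Xu; apply: X_dom => // [|x]; first exact: borel_abs.
by rewrite absc_ofreal normr_id.
Qed.

Lemma X_local a b : exists2 c, 0 <= c & forall u, borel u -> X (ofreal u) ->
  intg (fun y => u y * \1_`[a, b] y) /\
  It (fun y => `|u y| * \1_`[a, b] y) <= c * nm u.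
Proof.
have mE : measurable (`[a, b]%classic : set (measurableTypeR R)) by exact: measurable_itv.
have fE : (Defs.mu R `[a, b]%classic < +oo)%E.
  have : (leb `[a, b]%classic < +oo)%E by rewrite lebesgue_measure_itv/=; case: ifP; rewrite -?EFinD ltry.
  exact.
have [_ [c c0 cP]] := bl_local X mE fE; exists c; first exact: ltW.
move=> u mu_ Xu; have := cP _ Xu.
have -> : (\int[Defs.mu R]_(x in `[a, b]) (absc (ofreal u x))%:E =
    \int[leb]_x (`|u x| * \1_`[a, b] x)%:E)%E.
  rewrite integral_mkcond; apply: eq_integral => x _.
  by rewrite patchE absc_ofreal indicE; case: ifP; rewrite ?mulr1 ?mulr0.
move=> H.
have i : intg (fun x => `|u x| * \1_`[a, b] x).
  apply/integrableP; split.
    by apply/measurable_EFinP; apply: borelM; [exact: borel_abs|exact: borel_itv].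
  rewrite (_ : (\int[leb]_x `|(EFin \o _) x| = \int[leb]_x (`|u x| * \1_`[a, b] x)%:E)%E); last first.
    by apply: eq_integral => x _ /=; rewrite ger0_norm// mulr_ge0.
  by rewrite (le_lt_trans H)// ltry.
split; last by rewrite -lee_fin -ItE.
apply: (intg_le _ i) => [|x]; first by apply: borelM => //; exact: borel_itv.
by rewrite normrM (@ger0_norm _ (\1_ _ x)).
Qed.

Lemma intg_win L u x : borel u -> X (ofreal u) -> intg (fun y => win L (x - y) * u y).
Proof.
move=> mu_ Xu; have [c _ /(_ u mu_ Xu)[i _]] := X_local (x - L / 2) (x + L / 2).
by move: i; congr intg; apply/funext => y; rewrite winE mulrC.
Qed.

Lemma avg_borel L u : borel u -> borel (avg L u).
Proof.
move=> mu_; apply: borelM; first exact: borel_cst.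
by apply: borel_convol => //; exact: borel_itv.
Qed.

Lemma avg_ge0 L u x : 0 < L -> 0 <= avg L (fun y => `|u y|) x.
Proof.
move=> L0; rewrite mulr_ge0 ?invr_ge0 ?(ltW L0)//; apply: It_ge0 => y.
by rewrite mulr_ge0 ?win_ge0.
Qed.

Lemma avgZ L c u : borel u -> X (ofreal u) ->
  avg L (fun x => c * u x) = (fun x => c * avg L u x).
Proof.
move=> mu_ Xu; apply/funext => x; rewrite /avg mulrCA; congr (_ * _).
rewrite /convol -ItZ; last exact: intg_win.
by apply: eq_It => y; rewrite mulrCA.
Qed.

(** Assumption A bounds averages on the unit ball only. The scaling divides by [nm u + e'], as the
    norm of u may be 0, and e' then tends to 0. *)
Lemma avg_bound : exists2 M, 0 <= M & forall u L, borel u -> X (ofreal u) -> 0 < L ->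
  X (ofreal (avg L u)) /\ nm (avg L u) <= M * nm u.
Proof.
have [A1 [M AM]] := hA; exists `|M| => // u L mu_ Xu L0.
have XA : X (ofreal (avg L u)) by rewrite -steklov_real; exact: A1.
split=> //; apply/ler_addgt0Pl => e e0; have n0 := bl_norm_ge0 Xu.
have M1 : 0 < `|M| + 1 by rewrite ltr_wpDl.
pose e' := e / (`|M| + 1).
have e'0 : 0 < e' by rewrite divr_gt0.
have ne : 0 < nm u + e' by rewrite ltr_wpDl.
pose d := (nm u + e')^-1; have d0 : 0 < d by rewrite invr_gt0.
have [Xd Ed] := X_scale d Xu.
have H1 : nm (fun x => d * u x) <= 1.
  by rewrite Ed gtr0_norm// /d mulrC ler_pdivrMr// mul1r lerDl ltW.
have := AM _ _ Xd L0 H1; rewrite steklov_real (avgZ _ _ mu_ Xu) (X_scale d XA).2 gtr0_norm//.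
rewrite /d mulrC ler_pdivrMr// => H2; apply: (le_trans H2).
apply: (@le_trans _ _ (`|M| * (nm u + e'))); first by rewrite ler_wpM2r ?ler_norm// ltW.
rewrite mulrDr addrC lerD2r /e' mulrA ler_pdivrMr// mulrC ler_wpM2l ?(ltW e0)//.
by rewrite lerDl.
Qed.

(** The window of length L about x lies in the window of length 2 L about y; the factor 2 is the
    ratio of the lengths. *)
Lemma avg_shift L u x y : borel u -> X (ofreal u) -> 0 < L -> `|x - y| <= L / 2 ->
  avg L (fun t => `|u t|) x <= 2 * avg (2 * L) (fun t => `|u t|) y.
Proof.
move=> mu_ Xu L0 xy; have [Xa _] := X_abs mu_ Xu; have ma := borel_abs mu_.
rewrite /avg mulrA invfM mulrA mulfV// mul1r ler_pM2l ?invr_gt0//.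
apply: le_It => [||t]; [exact: intg_win|exact: intg_win|].
rewrite ler_wpM2r// /win !itvE; case: (boolP (_ <= x - t <= _)) => // /andP[t1 t2].
move: xy; rewrite ler_norml => /andP[? ?].
by case: (boolP (_ <= y - t <= _)) => //; rewrite negb_and -!ltNge => /orP[]; lra.
Qed.

(** Pointwise control from the norm: by [avg_shift] the value at x is dominated by the values over
    an interval of length 1 around x, and these are integrated by [X_local]. *)
Lemma avg_sup x : exists2 B, 0 <= B & forall u L, borel u -> X (ofreal u) -> 1 <= L ->
  avg L (fun t => `|u t|) x <= B * nm u.
Proof.
have [M M0 MP] := avg_bound; have [c c0 cP] := X_local (x - 2^-1) (x + 2^-1).
exists (2 * (c * M)); first by rewrite !mulr_ge0.
move=> u L mu_ Xu L1; have [Xa na] := X_abs mu_ Xu; have ma := borel_abs mu_.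
have L0 : 0 < L by rewrite (lt_le_trans ltr01).
have [Xv nv] := MP _ (2 * L) ma Xa (mulr_gt0 (ltr0n _ 2) L0).
have mv := avg_borel (2 * L) ma.
have [iv Iv] := cP _ mv Xv.
set a := avg L _ x.
have -> : a = It (fun y => a * \1_`[x - 2^-1, x + 2^-1] y).
  by rewrite (ftc (der_scale a) (der_cont (@der_cst R a))); [field|lra].
apply: (@le_trans _ _ (2 * It (fun y => `|avg (2 * L) (fun t => `|u t|) y| * \1_`[x - 2^-1, x + 2^-1] y))).
  have ia : intg (fun y => `|avg (2 * L) (fun t => `|u t|) y| * \1_`[x - 2^-1, x + 2^-1] y).
    have := intg_abs iv; congr intg; apply/funext => y.
    by rewrite normrM (@ger0_norm _ (\1_ _ y)).
  rewrite -ItZ//; apply: le_It => [||y].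
  - by apply: intg_itv_cont; exact: (der_cont (@der_cst R a)).
  - exact: intgZ.
  - rewrite itvE; case: (boolP (_ <= y <= _)) => [/andP[y1 y2]|_]; last by rewrite !mulr0.
    rewrite !mulr1 ger0_norm ?avg_ge0 ?mulr_gt0//; apply: avg_shift => //.
    by rewrite ler_norml; apply/andP; split; lra.
rewrite -mulrA ler_wpM2l// (le_trans Iv)// -mulrA ler_wpM2l// (le_trans nv)//.
by rewrite ler_wpM2l.
Qed.

Definition poih h t := h^-1 * poi (t / h).
Definition pmaxh h u x := It (fun y => poih h (x - y) * `|u y|).
(* Partial sums of a dyadic majorant of [pmaxh]. *)
Definition maj h u n x := \sum_(j < n) 8 * (2^-1) ^+ j * avg (2 ^+ j.+1 * h) (fun y => `|u y|) x.

Lemma poih_ge0 h t : 0 < h -> 0 <= poih h t.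
Proof. by move=> h0; rewrite mulr_ge0 ?poi_ge0// invr_ge0 ltW. Qed.

(** Where 2^n h < |t| the kernel is at most h^-1 4^-n, and this is exactly the coefficient of the
    term j = n + 1 of the sum. The constant 8 is chosen for that. *)
Lemma poih_dyadic h n t : 0 < h -> poih h t * win (2 ^+ n.+1 * h) t <=
  \sum_(j < n.+1) 8 * (2^-1) ^+ j * ((2 ^+ j.+1 * h)^-1 * win (2 ^+ j.+1 * h) t).
Proof.
move=> h0; have hn0 : h != 0 by rewrite gt_eqF.
have wE j : win (2 ^+ j.+1 * h) t = (`|t| <= 2 ^+ j * h)%R%:R.
  rewrite /win itvE ler_norml; congr (nat_of_bool _)%:R.
  have -> : 2 ^+ j.+1 * h / 2 = 2 ^+ j * h by rewrite exprS; field.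
  by [].
elim: n => [|n IH].
  rewrite big_ord1 expr0 mulr1 mulrA ler_wpM2r ?win_ge0// /poih expr1 invfM mulrA.
  rewrite mulrC ler_wpM2r ?invr_ge0 ?(ltW h0)// (le_trans (poi_le1 _))//; lra.
rewrite big_ord_recr /=.
have [tn|tn] := leP `|t| (2 ^+ n * h).
  rewrite -[leLHS]addr0 lerD//; last first.
    by rewrite !mulr_ge0 ?exprn_ge0 ?win_ge0// invr_ge0 mulr_ge0 ?exprn_ge0// ltW.
  apply: le_trans IH; rewrite !wE tn mulr1.
  by rewrite ler_piMr ?poih_ge0// lern1 leq_b1.
rewrite -[leLHS]add0r lerD//.
  apply: sumr_ge0 => j _.
  by rewrite !mulr_ge0 ?exprn_ge0 ?win_ge0// invr_ge0 mulr_ge0 ?exprn_ge0// ltW.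
rewrite mulrA ler_wpM2r ?win_ge0//.
have -> : 8 * 2^-1 ^+ n.+1 * (2 ^+ n.+2 * h)^-1 = h^-1 * (2 ^+ n * 2 ^+ n)^-1.
  by rewrite exprVn !exprS; field; rewrite hn0 expf_neq0.
rewrite /poih ler_wpM2l ?invr_ge0 ?(ltW h0)// /poi.
have n2 : 0 < (2 : R) ^+ n by rewrite exprn_gt0.
rewrite lef_pV2 ?posrE ?oneD_gt0 ?mulr_gt0//.
rewrite (@le_trans _ _ ((t / h) ^+ 2))// ?lerDr// -expr2.
rewrite -[leRHS]real_normK ?num_real// ler_sqr ?nnegrE ?(ltW n2)//.
by rewrite normrM normfV (gtr0_norm h0) ler_pdivlMr// ltW.
Qed.

Lemma borel_pmaxh h u : borel u -> borel (pmaxh h u).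
Proof.
move=> mu_; apply: borel_convol; last exact: borel_abs.
apply: borelM; first exact: borel_cst.
apply: borel_comp; first exact: borel_poi.
by apply: borelM; [exact: borel_id|exact: borel_cst].
Qed.

(** The coefficients 8 2^-j sum to at most 16, so Assumption A bounds the norms of all partial sums
    [maj], and the Fatou property gives their limit. That property needs a finite pointwise limit,
    which [avg_sup] provides. *)
Lemma pmaxh_bound : exists2 M, 0 <= M & forall h u, 0 < h -> borel u -> X (ofreal u) ->
  [/\ forall x, intg (fun y => poih h (x - y) * `|u y|),
      X (ofreal (pmaxh h u)) & nm (pmaxh h u) <= M * nm u].
Proof.
have [M M0 MP] := avg_bound; exists (16 * M); first by rewrite mulr_ge0.
move=> h u h0 mu_ Xu; have [Xa na] := X_abs mu_ Xu; have ma := borel_abs mu_.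
have L0 j : 0 < 2 ^+ j.+1 * h by rewrite mulr_gt0 ?exprn_gt0.
have e2 j : 0 <= (2^-1 : R) ^+ j by rewrite exprn_ge0// invr_ge0.
have half n : \sum_(j < n) (2^-1 : R) ^+ j <= 2.
  have : \sum_(j < n) (2^-1 : R) ^+ j = 2 - 2 * 2^-1 ^+ n.
    elim: n => [|n IH]; first by rewrite big_ord0 expr0 mulr1 subrr.
    by rewrite big_ord_recr /= IH exprS; field.
  by move=> ->; rewrite lerBlDr lerDl mulr_ge0.
have term0 j x : 0 <= 8 * 2^-1 ^+ j * avg (2 ^+ j.+1 * h) (fun y => `|u y|) x.
  by apply: mulr_ge0; [exact: mulr_ge0|exact: avg_ge0].
have majS n x : maj h u n.+1 x = maj h u n x + 8 * 2^-1 ^+ n * avg (2 ^+ n.+1 * h) (fun y => `|u y|) x.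
  by rewrite /maj big_ord_recr.
have XF n : X (ofreal (maj h u n)) /\ nm (maj h u n) <= \sum_(j < n) (2^-1) ^+ j * (8 * (M * nm u)).
  elim: n => [|n [XI NI]].
    rewrite big_ord0; have -> : maj h u 0 = (fun x => 0 * u x).
      by apply/funext => x; rewrite /maj big_ord0 mul0r.
    by have [? ->] := X_scale 0 Xu; rewrite normr0 mul0r.
  have [Xv nv] := MP _ _ ma Xa (L0 n).
  have [Xs ns] := X_scale (8 * 2^-1 ^+ n) Xv.
  have -> : maj h u n.+1 = (fun x => maj h u n x + 8 * 2^-1 ^+ n * avg (2 ^+ n.+1 * h) (fun y => `|u y|) x).
    by apply/funext => x; rewrite majS.
  have [Xd nd] := X_add XI Xs; split => //.
  rewrite big_ord_recr /= (le_trans nd)// lerD// ns ger0_norm ?mulr_ge0 ?exprn_ge0//.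
  rewrite -mulrA mulrCA ler_wpM2l ?exprn_ge0// ler_wpM2l// (le_trans nv)//.
  by rewrite ler_wpM2l.
have NF n : nm (maj h u n) <= 16 * M * nm u.
  apply: (le_trans (XF n).2); rewrite -mulr_suml.
  have -> : 16 * M * nm u = 2 * (8 * (M * nm u)) by ring.
  by rewrite ler_wpM2r// !mulr_ge0// bl_norm_ge0.
have majbd x : exists B, forall n, maj h u n x <= B.
  have [B B0 BP] := avg_sup x; have [B' B'0 BP'] := X_local (x - 2^-1) (x + 2^-1).
  have b j : avg (2 ^+ j.+1 * h) (fun y => `|u y|) x <= (1 + h^-1) * (B * nm u).
    have Bn : 0 <= B * nm u by rewrite mulr_ge0// bl_norm_ge0.
    (* Windows shorter than 1, to which [avg_sup] does not apply, are enlarged to length 1 at the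
       price of the factor h^-1. *)
    have [L1|L1] := leP 1 (2 ^+ j.+1 * h).
      by rewrite (le_trans (BP _ _ mu_ Xu L1))// ler_peMl// lerDl invr_ge0 ltW.
    apply: (@le_trans _ _ (h^-1 * avg 1 (fun y => `|u y|) x)).
      rewrite /avg invr1 mul1r.
      apply: ler_pM => //; first by rewrite invr_ge0 ltW.
      - by apply: It_ge0 => y; rewrite mulr_ge0 ?win_ge0.
      - by rewrite lef_pV2 ?posrE// ler_peMl ?(ltW h0)// exprn_ege1// ler1n.
      - apply: le_It => [||y]; [exact: intg_win..|].
        rewrite ler_wpM2r// /win !itvE.
        case: (boolP (_ <= x - y <= _)) => // /andP[? ?].
        case: (boolP (_ <= x - y <= _)) => //; rewrite negb_and -!ltNge => /orP[]; lra.
    have a1 := BP _ _ mu_ Xu (lexx 1).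
    have h1 : 0 <= h^-1 by rewrite invr_ge0 ltW.
    by rewrite mulrDl mul1r (le_trans (ler_wpM2l h1 a1))// lerDr.
  exists (2 * (8 * ((1 + h^-1) * (B * nm u)))) => n.
  apply: (@le_trans _ _ (\sum_(j < n) 2^-1 ^+ j * (8 * ((1 + h^-1) * (B * nm u))))).
    apply: ler_sum => j _; rewrite -mulrA mulrCA ler_wpM2l ?exprn_ge0//.
    by rewrite ler_wpM2l.
  rewrite -mulr_suml ler_wpM2r// !mulr_ge0// ?bl_norm_ge0// addr_ge0// invr_ge0 ltW//.
have majnd x : nondecreasing_seq (fun n => maj h u n x).
  by apply/nondecreasing_seqP => n; rewrite majS lerDl.
have majcv x : cvgn (fun n => maj h u n x).
  apply: nondecreasing_is_cvgn => //; have [B BP] := majbd x.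
  by exists B => _ [n _ <-].
pose F x := limn (fun n => maj h u n x).
have [XF' nF'] : X (ofreal F) /\ nm (maj h u n) @[n --> \oo] --> nm F.
  apply: (@bl_fatou _ X (maj h u) F (16 * M * nm u)) => //.
    by move=> n; exact: (XF n).1.
  apply: aeW => x; split; last exact: majcv.
  move=> n; rewrite majnd// andbT.
  by rewrite /maj; apply: sumr_ge0 => j _.
have nF : nm F <= 16 * M * nm u.
  by apply: (cvgr_to_le nF'); apply: nearW.
(* The kernel cut off to the dyadic windows increases to the whole kernel, and [poih_dyadic] bounds
   each truncated integral by a partial sum of [maj]. *)
have intF x : intg (fun y => poih h (x - y) * `|u y|) /\ pmaxh h u x <= F x.
  have iw n : intg (fun y => poih h (x - y) * win (2 ^+ n.+1 * h) (x - y) * `|u y|).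
    apply: (@intg_le _ _ (fun y => h^-1 * (win (2 ^+ n.+1 * h) (x - y) * `|u y|))).
    + apply: borelM => //; apply: borelM.
        apply: borelM; first exact: borel_cst.
        apply: borel_comp; first exact: borel_poi.
        by apply: borelM; [exact: borel_aff|exact: borel_cst].
      by apply: (@borel_comp _ (win (2 ^+ n.+1 * h))); [exact: borel_itv|exact: borel_aff].
    + by apply: intgZ; exact: intg_win.
    + move=> y; rewrite [leLHS]ger0_norm; last first.
        by apply: mulr_ge0 => //; apply: mulr_ge0; [exact: poih_ge0|exact: win_ge0].
      rewrite -mulrA ler_wpM2r//.
        by apply: mulr_ge0 => //; exact: win_ge0.
      by rewrite /poih ler_piMr ?poi_le1// invr_ge0 ltW.
  apply: (@mono_intg (fun n y => poih h (x - y) * win (2 ^+ n.+1 * h) (x - y) * `|u y|)).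
  - exact: iw.
  - by move=> n y; apply: mulr_ge0 => //; apply: mulr_ge0; [exact: poih_ge0|exact: win_ge0].
  - move=> n m y nm_; rewrite ler_wpM2r// ler_wpM2l ?poih_ge0// /win !itvE.
    have H : 2 ^+ n.+1 * h <= 2 ^+ m.+1 * h by rewrite ler_wpM2r ?(ltW h0)// ler_weXn2l// ler1n.
    case: (boolP (_ <= x - y <= _)) => // /andP[? ?].
    case: (boolP (_ <= x - y <= _)) => //; rewrite negb_and -!ltNge => /orP[]; lra.
  - move=> y; have [N NP] : exists N, `|x - y| / h <= N%:R.
      by exists (Num.truncn (`|x - y| / h)).+1; apply: ltW; rewrite truncnS_gt.
    exists N => n Nn.
    have -> : win (2 ^+ n.+1 * h) (x - y) = 1; last by rewrite mulr1.
    rewrite /win itvE -ler_norml.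
    have -> : 2 ^+ n.+1 * h / 2 = 2 ^+ n * h by rewrite exprS; field.
    rewrite -ler_pdivrMr// (le_trans NP) ?ler_nat//.
    rewrite -natrX ler_nat (leq_trans Nn)// ltnW// ltn_expl//.
  - move=> n; apply: (@le_trans _ _ (maj h u n.+1 x)); last exact: nondecreasing_cvgn_le.
    have ia j : intg (fun y => win (2 ^+ j.+1 * h) (x - y) * `|u y|) by exact: intg_win.
    pose T j y := 8 * 2^-1 ^+ j * ((2 ^+ j.+1 * h)^-1 * (win (2 ^+ j.+1 * h) (x - y) * `|u y|)).
    have iT j : intg (T j) by do 2 apply: intgZ.
    have ET j : It (T j) = 8 * 2^-1 ^+ j * avg (2 ^+ j.+1 * h) (fun y => `|u y|) x.
      by rewrite /T ItZ ?ItZ//; exact: intgZ.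
    have sumI N : intg (fun y => \sum_(j < N) T j y) /\ It (fun y => \sum_(j < N) T j y) = maj h u N x.
      elim: N => [|N [IH1 IH2]].
        have -> : (fun y => \sum_(j < 0) T j y) = (fun=> 0) by apply/funext => y; rewrite big_ord0.
        by rewrite /maj big_ord0; split; [exact: intg0|exact: It0].
      have -> : (fun y => \sum_(j < N.+1) T j y) = (fun y => \sum_(j < N) T j y + T N y).
        by apply/funext => y; rewrite big_ord_recr.
      by split; [exact: intgD|rewrite ItD// IH2 majS ET].
    rewrite -(sumI n.+1).2; apply: le_It; [exact: iw|exact: (sumI n.+1).1|move=> y].
    rewrite (@le_trans _ _ ((\sum_(j < n.+1) 8 * (2^-1) ^+ j * ((2 ^+ j.+1 * h)^-1 *
        win (2 ^+ j.+1 * h) (x - y))) * `|u y|))//.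
      by rewrite ler_wpM2r// poih_dyadic.
    rewrite mulr_suml le_eqVlt; apply/orP; left; apply/eqP; apply: eq_bigr => j _.
    by rewrite /T -[LHS]mulrA; congr (_ * _); rewrite -mulrA.
have pF x : `|pmaxh h u x| <= F x.
  rewrite ger0_norm; first exact: (intF x).2.
  by apply: It_ge0 => y; apply: mulr_ge0 => //; exact: poih_ge0.
have [Xp n1] := X_domr (borel_pmaxh h mu_) XF' pF.
by split; [move=> x; exact: (intF x).1| |exact: le_trans n1 nF].
Qed.
End Lattice.

(** * Fourier inversion *)

Section FourierInversion.
Variable R : realType.
Implicit Types (f g h F G u phi : R -> R) (a b c t x y C : R).

Lemma It_dct (f_ : nat -> R -> R) f g : (forall n, borel (f_ n)) ->
  (forall y, f_ n y @[n --> \oo] --> f y) -> intg g -> (forall n y, `|f_ n y| <= g y) ->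
  It (f_ n) @[n --> \oo] --> It f.
Proof.
move=> mf cf ig fg.
have bf : borel f.
  apply/measurable_EFinP.
  apply: (@emeasurable_fun_cvg _ _ _ setT (fun n y => (f_ n y)%:E)) => [n|y _].
    by apply/measurable_EFinP; exact: mf.
  by apply: cvg_EFin; [exact: nearW|exact: cf].
have [] := @dominated_convergence _ _ _ (@lebesgue_measure R) setT measurableT
  (fun n y => (f_ n y)%:E) (EFin \o f) (EFin \o g).
- by move=> n; apply/measurable_EFinP; exact: mf.
- by apply/measurable_EFinP; exact: bf.
- by apply: aeW => y _; apply: cvg_EFin; [exact: nearW|exact: cf].
- exact: ig.
- by apply: aeW => y n _; rewrite lee_fin.
move=> i _ H.
have inn n : intg (f_ n) by exact: (intg_le (mf n) ig).
rewrite (ItE i) in H.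
have {}H : (It (f_ n))%:E @[n --> \oo] --> (It f)%:E.
  by apply: cvg_trans H; apply: near_eq_cvg; apply: nearW => n; rewrite -(ItE (inn n)).
have := fine_cvg H; rewrite /comp /=; exact.
Qed.

Lemma cvg_invS : (n.+1%:R^-1 : R) @[n --> \oo] --> (0 : R).
Proof. exact: cvg_harmonic. Qed.

Lemma FC_dilate F b t : 0 < b -> intg F -> FC (fun x => F (b * x)) t = b^-1 * FC F (t / b).
Proof.
move=> b0 iF; have := It_dilate b0 (intg_cos (t / b) iF); rewrite /FC => <-.
by apply: eq_It => x; rewrite mulrA divfK ?gt_eqF.
Qed.
Lemma FS_dilate F b t : 0 < b -> intg F -> FS (fun x => F (b * x)) t = b^-1 * FS F (t / b).
Proof.
move=> b0 iF; have := It_dilate b0 (intg_sin (t / b) iF); rewrite /FS => <-.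
by apply: eq_It => x; rewrite mulrA divfK ?gt_eqF.
Qed.
Lemma FC_even F t : FC F (- t) = FC F t.
Proof. by apply: eq_It => x; rewrite mulNr cosN. Qed.
Lemma FS_odd F t : intg F -> FS F (- t) = - FS F t.
Proof.
move=> iF; rewrite /FS -ItN; last exact: intg_sin.
by apply: eq_It => x; rewrite mulNr sinN mulrN.
Qed.

Lemma csmth_intg a phi : csmth a phi -> intg phi.
Proof. by move=> /csmth_decay; exact: decay_intg. Qed.
Lemma csmth_FC a phi : csmth a phi -> exists C, kern C (FC phi).
Proof. by move=> /csmth_decay; exact: FC_kern. Qed.
Lemma csmth_FS a phi : csmth a phi -> exists C, kern C (FS phi).
Proof. by move=> /csmth_decay; exact: FS_kern. Qed.

Lemma It_point c : It (fun y => c * \1_`[0, 0]%classic y) = 0.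
Proof. by rewrite (ftc (der_scale c) (der_cont (@der_cst R c))) ?subrr. Qed.

Local Notation w := (fun y : R => ((y <= 0)%R)%:R : R).

(** The Fejer weight [h1] lives on the negative half-line, so the summation below sees only one half
    of the even function [FC phi]. *)
Lemma It_half a phi : csmth a phi -> intg (fun y => w y * FC phi y) /\
  It (fun y => w y * FC phi y) = It (FC phi) / 2.
Proof.
move=> cp; have [C kC] := csmth_FC cp; have ik := kern_intg kC.
have bw : borel w.
  have -> : w = \1_`]-oo, (0 : R)]%classic.
    by apply/funext => y; rewrite indicE mem_setE in_itv.
  by apply: borel_indic; exact: measurable_itv.
have iw : intg (fun y => w y * FC phi y).
  apply: (intg_le _ (intg_abs ik)) => [|y]; first by apply: borelM => //; case: kC.
  by rewrite normrM normr_nat ler_piMl// lern1 leq_b1.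
split=> //; have iw' := intg_opp iw.
have i0 : intg (fun y => FC phi 0 * \1_`[0, 0]%classic y).
  exact: (intg_itv_cont 0 0 (der_cont (@der_cst R (FC phi 0)))).
(* The point 0 belongs to both half-lines; the last term, of integral 0, removes the double
   count. *)
have -> : It (FC phi) = It (fun y => (w y * FC phi y + w (- y) * FC phi (- y)) - FC phi 0 * \1_`[0, 0]%classic y).
  apply: eq_It => y; rewrite FC_even itvE oppr_le0.
  case: (ltgtP y 0) => [y0|y0|->] /=; rewrite ?mulr0 ?subr0 ?mul0r ?mul1r ?addr0 ?add0r//.
  by rewrite mulr1 addrK.
rewrite ItB//; last exact: intgD.
by rewrite It_point subr0 ItD// (It_opp iw); field.
Qed.

(* Fejer summation: [FC h1 = nr] with [It nr = c0]. *)
Lemma It_FC a phi : csmth a phi -> It (FC phi) = 2 * c0 R * phi 0.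
Proof.
move=> cp; have [C kC] := csmth_FC cp; have ik := kern_intg kC.
have [iw Iw] := It_half cp; have ip := csmth_intg cp.
have [B B0 BP] := bnd_ge0 (csmth_bnd cp).
have pc : continuous phi by apply: smooth_cont; case: cp.
have ih := intg_h1 R.
have [ih1 _ _] := ih.
pose N n : R := n.+1%:R; have N0 n : 0 < N n by rewrite ltr0n.
have cN y : (N n)^-1 * y @[n --> \oo] --> (0 : R).
  by rewrite -[X in _ --> X](mul0r y); apply: cvgMl; exact: cvg_invS.
(* Exchange of integrals in the double integral of h1 (y / N) phi (x) cos (x y) with N = n + 1,
   followed by a dilation by N on the side of [nr]. *)
have E n : It (fun y => h1 ((N n)^-1 * y) * FC phi y) = It (fun x => phi ((N n)^-1 * x) * nr x).
  have Nn := N0 n; have Ni : 0 < (N n)^-1 by rewrite invr_gt0.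
  have ihn : intg (fun y => h1 ((N n)^-1 * y)) := intg_dilate Ni ih1.
  have := @It_trig_fubini R phi (fun y => h1 ((N n)^-1 * y)) cos 0 ip ihn (@continuous_cos R) _.
  have cb y : `|cos y| <= 1 by rewrite ler_norml cos_geN1 cos_le1.
  move=> /(_ cb) H.
  transitivity (It (fun s => h1 ((N n)^-1 * s) * It (fun x => phi x * cos ((0 - s) * x)))).
    by apply: eq_It => y; congr (_ * _); apply: eq_It => x; rewrite sub0r mulNr cosN.
  rewrite H.
  have inr : intg (fun x => phi ((N n)^-1 * x) * nr x).
    apply: (@intg_le _ _ (fun x => B * nr x)).
    - apply: borelM; last exact: (decay_borel (decay_nr R)).
      by apply: borel_cont => x; apply: continuous_comp; [exact: mulrl_continuous|exact: pc].
    - by apply: intgZ; exact: (decay_intg (decay_nr R)).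
    - by move=> x; rewrite normrM (ger0_norm (nr_ge0 x)) ler_wpM2r ?nr_ge0.
  have := It_dilate Nn inr => D.
  have -> : It (fun x => phi ((N n)^-1 * x) * nr x) = N n * It (fun x => phi ((N n)^-1 * (N n * x)) * nr (N n * x)).
    by rewrite D; move: (It _) => I; rewrite mulrA mulfV ?mul1r ?gt_eqF.
  rewrite -ItZ; last by have := intg_dilate Nn inr.
  apply: eq_It => x.
  have -> : (N n)^-1 * (N n * x) = x by rewrite mulrA mulVf ?mul1r ?gt_eqF.
  rewrite [RHS]mulrCA; congr (_ * _).
  have := FC_dilate (- x) Ni ih1; rewrite invrK => F1.
  have -> : nr (N n * x) = FC (@h1 R) (- x * N n) by rewrite mulNr FC_even mulrC.
  rewrite -F1; apply: eq_It => y; rewrite sub0r.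
  by rewrite mulNr mulNr [y * x]mulrC.
(* The weight h1 (y / N) tends to 1 for y <= 0 and is 0 for y > 0, which leaves the half of
   [It_half]. On the other side phi (x / N) tends to [phi 0]. *)
have L1 : It (fun y => h1 ((N n)^-1 * y) * FC phi y) @[n --> \oo] --> It (FC phi) / 2.
  rewrite -Iw.
  apply: (@It_dct (fun n y => h1 ((N n)^-1 * y) * FC phi y) _ (fun y => `|FC phi y|)).
  - move=> n; apply: borelM; last by case: kC.
    apply: (@borel_comp _ (@h1 R)); first exact: intg_borel ih1.
    by apply: borelM; [exact: borel_cst|exact: borel_id].
  - move=> y; apply: cvgMl.
    have [y0|y0] := leP y 0; last first.
      apply: cvg_near_cst; apply: nearW => n; rewrite /h1 /w1 itvE.
      have yn : 0 < (N n)^-1 * y by rewrite mulr_gt0 ?invr_gt0.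
      by rewrite (lt_geF yn) andbF mulr0.
    have c1 : 1 + (N n)^-1 * y @[n --> \oo] --> (1 : R).
      by rewrite -[X in _ --> X]addr0; apply: cvgD; [exact: cvg_cst|exact: cN].
    apply: cvg_trans c1; apply: near_eq_cvg.
    have [M ME] : exists M, - y <= M%:R.
      by exists (Num.truncn (- y)).+1; apply: ltW; rewrite truncnS_gt.
    exists M => // n /= Mn; rewrite /h1 /w1 itvE.
    have -> : (N n)^-1 * y <= 0 by rewrite pmulr_rle0 ?invr_gt0.
    have -> : -1 <= (N n)^-1 * y.
      rewrite mulrC ler_pdivlMr ?N0// mulN1r lerNl (le_trans ME)// ler_nat.
      exact: leqW.
    by rewrite mulr1.
  - exact: intg_abs.
  - move=> n y; rewrite normrM ler_piMl// /h1 /w1 itvE; move: (_ * y) => z.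
    case: (boolP (_ <= _ <= _)) => [/andP[? ?]|_]; last by rewrite mulr0 normr0.
    by rewrite mulr1 ler_norml; apply/andP; split; lra.
have L2 : It (fun y => h1 ((N n)^-1 * y) * FC phi y) @[n --> \oo] --> phi 0 * c0 R.
  have -> : phi 0 * c0 R = It (fun x => phi 0 * nr x).
    by rewrite ItZ//; exact: (decay_intg (decay_nr R)).
  rewrite (_ : (fun n => It _) = (fun n => It (fun x => phi ((N n)^-1 * x) * nr x))); last by apply/funext.
  apply: (@It_dct (fun n x => phi ((N n)^-1 * x) * nr x) _ (fun x => B * nr x)).
  - move=> n; apply: borelM; last exact: (decay_borel (decay_nr R)).
    by apply: borel_cont => x; apply: continuous_comp; [exact: mulrl_continuous|exact: pc].
  - move=> x; apply: cvgMl; have := pc 0; apply: cvg_comp; exact: cN.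
  - by apply: intgZ; exact: (decay_intg (decay_nr R)).
  - by move=> n x; rewrite normrM (ger0_norm (nr_ge0 x)) ler_wpM2r ?nr_ge0.
have := cvg_unique _ L1 L2 => H.
have {}H : It (FC phi) / 2 = phi 0 * c0 R by apply: H.
by rewrite -[LHS](divfK (_ : (2 : R) != 0))// H; ring.
Qed.

Lemma csmth_shift a phi t : csmth a phi -> csmth (a + `|t|) (fun x => phi (1 * x + t)).
Proof.
move=> [sp p0]; split; first exact: smooth_comp_aff.
move=> x ax; apply: p0; rewrite mul1r.
have := ler_normD (x + t) (- t); rewrite addrK normrN; lra.
Qed.

(** [It_FC] for the translate of [phi] by t, whose cosine transform expands by the addition
    formula. *)
Lemma inversion a phi t : csmth a phi ->
  FC (FC phi) t + FS (FS phi) t = 2 * c0 R * phi t.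
Proof.
move=> cp; have := It_FC (csmth_shift t cp); rewrite mulr0 add0r => <-.
have ip := csmth_intg cp.
have [C1 k1] := csmth_FC cp; have [C2 k2] := csmth_FS cp.
rewrite -ItD; last 2 first.
- by apply: intg_cos; exact: kern_intg k1.
- by apply: intg_sin; exact: kern_intg k2.
apply: eq_It => y.
have i1 := intgZ (cos (t * y)) (intg_cos y ip).
have i2 := intgZ (sin (t * y)) (intg_sin y ip).
transitivity (It (fun x => cos (t * y) * (phi x * cos (y * x)) + sin (t * y) * (phi x * sin (y * x)))).
  rewrite ItD// !ItZ//; [|exact: intg_sin|exact: intg_cos].
  by rewrite mulrC [_ * sin _]mulrC.
have iX : intg (fun x => cos (t * y) * (phi x * cos (y * x)) + sin (t * y) * (phi x * sin (y * x))) by exact: intgD.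
rewrite -(It_shift t iX); apply: eq_It => x; rewrite mul1r.
have -> : y * x = y * (x + t) - t * y by ring.
by rewrite cosB; ring.
Qed.

(** Adding and subtracting the inversion formulas at t and - t separates the even part from the odd
    part. *)
Lemma transforms_eq0 a phi t : csmth a phi -> phi t = 0 -> phi (- t) = 0 ->
  FC (FC phi) t = 0 /\ FS (FS phi) t = 0.
Proof.
move=> cp p1 p2; have [C2 k2] := csmth_FS cp.
have := inversion t cp; have := inversion (- t) cp.
by rewrite p1 p2 FC_even (FS_odd _ (kern_intg k2)) mulr0; split; lra.
Qed.

Lemma FS_even F t : intg F -> (forall x, F (- x) = F x) -> FS F t = 0.
Proof.
move=> iF eF; have := It_opp (intg_sin t iF); rewrite -/(FS F t) => H.
have : FS F t = - FS F t.
  rewrite -{1}H -FS_odd//; apply: eq_It => x.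
  by rewrite eF mulrN mulNr.
by lra.
Qed.
Lemma FC_odd F t : intg F -> (forall x, F (- x) = - F x) -> FC F t = 0.
Proof.
move=> iF oF; have := It_opp (intg_cos t iF); rewrite -/(FC F t) => H.
have : FC F t = - FC F t.
  rewrite -{1}H /FC -ItN; last exact: intg_cos.
  by apply: eq_It => x; rewrite oF mulrN cosN mulNr.
by lra.
Qed.
End FourierInversion.

(** * Transforms of test functions *)

Section TransformsOfTestFunctions.
Variable R : realType.
Implicit Types (f g h F G e phi : R -> R) (a b c t x y C : R) (m n : nat).

Lemma csmth_le a b phi : a <= b -> csmth a phi -> csmth b phi.
Proof. by move=> ab [sp p0]; split=> // x bx; apply: p0; exact: le_trans bx. Qed.

Lemma It_der_csmth a f f' : csmth a f -> der f f' -> It f' = 0.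
Proof.
move=> cf ff; have a1 : a <= `|a| + 1 by rewrite (le_trans (ler_norm a))// lerDl.
have cf1 := csmth_le a1 cf; have cf' := csmth_der cf1 ff.
set b := `|a| + 1 in cf1 cf' a1; have b0 : 0 < b by rewrite ltr_wpDl.
have bb : - b <= b by rewrite (le_trans _ (ltW b0))// oppr_le0 ltW.
transitivity (It (fun x => f' x * \1_`[-b, b]%classic x)).
  apply: eq_It => x; rewrite itvE -ler_norml.
  by have [|xb] := leP `|x| b; rewrite ?mulr1// cf'.2 ?mul0r// ltW.
rewrite (ftc ff _ bb); last by apply: smooth_cont; case: cf'.
by rewrite !cf1.2 ?subrr// ?normrN ger0_norm// ltW.
Qed.

Lemma FC_by_parts a phi phi' t : csmth a phi -> der phi phi' -> t * FC phi t = - FS phi' t.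
Proof.
move=> cp dp; have cp' := csmth_der cp dp.
have cS : csmth a (fun x => phi x * sin (t * x)) by apply: csmth_M => //; exact: smooth_sin.
have d := derM dp (der_sinZ t).
have i1 := intg_sin t (csmth_intg cp'); have i2 := intgZ t (intg_cos t (csmth_intg cp)).
have := It_der_csmth cS d.
rewrite (_ : It _ = It (fun x => phi' x * sin (t * x) + t * (phi x * cos (t * x)))); last first.
  by apply: eq_It => x; rewrite [phi x * (t * _)]mulrCA.
by rewrite ItD// ItZ ?intg_cos ?(csmth_intg cp)// -/(FC phi t) -/(FS phi' t); lra.
Qed.

Lemma FS_by_parts a phi phi' t : csmth a phi -> der phi phi' -> t * FS phi t = FC phi' t.
Proof.
move=> cp dp; have cp' := csmth_der cp dp.
have cS : csmth a (fun x => phi x * cos (t * x)) by apply: csmth_M => //; exact: smooth_cos.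
have d := derM dp (der_cosZ t).
have i1 := intg_cos t (csmth_intg cp'); have i2 := intgZ t (intg_sin t (csmth_intg cp)).
have := It_der_csmth cS d.
rewrite (_ : It _ = It (fun x => phi' x * cos (t * x) - t * (phi x * sin (t * x)))); last first.
  by apply: eq_It => x; rewrite mulrN [phi x * (t * _)]mulrCA.
by rewrite ItB// ItZ ?intg_sin ?(csmth_intg cp)// -/(FS phi t) -/(FC phi' t); lra.
Qed.

(** Real transforms of test functions. Differentiation and multiplication by t preserve the class,
    so the rapid decay of all derivatives follows from mere boundedness. *)
Definition transform F := exists a phi psi,
  [/\ csmth a phi, csmth a psi & F =1 (fun t => FC phi t + FS psi t)].

Lemma csmth_mulX a phi : csmth a phi -> csmth a (fun x => x * phi x).
Proof.
move=> cp; have := csmth_M cp (@smooth_id R); case=> s z; split.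
  by move=> n; move: (s n); congr smN; apply/funext => x; rewrite mulrC.
by move=> x /z; rewrite mulrC.
Qed.

Lemma csmthN a phi : csmth a phi -> csmth a (fun x => - phi x).
Proof. by case=> s z; split; [exact: smoothN|move=> x /z ->; rewrite oppr0]. Qed.

Lemma csmth0 a : csmth a (fun=> 0).
Proof. by split=> //; exact: smooth_cst. Qed.

Lemma transform_der F : transform F -> exists2 F', der F F' & transform F'.
Proof.
move=> [a [phi [psi [c1 c2 E]]]].
have d1 := der_FC (csmth_intg c1) (csmth_intg (csmth_mulX c1)).
have d2 := der_FS (csmth_intg c2) (csmth_intg (csmth_mulX c2)).
exists (fun t => - FS (fun x => x * phi x) t + FC (fun x => x * psi x) t).
  exact: (der_ext (fun t => esym (E t)) (fun=> erefl) (derD d1 d2)).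
exists a, (fun x => x * psi x), (fun x => - (x * phi x)); split.
- exact: csmth_mulX.
- by apply: csmthN; exact: csmth_mulX.
move=> t; rewrite addrC; congr (_ + _).
rewrite /FS -ItN; first by apply: eq_It => x; rewrite mulNr.
by apply: intg_sin; exact: (csmth_intg (csmth_mulX c1)).
Qed.

Lemma transform_mulX F : transform F -> transform (fun t => t * F t).
Proof.
move=> [a [phi [psi [c1 c2 E]]]].
have [p1 d1 _] := smooth_exder c1.1; have [p2 d2 _] := smooth_exder c2.1.
have c1' := csmth_der c1 d1; have c2' := csmth_der c2 d2.
exists a, p2, (fun x => - p1 x); split; [exact: c2'|exact: csmthN|move=> t].
rewrite E mulrDr (FC_by_parts _ c1 d1) (FS_by_parts _ c2 d2) addrC; congr (_ + _).
rewrite /FS -ItN; first by apply: eq_It => x; rewrite mulNr.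
by apply: intg_sin; exact: (csmth_intg c1').
Qed.

Lemma transform_bnd F : transform F -> bnd F.
Proof.
move=> [a [phi [psi [c1 c2 E]]]].
apply: (bnd_ext (fun t => esym (E t))); apply: bndD.
  exact: bnd_FC (csmth_intg c1).
exact: bnd_FS (csmth_intg c2).
Qed.

Lemma transform_rapid m F : transform F -> exists2 C, 0 <= C & forall t, `|t| ^+ m * `|F t| <= C.
Proof.
elim: m F => [|m IH] F tF.
  by have [C C0 CP] := bnd_ge0 (transform_bnd tF); exists C => // t; rewrite expr0 mul1r.
have [C C0 CP] := IH _ (transform_mulX tF); exists C => // t.
by rewrite exprSr -mulrA -normrM.
Qed.

Lemma transform_smooth F : transform F -> smooth F.
Proof.
move=> tF n; elim: n F tF => [//|n IH] F tF.
by have [F' d tF'] := transform_der tF; exists F' => //; exact: IH.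
Qed.

Lemma transform_kern F : transform F -> exists C, kern C F.
Proof.
move=> [a [phi [psi [c1 c2 E]]]].
have [C1 k1] := csmth_FC c1; have [C2 k2] := csmth_FS c2.
exists (C1 + C2); have := kernD k1 k2; congr kern; apply/funext => t; by rewrite E.
Qed.

Lemma nder_derive1n n f g : nder n f g -> derive1n n f = g.
Proof.
elim: n f => [f <-//|n IH f [f' d dn]].
by rewrite derive1Sn (der_derive1 d); exact: IH.
Qed.

Lemma nder_D n f1 f2 g1 g2 : nder n f1 g1 -> nder n f2 g2 ->
  nder n (fun x => f1 x + f2 x) (fun x => g1 x + g2 x).
Proof.
elim: n f1 f2 => [f1 f2 <- <-//|n IH f1 f2 [f1' d1 n1] [f2' d2 n2]].
by exists (fun x => f1' x + f2' x); [exact: derD|exact: IH].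
Qed.

Lemma nder_Z n c f g : nder n f g -> nder n (fun x => c * f x) (fun x => c * g x).
Proof.
elim: n f => [f <-//|n IH f [f' d dn]].
by exists (fun x => c * f' x); [exact: derZ|exact: IH].
Qed.

Lemma nder_smooth n f : smooth f -> nder n f (derive1n n f).
Proof.
elim: n f => [//|n IH f sf]; have [f' d sf'] := smooth_exder sf.
by exists f' => //; rewrite derive1Sn (der_derive1 d); exact: IH.
Qed.

(* Factors [e] such that [e (./L)] tends to 0 with all its derivatives. *)
Definition cutoff e := (exists c a phi, csmth a phi /\ e =1 (fun y => c + phi y)) /\
  forall y, `|y| < 1 -> e y = 0.

Lemma cutoff_der e : cutoff e -> exists2 e', der e e' & cutoff e'.
Proof.
move=> [[c [a [phi [cp E]]]] e0]; have [p' d sp'] := smooth_exder cp.1.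
have de : der e p'.
  by apply: (der_ext (fun y => esym (E y)) _ (derD (der_cst c) d)) => y; rewrite add0r.
exists p' => //; split.
  by exists 0, a, p'; split; [exact: csmth_der d|move=> y; rewrite add0r].
move=> y y1; have d0 : 0 < 1 - `|y| by rewrite subr_gt0.
have H : is_derive y (1 : R) e 0.
  apply: (@near_eq_is_derive R R R (fun=> 0) e y 1 0).
  apply: (near_dist d0) => s st; rewrite e0//.
  by have := ler_normD (s - y) y; rewrite subrK; lra.
by have [_ <-] := de y; have [_ ->] := H.
Qed.

Lemma cutoff_bnd e : cutoff e -> bnd e.
Proof.
move=> [[c [a [phi [cp E]]]] _]; apply: (bnd_ext (fun y => esym (E y))).
by apply: bndD; [exact: bnd_cst|exact: csmth_bnd cp].
Qed.

(** The function e (y / L) vanishes for |y| < L, and elsewhere one extra power of |y| is worth a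
    factor L. A derivative that falls on the cutoff only gains a further L^-1. *)
Lemma cutoff_tail n m e F : cutoff e -> transform F -> exists2 C, 0 <= C &
  forall L, 1 <= L -> exists2 g, nder n (fun y => e (L^-1 * y) * F y) g &
    forall y, `|y| ^+ m * `|g y| <= C / L.
Proof.
elim: n e F => [|n IH] e F ce tF.
  have [B B0 BP] := bnd_ge0 (cutoff_bnd ce); have [C C0 CP] := transform_rapid m.+1 tF.
  exists (B * C) => [|L L1]; first exact: mulr_ge0.
  have L0 : 0 < L by lra.
  exists (fun y => e (L^-1 * y) * F y) => // y.
  have [yL|yL] := ltP `|L^-1 * y| 1.
    by rewrite ce.2// mul0r normr0 mulr0 divr_ge0 ?mulr_ge0// ltW.
  have {}yL : L <= `|y|.
    by move: yL; rewrite normrM normfV (gtr0_norm L0) mulrC ler_pdivlMr ?mul1r.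
  have y0 : 0 < `|y| by lra.
  have key : `|y| ^+ m * `|F y| <= C / L.
    rewrite ler_pdivlMr// (le_trans _ (CP y))// mulrC exprS -mulrA.
    by apply: ler_wpM2r => //; apply: mulr_ge0 => //; exact: exprn_ge0.
  rewrite normrM mulrCA -mulrA.
  by apply: ler_pM; [exact: normr_ge0|apply: mulr_ge0; [exact: exprn_ge0|exact: normr_ge0]|exact: BP|exact: key].
have [e' de ce'] := cutoff_der ce; have [F' dF tF'] := transform_der tF.
have [C1 C10 H1] := IH _ _ ce' tF; have [C2 C20 H2] := IH _ _ ce tF'.
exists (C1 + C2) => [|L L1]; first exact: addr_ge0.
have L0 : 0 < L by lra.
have [g1 n1 b1] := H1 L L1; have [g2 n2 b2] := H2 L L1.
exists (fun y => L^-1 * g1 y + g2 y).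
  have n1' := nder_Z L^-1 n1; have n12 := nder_D n1' n2.
  exists (fun y => L^-1 * (e' (L^-1 * y) * F y) + e (L^-1 * y) * F' y) => //.
  have := derM (der_comp de (der_scale L^-1)) dF.
  move=> H; apply: (der_ext _ _ H) => y; first by [].
  by rewrite -[L^-1 * e' _ * _]mulrA.
move=> y; rewrite mulrDl.
apply: (@le_trans _ _ (`|y| ^+ m * `|g1 y| + `|y| ^+ m * `|g2 y|)); last exact: lerD.
rewrite -mulrDr ler_wpM2l ?exprn_ge0// (le_trans (ler_normD _ _))// lerD2r.
by rewrite normrM normfV (gtr0_norm L0) ler_piMl// invf_le1.
Qed.

End TransformsOfTestFunctions.

(** * Tempered distributions *)

Section ReproducingFormula.
Variable R : realType.
Implicit Types (f g h F G e phi u v p : R -> R) (a b c t x y C : R) (m n : nat).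

Definition cx u v : R -> R[i] := fun x => u x +i* v x.

Lemma derive1n_cst n c x : derive1n n.+1 (fun=> c : R) x = 0.
Proof.
elim: n c => [|n IH] c; first by rewrite derive1n1 (der_derive1 (der_cst c)).
by rewrite derive1Sn (der_derive1 (der_cst c)) IH.
Qed.

Lemma csmooth_cx u v : smooth u -> smooth v -> csmooth (cx u v).
Proof.
move=> su sv n; split.
  move=> k x _; have [d1 _] := smooth_derive1n k su; have [d2 _] := smooth_derive1n k sv.
  by split; [have [] := d1 x|have [] := d2 x].
by split; apply: smooth_cont; [exact: (smooth_derive1n n su).2|exact: (smooth_derive1n n sv).2].
Qed.

Lemma csupport_sub a u v : csmth a u -> csmth a v -> csupport (cx u v) `<=` `[-a, a].
Proof.
move=> [_ u0] [_ v0]; have cl : closed `[-a, a]%classic by exact: itv_closed.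
rewrite (closure_id `[-a, a]%classic).1//; apply: closure_subset => x /= xn.
rewrite in_itv/= -ler_norml leNgt; apply/negP => ax; move: xn.
by rewrite /cx u0 ?v0 ?eqxx// ltW.
Qed.

Lemma test_cx a u v : csmth a u -> csmth a v -> test_function (cx u v).
Proof.
move=> cu cv; split; first by apply: csmooth_cx; [case: cu|case: cv].
apply: (@subclosed_compact _ _ `[-a, a]%classic); first exact: closed_closure.
  exact: segment_compact.
exact: csupport_sub.
Qed.

Lemma csupport_disjoint s u v : 0 < s -> (forall x, `|x| <= 2 * s -> u x = 0 /\ v x = 0) ->
  csupport (cx u v) `&` `[- s, s] = set0.
Proof.
move=> s0 H; rewrite -subset0 => x [/= cl]; rewrite in_itv/= -ler_norml => xs.
have [y [/= yn]] : [set y | cx u v y != 0] `&` ball x s !=set0 by apply: cl; exact: nbhsx_ballx.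
rewrite /ball /= => xy.
have ys : `|y| <= 2 * s by have := ler_normD (y - x) x; rewrite subrK distrC; lra.
by have [u0 v0] := H y ys; move: yn; rewrite /cx u0 v0 eqxx.
Qed.

Lemma cderiv_ofreal n u : cderiv n (ofreal u) = ofreal (derive1n n u).
Proof.
apply/funext => x; rewrite /cderiv /ofreal; congr (_ +i* _).
by case: n => [|n]; [rewrite derive1n0|exact: derive1n_cst].
Qed.

Lemma schwartz_ofreal u : smooth u ->
  (forall m n, exists C, forall t, `|t| ^+ m * `|derive1n n u t| <= C) -> schwartz (ofreal u).
Proof.
move=> su H; split; first by apply: csmooth_cx => //; exact: smooth_cst.
move=> m n; have [C CP] := H m n; exists C => _ [t _ <-]; cbv beta.
by rewrite cderiv_ofreal absc_ofreal.
Qed.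

Lemma seminorm_le m n u C : (forall t, `|t| ^+ m * `|derive1n n u t| <= C) ->
  schwartz_seminorm m n (ofreal u) <= C.
Proof.
move=> H; apply: ge_sup; first by exists (`|0 : R| ^+ m * absc (cderiv n (ofreal u) 0)), 0.
by move=> _ [t _ <-]; cbv beta; rewrite cderiv_ofreal absc_ofreal.
Qed.

Lemma csmth_derive1n a u n : csmth a u -> csmth a (derive1n n u).
Proof.
move=> cu; elim: n => [//|n IH]; have [d _] := smooth_derive1n n cu.1.
exact: csmth_der IH d.
Qed.

Lemma schwartz_csmth a u : csmth a u -> schwartz (ofreal u).
Proof.
move=> cu; apply: schwartz_ofreal; first by case: cu.
move=> m n; have [C CP] := csmth_bnd (csmth_M (csmth_derive1n n cu) (@smooth_exp R m)).
by exists C => t; have := CP t; rewrite normrM normrX mulrC.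
Qed.

Lemma tail_sum (s : nat -> R -> R) N :
  (forall m, exists2 C, 0 <= C & forall L, 1 <= L -> s m L <= C / L) ->
  exists2 C, 0 <= C & forall L, 1 <= L -> \sum_(m < N) s m L <= C / L.
Proof.
move=> H; elim: N => [|N [C C0 CP]].
  by exists 0 => // L L1; rewrite big_ord0 mul0r.
have [D D0 DP] := H N; exists (C + D); first exact: addr_ge0.
by move=> L L1; rewrite big_ord_recr /= mulrDl lerD// ?CP ?DP.
Qed.

Definition outer y : R := 1 - bumpR y.
Lemma cutoff_outer : cutoff outer.
Proof.
split; last by move=> y y1; rewrite /outer bump1 ?subrr// ltW.
exists 1, 2, (fun y => - bumpR y); split => //.
by apply: csmthN; split; [exact: smooth_bump|exact: bump0].
Qed.

Lemma csmth_bump_scale b : 0 < b -> csmth (2 / b) (fun y => bumpR (b * y)).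
Proof.
move=> b0; split.
  have := smooth_comp_aff b 0 (@smooth_bump R).
  by move=> s n; move: (s n); congr smN; apply/funext => y; rewrite addr0.
move=> y yb; apply: bump0; rewrite normrM (gtr0_norm b0) mulrC.
by rewrite -ler_pdivrMr.
Qed.

Lemma eq_limit (a l K : R) (z : nat -> R) : z n @[n --> \oo] --> l ->
  (forall n, `|a - z n| <= K / n.+1%:R) -> a = l.
Proof.
move=> zl H.
have K0 : K / n.+1%:R @[n --> \oo] --> (0 : R).
  by rewrite -[X in _ --> X](mulr0 K); apply: cvgMr; exact: cvg_invS.
have za : a - z n @[n --> \oo] --> (0 : R).
  apply/norm_cvg0P; apply: (squeeze_cvgr _ (cvg_cst 0) K0).
  by apply: nearW => n; rewrite normr_ge0 H.
have : a - z n @[n --> \oo] --> a - l by apply: cvgB => //; exact: cvg_cst.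
move=> /(cvg_unique _ za) E; apply/eqP; rewrite -subr_eq0; apply/eqP.
by rewrite E.
Qed.

Section Distribution.
Variables (T : (R -> R[i]) -> R[i]) (p1 p2 : R -> R).
Hypothesis T_tempered : tempered_distribution T.
Hypothesis T_repr : represents T (cx p1 p2).
Hypothesis (p1_tame : tame p1) (p2_tame : tame p2).

Lemma T_csmth a u : csmth a u ->
  T (ofreal u) = It (fun y => p1 y * u y) +i* It (fun y => p2 y * u y).
Proof.
move=> cu; rewrite T_repr; last exact: (test_cx cu (csmth0 a)).
by congr (_ +i* _); apply: eq_It => y; rewrite /refun /imfun /cx /= !(mulr0, subr0, add0r).
Qed.

Lemma It_cutoff_cvg p F : tame p -> transform F ->
  It (fun y => p y * (bumpR (n.+1%:R^-1 * y) * F y)) @[n --> \oo] --> It (fun y => p y * F y).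
Proof.
move=> tp tF; have [C kC] := transform_kern tF.
have ip : intg (fun y => F y * p y) by exact: (tame_mul kC.1 kC.2 tp).
have cb : csmth 2 (@bumpR R) by split; [exact: smooth_bump|exact: bump0].
have [B B0 BP] := bnd_ge0 (csmth_bnd cb).
apply: (@It_dct _ (fun n y => p y * (bumpR (n.+1%:R^-1 * y) * F y)) _ (fun y => B * `|F y * p y|)).
- move=> n; apply: borelM; first by case: tp.
  apply: borelM; last by case: kC.
  apply: borel_comp; first by apply: borel_cont; apply: smooth_cont; exact: smooth_bump.
  by apply: borelM; [exact: borel_cst|exact: borel_id].
- move=> y; apply: cvg_near_cst.
  have [M ME] : exists M, `|y| <= M%:R.
    by exists (Num.truncn `|y|).+1; apply: ltW; rewrite truncnS_gt.
  exists M => // n /= Mn.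
  have n0 : 0 < (n.+1%:R : R) by rewrite ltr0n.
  rewrite bump1 ?mul1r// normrM normfV (gtr0_norm n0) mulrC ler_pdivrMr// mul1r.
  by rewrite (le_trans ME)// ler_nat leqW.
- by apply: intgZ; exact: intg_abs.
- move=> n y; rewrite mulrCA [p y * F y]mulrC normrM ler_wpM2r//; exact: BP.
Qed.

(** [represents] speaks of test functions only. The transform is cut off at scale n + 1, and
    temperedness makes T of the remainder O(1 / (n + 1)) through [cutoff_tail]. *)
Lemma T_transform F : transform F ->
  T (ofreal F) = It (fun y => p1 y * F y) +i* It (fun y => p2 y * F y).
Proof.
move=> tF; have [lin [C0 [N bd]]] := T_tempered.
pose L n : R := n.+1%:R; have L1 n : 1 <= L n by rewrite ler1n.
have L0 n : 0 < (L n)^-1 by rewrite invr_gt0 ltr0n.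
pose tl (l : R) y := outer (l^-1 * y) * F y.
have sm m n : exists2 C, 0 <= C & forall l, 1 <= l -> schwartz_seminorm m n (ofreal (tl l)) <= C / l.
  have [C C00 CP] := cutoff_tail n m cutoff_outer tF; exists C => // l l1.
  have [g dg bg] := CP l l1; apply: seminorm_le => t.
  by rewrite (nder_derive1n dg).
have [K K0 KP] : exists2 C, 0 <= C & forall l, 1 <= l ->
    \sum_(m < N) \sum_(n < N) schwartz_seminorm m n (ofreal (tl l)) <= C / l.
  apply: (@tail_sum (fun m l => \sum_(n < N) schwartz_seminorm m n (ofreal (tl l)))) => m.
  exact: (@tail_sum (fun n l => schwartz_seminorm m n (ofreal (tl l)))).
have cbF n : csmth (2 / (L n)^-1) (fun y => bumpR ((L n)^-1 * y) * F y).
  by apply: csmth_M; [exact: csmth_bump_scale|exact: transform_smooth].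
have stl n : schwartz (ofreal (tl (L n))).
  apply: schwartz_ofreal => [|m k].
    apply: smoothM; last exact: transform_smooth.
    by apply: smoothB; [exact: smooth_cst|exact: (csmth_bump_scale (L0 n)).1].
  have [C _ CP] := cutoff_tail k m cutoff_outer tF; have [g dg bg] := CP _ (L1 n).
  by exists (C / L n) => t; rewrite (nder_derive1n dg).
have E n : T (ofreal F) = T (ofreal (fun y => bumpR ((L n)^-1 * y) * F y)) + T (ofreal (tl (L n))).
  rewrite -[T (ofreal (fun y => bumpR _ * _))]mul1r -lin//; last exact: (schwartz_csmth (cbF n)).
  congr T; apply/funext => y; rewrite mul1r /ofreal -rmorphD /tl /outer; congr (_%:C).
  by rewrite mulrBl mul1r addrC subrK.
have bT n : absc (T (ofreal (tl (L n)))) <= `|C0| * K / L n.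
  apply: (le_trans (bd _ (stl n))); have H := KP _ (L1 n).
  apply: (@le_trans _ _ (`|C0| * \sum_(m < N) \sum_(k < N) schwartz_seminorm m k (ofreal (tl (L n))))).
    rewrite ler_wpM2r ?ler_norm//; apply: sumr_ge0 => m _; apply: sumr_ge0 => k _.
    apply: (@le_trans _ _ (`|0 : R| ^+ m * absc (cderiv k (ofreal (tl (L n))) 0))).
      by apply: mulr_ge0; [exact: exprn_ge0|exact: absc_ge0].
    by apply: ub_le_sup; [exact: (stl n).2|exists 0].
  by rewrite -mulrA ler_wpM2l.
apply/eqP; rewrite eq_complex; apply/andP; split; apply/eqP => /=.
  apply: (@eq_limit _ _ (`|C0| * K) _ (It_cutoff_cvg p1_tame tF)) => n.
  rewrite (E n) (T_csmth (cbF n)) raddfD /= addrAC subrr add0r.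
  exact: le_trans (absc_Re _) (bT n).
apply: (@eq_limit _ _ (`|C0| * K) _ (It_cutoff_cvg p2_tame tF)) => n.
rewrite (E n) (T_csmth (cbF n)) raddfD /= addrAC subrr add0r.
exact: le_trans (absc_Im _) (bT n).
Qed.

End Distribution.
End ReproducingFormula.

(** * The reproducing kernel of band-limited functions *)

Section Reproducing.
Variable R : realType.
Implicit Types (f g h F G e phi psi u v p k : R -> R) (a b c d s t x y z C : R) (m n : nat).

Lemma dilated_poi N d t : 0 < N -> 0 < d -> d <= `|t| ->
  N * poi (N * t) <= N^-1 * ((1 + d ^+ 2) / d ^+ 2 * poi t).
Proof.
move=> N0 d0 dt.
have t0 : 0 < t ^+ 2 by rewrite -real_normK ?num_real// exprn_gt0// (lt_le_trans d0).
have dt2 : d ^+ 2 <= t ^+ 2.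
  by rewrite -[leRHS]real_normK ?num_real// ler_sqr ?nnegrE// ltW.
have d2 : 0 < d ^+ 2 by rewrite exprn_gt0.
apply: (@le_trans _ _ (N^-1 * (t ^+ 2)^-1)).
  have -> : N^-1 * (t ^+ 2)^-1 = N * ((N * t) ^+ 2)^-1.
    have Nn : N != 0 by rewrite gt_eqF.
    have tn : t != 0 by rewrite -normr_gt0 (lt_le_trans d0).
    by field; rewrite Nn tn.
  apply: ler_wpM2l; first exact: ltW.
  rewrite /poi lef_pV2 ?posrE ?oneD_gt0 ?lerDr//.
  by rewrite exprMn mulr_gt0// exprn_gt0.
apply: ler_wpM2l; first by rewrite invr_ge0 ltW.
rewrite /poi ler_pdivlMr ?oneD_gt0// mulrDr mulr1 mulVf ?gt_eqF// mulrDl mulfV ?gt_eqF//.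
by rewrite mul1r lerD2r lef_pV2.
Qed.

Lemma poi_dilate L t : 0 < L -> poi (L * t) <= (1 + (L ^+ 2)^-1) * poi t.
Proof.
move=> L0; have L2 : 0 < L ^+ 2 by rewrite exprn_gt0.
rewrite /poi ler_pdivlMr ?oneD_gt0// mulrC ler_pdivrMr ?oneD_gt0//.
have -> : (1 + (L ^+ 2)^-1) * (1 + (L * t) ^+ 2) = 1 + t ^+ 2 + ((L ^+ 2)^-1 + (L * t) ^+ 2).
  by field; rewrite gt_eqF.
by rewrite lerDl addr_ge0 ?sqr_ge0// invr_ge0 ltW.
Qed.

Lemma kern_dilate C k L : 0 < L -> kern C k ->
  kern (L * (C * (1 + (L ^+ 2)^-1))) (fun t => L * k (L * - t)).
Proof.
move=> L0 kk; have C0 := kern_ge0 kk; split.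
  apply: borelM; first exact: borel_cst.
  apply: borel_comp; first by case: kk.
  by apply: borelM; [exact: borel_cst|exact: (borel_cont (der_cont (derN (@der_id R))))].
move=> t; rewrite normrM (gtr0_norm L0) -!mulrA; apply: ler_wpM2l; first exact: ltW.
apply: (le_trans (kk.2 _)); apply: ler_wpM2l => //.
by rewrite -[poi t]poiN; exact: poi_dilate.
Qed.

Lemma intg_dilated C k p L x : 0 < L -> kern C k -> tame p ->
  intg (fun y => p y * (L * k (L * (y - x)))).
Proof.
move=> L0 kk tp; have := convol_intg x (kern_dilate L0 kk) tp.
by congr intg; apply/funext => y; rewrite mulrC opprB.
Qed.

(** The function p may be unbounded. Near x its continuity is used; at distance at least d
    [dilated_poi] gains 1 / N against the weight, and what is left is the finite number
    [pmax P x]. *)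
Lemma approximate_identity C k p x : kern C k -> tame p -> {for x, continuous p} ->
  It (fun y => p y * (n.+1%:R * k (n.+1%:R * (y - x)))) @[n --> \oo] --> p x * It k.
Proof.
move=> kk tp cp; have C0 := kern_ge0 kk; have ik := kern_intg kk.
pose L n : R := n.+1%:R; have L0 n : 0 < L n by rewrite ltr0n.
pose P y := `|p y - p x|.
have tP : tame P by apply: tame_abs; apply: tameB => //; apply: (@tame_bounded _ _ `|p x|) => //; exact: borel_cst.
have idil F n : intg F -> intg (fun y => L n * F (L n * (y - x))) /\
    It (fun y => L n * F (L n * (y - x))) = It F.
  move=> iF; have i1 := intg_dilate (L0 n) iF.
  have i2 := intg_shift (- x) i1; have i3 := intgZ (L n) i2.
  split; first exact: i3.
  rewrite ItZ//; have -> := It_shift (- x) i1.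
  by rewrite (It_dilate (L0 n) iF) mulrA mulfV ?mul1r// gt_eqF.
apply/cvgrPdist_le => e e0.
have den0 : 0 < C * Ipoi R + 1 by rewrite ltr_wpDl// mulr_ge0// Ipoi_ge0.
pose e1 := e / 2 / (C * Ipoi R + 1); have e10 : 0 < e1 by rewrite !divr_gt0.
have [d d0 dP] : exists2 d, 0 < d & forall y, `|y - x| < d -> P y <= e1.
  move: cp => /cvgrPdist_le /(_ e1 e10) /nbhs_ballP [d /= d0 H]; exists d => // y xy.
  by rewrite /P distrC; apply: H; rewrite /ball /= distrC.
pose A := (1 + d ^+ 2) / d ^+ 2.
have A0 : 0 <= A by rewrite divr_ge0 ?sqr_ge0// addr_ge0 ?sqr_ge0.
pose S := C * (A * pmax P x).
have S0 : 0 <= S.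
  by apply: mulr_ge0; [|apply: mulr_ge0 => //; exact: pmax_ge0].
have [M MP] : exists M, S / (e / 2) <= M%:R.
  by exists (Num.truncn (S / (e / 2))).+1; apply: ltW; rewrite truncnS_gt.
exists M => // n /= Mn.
have [ikn Ikn] := idil _ n ik; have [ipn Ipn] := idil _ n (@intg_poi R).
have ipk := intg_dilated x (L0 n) kk tp.
have ixk : intg (fun y => p x * (L n * k (L n * (y - x)))) by exact: intgZ.
have -> : p x * It k = It (fun y => p x * (L n * k (L n * (y - x)))) by rewrite ItZ// Ikn.
rewrite -ItB//.
have iM : intg (fun y => C * (e1 * (L n * poi (L n * (y - x))) + (L n)^-1 * (A * (poi (x - y) * `|P y|)))).
  by apply: intgZ; apply: intgD; apply: intgZ => //; apply: intgZ; exact: pmax_intg.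
apply: (@le_trans _ _ (It (fun y => C * (e1 * (L n * poi (L n * (y - x))) + (L n)^-1 * (A * (poi (x - y) * `|P y|)))))).
  apply: It_norm => // [|y]; first exact: intg_borel (intgB ixk ipk).
  rewrite -mulrBl normrM distrC -/(P y) normrM (gtr0_norm (L0 n)).
  have H := ler_wpM2l (ltW (L0 n)) (kk.2 (L n * (y - x))).
  have P0 : 0 <= P y by exact: normr_ge0.
  rewrite (ger0_norm P0).
  apply: (le_trans (ler_wpM2l P0 H)).
  rewrite [L n * (C * _)]mulrCA [P y * (C * _)]mulrCA; apply: ler_wpM2l => //.
  have [yd|yd] := ltP `|y - x| d.
    rewrite -[leLHS]addr0; apply: lerD.
      apply: ler_wpM2r; last exact: dP.
      by apply: mulr_ge0; [exact: ltW|exact: poi_ge0].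
    apply: mulr_ge0; first by rewrite invr_ge0 ltW.
    by apply: mulr_ge0 => //; apply: mulr_ge0 => //; exact: poi_ge0.
  rewrite -[leLHS]add0r; apply: lerD.
    apply: mulr_ge0; first exact: ltW.
    by apply: mulr_ge0; [exact: ltW|exact: poi_ge0].
  have -> : (L n)^-1 * (A * (poi (x - y) * P y)) = P y * ((L n)^-1 * (A * poi (y - x))).
    rewrite poiC [RHS]mulrCA; congr (_ * _).
    by rewrite [RHS]mulrCA; congr (_ * _); rewrite mulrC.
  exact: (ler_wpM2l P0 (dilated_poi (L0 n) d0 yd)).
rewrite ItZ; last first.
  by apply: intgD; apply: intgZ => //; apply: intgZ; exact: pmax_intg.
rewrite ItD; [|exact: intgZ|by do 2 apply: intgZ; exact: pmax_intg].
rewrite ItZ// Ipn ItZ; last by apply: intgZ; exact: pmax_intg.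
rewrite ItZ; last exact: pmax_intg.
rewrite -/(Ipoi R) mulrDr [C * (_^-1 * _)]mulrCA.
have -> : It (fun y => poi (x - y) * `|P y|) = pmax P x by [].
rewrite -/S.
have h1 : C * (e1 * Ipoi R) <= e / 2.
  rewrite mulrCA /e1 mulrAC ler_pdivrMr// ler_wpM2l ?divr_ge0 ?(ltW e0)//.
  by rewrite lerDl.
have h2 : (L n)^-1 * S <= e / 2.
  rewrite mulrC ler_pdivrMr// mulrC -ler_pdivrMr ?divr_gt0//.
  by rewrite (le_trans MP)// ler_nat; exact: leqW.
apply: (le_trans (lerD h1 h2)); lra.
Qed.

Variables (T : (R -> R[i]) -> R[i]) (p1 p2 : R -> R) (sigma : R).
Hypothesis T_tempered : tempered_distribution T.
Hypothesis T_repr : represents T (cx p1 p2).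
Hypothesis T_spec : spectrum_in T sigma.
Hypothesis sigma_gt0 : 0 < sigma.
Hypothesis (p1_tame : tame p1) (p2_tame : tame p2).
Hypothesis (p1_cont : continuous p1) (p2_cont : continuous p2).

(** As a function of y, [FC psi (y - x)] is the Fourier transform of psi (t) exp (i x t), the
    imaginary part vanishing because psi is even. A gap twice as wide as [-sigma, sigma] keeps even
    the closed support away from that interval. *)
Lemma spectral_gap a psi x : csmth a psi -> (forall t, psi (- t) = psi t) ->
  (forall t, `|t| <= 2 * sigma -> psi t = 0) ->
  It (fun y => p1 y * FC psi (y - x)) = 0 /\ It (fun y => p2 y * FC psi (y - x)) = 0.
Proof.
move=> cp ev gap.
pose u t := psi t * cos (x * t); pose v t := psi t * sin (x * t).
have cu : csmth a u by apply: csmth_M => //; exact: smooth_cos.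
have cv : csmth a v by apply: csmth_M => //; exact: smooth_sin.
have [iu iv] := (csmth_intg cu, csmth_intg cv).
have uE t : u (- t) = u t by rewrite /u ev mulrN cosN.
have vE t : v (- t) = - v t by rewrite /v ev mulrN sinN mulrN.
have FE y : FC psi (y - x) = FC u y + FS v y.
  rewrite /FC /FS -ItD; [|exact: intg_cos|exact: intg_sin].
  by apply: eq_It => t; rewrite /u /v mulrBl cosB mulrDr -!mulrA [cos (x * t) * _]mulrC [sin (x * t) * _]mulrC.
have tF : transform (fun y => FC psi (y - x)) by exists a, u, v.
have fE : fourier (cx u v) = ofreal (fun y => FC psi (y - x)).
  apply/funext => y; rewrite /fourier /cintegral /ofreal; congr (_ +i* _).
    rewrite FE /FC /FS -ItD; [|exact: intg_cos|exact: intg_sin].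
    by apply: eq_It => t; rewrite /refun /cx /= mulrN opprK.
  transitivity (FC v y - FS u y).
    rewrite /FC /FS -ItB; [|exact: intg_cos|exact: intg_sin].
    by apply: eq_It => t; rewrite /imfun /cx /= mulrN addrC.
  by rewrite (FC_odd y iv vE) (FS_even y iu uE) subrr.
have sd : csupport (cx u v) `&` `[- sigma, sigma] = set0.
  by apply: csupport_disjoint => // t /gap H; rewrite /u /v H !mul0r.
have := T_spec (test_cx cu cv) sd; rewrite fE (T_transform T_tempered T_repr p1_tame p2_tame tF).
by move=> /eqP; rewrite eq_complex /= => /andP[/eqP -> /eqP ->].
Qed.

(** For L >= 2 sigma the difference of the bumps dilated to L and to 2 sigma vanishes on
    [-2 sigma, 2 sigma], so both scales give the same integral. As L grows, that integral tends to p
    x times the integral of [FC bumpR], which is 2 c0. *)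
Lemma reproducing_aux p x : tame p -> continuous p ->
  (forall a psi, csmth a psi -> (forall t, psi (- t) = psi t) ->
    (forall t, `|t| <= 2 * sigma -> psi t = 0) -> It (fun y => p y * FC psi (y - x)) = 0) ->
  2 * c0 R * p x = It (fun y => p y * (2 * sigma * FC (@bumpR R) (2 * sigma * (y - x)))).
Proof.
move=> tp cp H; have cb : csmth 2 (@bumpR R) by split; [exact: smooth_bump|exact: bump0].
have [C kC] := csmth_FC cb; have ib := csmth_intg cb.
have s0 : 0 < 2 * sigma by rewrite mulr_gt0.
pose b := (2 * sigma)^-1; have b0 : 0 < b by rewrite invr_gt0.
set K := It _.
have := approximate_identity kC tp (cp x).
rewrite (It_FC cb) bump1 ?normr0// mulr1 mulrC => lim.
apply/esym; apply: (cvg_unique _ _ lim) => //.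
have [M MP] : exists M, 2 * sigma <= M%:R.
  by exists (Num.truncn (2 * sigma)).+1; apply: ltW; rewrite truncnS_gt.
apply: cvg_near_cst; exists M; [exact: I|move=> n Mn].
pose L : R := n.+1%:R; have L0 : 0 < L by rewrite ltr0n.
have Li0 : 0 < L^-1 by rewrite invr_gt0.
have sL : 2 * sigma <= L by rewrite (le_trans MP)// ler_nat leqW.
have c1 := csmth_bump_scale Li0; have c2 := csmth_bump_scale b0.
have m1 : 2 / L^-1 <= 2 / L^-1 + 2 / b by rewrite lerDl divr_ge0 ?(ltW b0).
have m2 : 2 / b <= 2 / L^-1 + 2 / b by rewrite lerDr divr_ge0 ?(ltW Li0).
pose psi t := bumpR (L^-1 * t) - bumpR (b * t).
have cpsi : csmth (2 / L^-1 + 2 / b) psi.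
  have [s1 z1] := csmth_le m1 c1; have [s2 z2] := csmth_le m2 c2.
  by split; [exact: smoothB|move=> t ht; rewrite /psi z1 ?z2 ?subrr].
have ev t : psi (- t) = psi t by rewrite /psi !mulrN !bump_even.
have gap t : `|t| <= 2 * sigma -> psi t = 0.
  move=> ht; rewrite /psi !bump1 ?subrr//.
    by rewrite normrM gtr0_norm// /b mulrC ler_pdivrMr ?mul1r.
  by rewrite normrM gtr0_norm// mulrC ler_pdivrMr ?mul1r// (le_trans ht).
have FE y : FC psi (y - x) = L * FC (@bumpR R) (L * (y - x)) - 2 * sigma * FC (@bumpR R) (2 * sigma * (y - x)).
  rewrite /FC; transitivity (FC (fun t => bumpR (L^-1 * t)) (y - x) - FC (fun t => bumpR (b * t)) (y - x)).
    rewrite /FC -ItB; [|exact: (intg_cos _ (csmth_intg c1))|exact: (intg_cos _ (csmth_intg c2))].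
    by apply: eq_It => t; rewrite mulrBl.
  by rewrite !FC_dilate// invrK /b invrK [_ * L]mulrC [_ * (2 * sigma)]mulrC.
have := H _ _ cpsi ev gap.
have -> : It (fun y => p y * FC psi (y - x)) = It (fun y => p y * (L * FC (@bumpR R) (L * (y - x)))) - K.
  rewrite -ItB; [|exact: intg_dilated kC tp|exact: intg_dilated kC tp].
  by apply: eq_It => y; rewrite FE mulrBr.
by move/eqP; rewrite subr_eq0 => /eqP.
Qed.

Theorem bandlimited_maximal C x : kern C (FC (@bumpR R)) ->
  `|p1 x| <= C / (2 * c0 R) * pmaxh (2 * sigma)^-1 p1 x /\
  `|p2 x| <= C / (2 * c0 R) * pmaxh (2 * sigma)^-1 p2 x.
Proof.
move=> kC; have C0 := kern_ge0 kC.
have s0 : 0 < 2 * sigma by rewrite mulr_gt0.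
have cc : 0 < 2 * c0 R by rewrite mulr_gt0// c0_gt0.
have key p : tame p -> 2 * c0 R * p x = It (fun y => p y * (2 * sigma * FC (@bumpR R) (2 * sigma * (y - x)))) ->
    `|p x| <= C / (2 * c0 R) * pmaxh (2 * sigma)^-1 p x.
  move=> tp E; rewrite mulrAC ler_pdivlMr// mulrC -[2 * c0 R](gtr0_norm cc) -normrM E.
  have ip := intg_dilated x s0 kC tp.
  have io : intg (fun y => poih (2 * sigma)^-1 (x - y) * `|p y|).
    have := intg_dilated x s0 (@kern_poi R) (tame_abs tp); congr intg; apply/funext => y.
    by rewrite /poih !invrK mulrC [(x - y) * _]mulrC -[x - y]opprB mulrN poiN.
  rewrite /pmaxh -ItZ//; apply: It_norm; [exact: intg_borel ip|exact: intgZ|move=> y].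
  rewrite normrM normrM (gtr0_norm s0) /poih !invrK [(x - y) * _]mulrC -[x - y]opprB mulrN poiN.
  have H := kC.2 (2 * sigma * (y - x)).
  have -> : C * (2 * sigma * poi (2 * sigma * (y - x)) * `|p y|) = `|p y| * (2 * sigma * (C * poi (2 * sigma * (y - x)))).
    by move: (poi _) `|p y| => P1 P2; ring.
  by apply: ler_wpM2l => //; apply: ler_wpM2l H; exact: ltW.
split; apply: key => //; apply: reproducing_aux => // a psi cp ev gap.
  by have [] := spectral_gap x cp ev gap.
by have [] := spectral_gap x cp ev gap.
Qed.
End Reproducing.

(** * Dilates of J w are band-limited *)

Section BandlimitedDilates.
Variable R : realType.
Implicit Types (f g h F G e phi psi u v w k : R -> R) (a b c d s t x y z C : R) (m n : nat).

Lemma abscD (z w : R[i]) : absc (z + w) <= absc z + absc w.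
Proof.
have := ler_normD z w; rewrite !normc_def -rmorphD lecR /absc.
by case: z w => [? ?] [? ?].
Qed.

Lemma abscM (z w : R[i]) : absc (z * w) = absc z * absc w.
Proof. exact: ComplexField.Normc.normcM. Qed.

Lemma cderivE n (f : R -> R[i]) x : cderiv n f x = derive1n n (refun f) x +i* derive1n n (imfun f) x.
Proof. by []. Qed.

Lemma smooth_derivable u : (forall n x, derivable (derive1n n u) x 1) -> smooth u.
Proof.
move=> H n; have D (j : nat) : der (derive1n j u) (derive1n j.+1 u).
  by move=> x; rewrite derive1nS derive1E; exact/derivableP/H.
suff S m (j : nat) : smN m (derive1n j u) by exact: (S n 0).
by elim: m j => [//|m IH] j; exists (derive1n j.+1 u) => //; exact: IH.
Qed.

Lemma test_parts (f : R -> R[i]) : test_function f ->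
  exists a, csmth a (refun f) /\ csmth a (imfun f).
Proof.
move=> [sf /compact_bounded[M [_ MP]]].
pose a := `|M| + 1; have aM : M < a by rewrite (le_lt_trans (ler_norm M))// ltrDl.
have f0 x : a + 1 <= `|x| -> f x = 0.
  move=> ax; apply/eqP; apply: contraPT isT => fx.
  have /(MP a aM) : csupport f x by apply: subset_closure.
  by rewrite /= leNgt (lt_le_trans _ ax)// ltrDl.
exists (a + 1); split; split.
- by apply: smooth_derivable => n x; have [H _] := sf n.+1; have [] := H n x (ltnSn n).
- by move=> x /f0; rewrite /refun => ->.
- by apply: smooth_derivable => n x; have [H _] := sf n.+1; have [] := H n x (ltnSn n).
- by move=> x /f0; rewrite /imfun => ->.
Qed.

Lemma csmooth_parts (f : R -> R[i]) : csmooth f -> smooth (refun f) /\ smooth (imfun f).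
Proof.
by move=> sf; split; apply: smooth_derivable => n x; have [H _] := sf n.+1; have [] := H n x (ltnSn n).
Qed.

Lemma schwartz_seminorm_ge0 (f : R -> R[i]) m n : schwartz f -> 0 <= schwartz_seminorm m n f.
Proof.
move=> [_ H]; apply: (@le_trans _ _ (`|0 : R| ^+ m * absc (cderiv n f 0))).
  by apply: mulr_ge0; [exact: exprn_ge0|exact: absc_ge0].
by apply: ub_le_sup; [exact: H|exists 0].
Qed.

Lemma schwartz_poi (f : R -> R[i]) x : schwartz f ->
  absc (f x) <= (schwartz_seminorm 0 0 f + schwartz_seminorm 2 0 f) * poi x.
Proof.
move=> [_ H]; rewrite /poi ler_pdivlMr ?oneD_gt0// mulrC mulrDl mul1r.
have E : absc (cderiv 0 f x) = absc (f x) by rewrite cderivE !derive1n0 /refun /imfun; case: (f x).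
apply: lerD.
  by apply: ub_le_sup; [exact: H|exists x => //; rewrite expr0 mul1r E].
by apply: ub_le_sup; [exact: H|exists x => //; rewrite E real_normK ?num_real].
Qed.

Lemma It_lin3 u1 u2 u3 a b : intg u1 -> intg u2 -> intg u3 ->
  It (fun x => a * u1 x + b * u2 x + u3 x) = a * It u1 + b * It u2 + It u3.
Proof.
move=> i1 i2 i3; have j1 := intgZ a i1; have j2 := intgZ b i2.
by rewrite ItD//; [rewrite ItD// !ItZ|exact: intgD].
Qed.

Lemma sum3_ge (q : nat -> nat -> R) : (forall m n, 0 <= q m n) ->
  q 0%N 0%N + q 2%N 0%N <= \sum_(m < 3) \sum_(n < 3) q m n.
Proof.
move=> q0; rewrite !big_ord_recr !big_ord0 /= !add0r.
have := q0 0%N 1%N; have := q0 0%N 2%N; have := q0 1%N 0%N; have := q0 1%N 1%N; have := q0 1%N 2%N.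
have := q0 2%N 1%N; have := q0 2%N 2%N; move: (q 0%N 0%N) (q 2%N 0%N) (q 0%N 1%N) (q 0%N 2%N) (q 1%N 0%N) (q 1%N 1%N) (q 1%N 2%N) (q 2%N 1%N) (q 2%N 2%N).
by move=> *; lra.
Qed.

Lemma schwartz_lin (c : R[i]) (f g : R -> R[i]) : schwartz f -> schwartz g ->
  schwartz (fun x => c * f x + g x).
Proof.
move=> sf sg; have [f1 f2] := csmooth_parts sf.1; have [g1 g2] := csmooth_parts sg.1.
case: c => a b.
have re : refun (fun x => (a +i* b) * f x + g x) = (fun x => a * refun f x + - b * imfun f x + refun g x).
  by apply/funext => x; rewrite /refun /imfun; case: (f x) (g x) => [u1 u2] [v1 v2] /=; ring.
have im : imfun (fun x => (a +i* b) * f x + g x) = (fun x => b * refun f x + a * imfun f x + imfun g x).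
  by apply/funext => x; rewrite /refun /imfun; case: (f x) (g x) => [u1 u2] [v1 v2] /=; ring.
have sc (a1 : R) u : smooth u -> smooth (fun x => a1 * u x) by move=> su; apply: smoothM => //; exact: smooth_cst.
split.
  have -> : (fun x => (a +i* b) * f x + g x) = cx (fun x => a * refun f x + - b * imfun f x + refun g x)
      (fun x => b * refun f x + a * imfun f x + imfun g x).
    by rewrite -re -im; apply/funext => x; rewrite /cx /refun /imfun; case: (_ + _).
  by apply: csmooth_cx; do 2 apply: smoothD => //; exact: sc.
have E n x : cderiv n (fun x => (a +i* b) * f x + g x) x = (a +i* b) * cderiv n f x + cderiv n g x.
  rewrite !cderivE re im.
  have lin u1 u2 u3 a1 b1 : smooth u1 -> smooth u2 -> smooth u3 ->
      derive1n n (fun x => a1 * u1 x + b1 * u2 x + u3 x) x = a1 * derive1n n u1 x + b1 * derive1n n u2 x + derive1n n u3 x.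
    move=> s1 s2 s3; have d1 := nder_Z a1 (nder_smooth n s1); have d2 := nder_Z b1 (nder_smooth n s2).
    by rewrite (nder_derive1n (nder_D (nder_D d1 d2) (nder_smooth n s3))).
  rewrite !lin//.
  by apply/eqP; rewrite eq_complex /=; apply/andP; split; apply/eqP; ring.
move=> m n; have [A AP] := sf.2 m n; have [B BP] := sg.2 m n.
exists (absc (a +i* b) * A + B) => _ [x _ <-]; cbv beta; rewrite E.
have t0 : 0 <= `|x| ^+ m by exact: exprn_ge0.
have HA : `|x| ^+ m * absc (cderiv n f x) <= A by apply: AP; exists x.
have HB : `|x| ^+ m * absc (cderiv n g x) <= B by apply: BP; exists x.
apply: (le_trans (ler_wpM2l t0 (abscD _ _))).
rewrite mulrDr; apply: lerD => //.
rewrite abscM mulrCA; apply: ler_wpM2l => //.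
exact: absc_ge0.
Qed.

Section Criterion.
Variables (p1 p2 : R -> R).
Hypothesis (p1_tame : tame p1) (p2_tame : tame p2).
Let T (f : R -> R[i]) := cintegral setT (fun x => cx p1 p2 x * f x).

Lemma tame_schwartz p (f : R -> R[i]) : tame p -> schwartz f ->
  intg (fun x => p x * refun f x) /\ intg (fun x => p x * imfun f x).
Proof.
move=> tp sf; have [s1 s2] := csmooth_parts sf.1.
have key u : smooth u -> (forall x, `|u x| <= absc (f x)) -> intg (fun x => p x * u x).
  move=> su uf; have := @tame_mul R u p (schwartz_seminorm 0 0 f + schwartz_seminorm 2 0 f) _ _ tp.
  have E : (fun y => u y * p y) = (fun y => p y * u y) by apply/funext => y; rewrite mulrC.
  rewrite E; apply; first by apply: borel_cont; exact: smooth_cont.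
  by move=> x; apply: (le_trans (uf x)); exact: schwartz_poi.
by split; apply: key => // x; [exact: absc_Re|exact: absc_Im].
Qed.

Lemma cintegral_split (q1 q2 : R -> R) (f : R -> R[i]) :
  intg (fun x => q1 x * refun f x) -> intg (fun x => q1 x * imfun f x) ->
  intg (fun x => q2 x * refun f x) -> intg (fun x => q2 x * imfun f x) ->
  cintegral setT (fun x => cx q1 q2 x * f x) =
    (It (fun x => q1 x * refun f x) - It (fun x => q2 x * imfun f x)) +i*
    (It (fun x => q1 x * imfun f x) + It (fun x => q2 x * refun f x)).
Proof.
move=> i1 i2 i3 i4.
rewrite -ItB// -ItD// /cintegral; congr (_ +i* _); apply: eq_It => x; rewrite /refun /imfun /cx;
by case: (f x).
Qed.

Lemma T_split (f : R -> R[i]) : schwartz f ->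
  T f = (It (fun x => p1 x * refun f x) - It (fun x => p2 x * imfun f x)) +i*
        (It (fun x => p1 x * imfun f x) + It (fun x => p2 x * refun f x)).
Proof.
move=> sf; have [i1 i2] := tame_schwartz p1_tame sf; have [i3 i4] := tame_schwartz p2_tame sf.
exact: cintegral_split.
Qed.

Lemma T_is_tempered : tempered_distribution T.
Proof.
split.
  move=> c f g sf sg; rewrite !T_split//; last exact: schwartz_lin.
  have [i1 i2] := tame_schwartz p1_tame sf; have [i3 i4] := tame_schwartz p2_tame sf.
  have [j1 j2] := tame_schwartz p1_tame sg; have [j3 j4] := tame_schwartz p2_tame sg.
  case: c => a b.
  have re p : intg (fun x => p x * refun f x) -> intg (fun x => p x * imfun f x) ->
      intg (fun x => p x * refun g x) -> It (fun x => p x * refun (fun x => (a +i* b) * f x + g x) x) =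
      a * It (fun x => p x * refun f x) + - b * It (fun x => p x * imfun f x) + It (fun x => p x * refun g x).
    move=> k1 k2 k3; rewrite -It_lin3//; apply: eq_It => x; rewrite /refun /imfun.
    by case: (f x) (g x) => [u1 u2] [v1 v2] /=; ring.
  have im p : intg (fun x => p x * refun f x) -> intg (fun x => p x * imfun f x) ->
      intg (fun x => p x * imfun g x) -> It (fun x => p x * imfun (fun x => (a +i* b) * f x + g x) x) =
      b * It (fun x => p x * refun f x) + a * It (fun x => p x * imfun f x) + It (fun x => p x * imfun g x).
    move=> k1 k2 k3; rewrite -It_lin3//; apply: eq_It => x; rewrite /refun /imfun.
    by case: (f x) (g x) => [u1 u2] [v1 v2] /=; ring.
  rewrite !re// !im//.
  move: (It _) (It _) (It _) (It _) (It _) (It _) (It _) (It _) => x1 x2 x3 x4 x5 x6 x7 x8.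
  by apply/eqP; rewrite eq_complex /=; apply/andP; split; apply/eqP; ring.
pose K p := It (fun x => `|p x * poi x|).
have iK p : tame p -> intg (fun x => `|p x * poi x|) by move=> [_ i]; exact: intg_abs.
have K0 p : 0 <= K p by apply: It_ge0.
(* Summing over indices below 3 includes the seminorms (0, 0) and (2, 0), which together bound
   [absc (f x)] by a multiple of [poi x]. *)
exists (2 * (K p1 + K p2)), 3%N => f sf.
pose S := schwartz_seminorm 0 0 f + schwartz_seminorm 2 0 f.
have sn m n := schwartz_seminorm_ge0 m n sf.
have S0 : 0 <= S by rewrite addr_ge0.
have B p u : tame p -> intg (fun x => p x * u x) -> (forall x, `|u x| <= absc (f x)) ->
    `|It (fun x => p x * u x)| <= K p * S.
  move=> tp ip uf; rewrite /K -ItZr; last exact: iK.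
  apply: It_norm => [||x]; [exact: intg_borel ip|by under eq_fun do rewrite mulrC; exact/intgZ/iK|].
  rewrite !normrM -mulrA; apply: ler_wpM2l => //.
  rewrite (ger0_norm (poi_ge0 x)) mulrC.
  by apply: (le_trans (uf x)); exact: schwartz_poi.
have [i1 i2] := tame_schwartz p1_tame sf; have [i3 i4] := tame_schwartz p2_tame sf.
apply: (@le_trans _ _ (2 * (K p1 + K p2) * S)); last first.
  apply: ler_wpM2l; first by rewrite mulr_ge0 ?addr_ge0.
  exact: (@sum3_ge (fun m n => schwartz_seminorm m n f)).
rewrite T_split//; apply: (le_trans (absc_le _)) => /=.
have b1 := B _ _ p1_tame i1 (fun x => absc_Re (f x)).
have b2 := B _ _ p1_tame i2 (fun x => absc_Im (f x)).
have b3 := B _ _ p2_tame i3 (fun x => absc_Re (f x)).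
have b4 := B _ _ p2_tame i4 (fun x => absc_Im (f x)).
apply: (le_trans (lerD (ler_normB _ _) (ler_normD _ _))).
apply: (le_trans (lerD (lerD b1 b4) (lerD b2 b3))).
by move: (K p1) (K p2) => k1 k2; rewrite le_eqVlt; apply/orP; left; apply/eqP; ring.
Qed.

Lemma intg_kern C k p : kern C k -> tame p -> intg (fun x => p x * k x).
Proof.
move=> [bk kp] tp; have := tame_mul bk kp tp.
by congr intg; apply/funext => x; rewrite mulrC.
Qed.

Lemma intg_csmth a u p : csmth a u -> tame p -> intg (fun x => p x * u x).
Proof.
move=> cu tp; have [_ [_ [C [_ _ uC _]]]] := csmth_decay cu.
by apply: (@intg_kern C) => //; split=> //; apply: borel_cont; apply: smooth_cont; case: cu.
Qed.

Lemma fourier_parts a (f : R -> R[i]) : csmth a (refun f) -> csmth a (imfun f) ->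
  fourier f = cx (fun y => FC (refun f) y + FS (imfun f) y) (fun y => FC (imfun f) y - FS (refun f) y).
Proof.
move=> c1 c2; have [i1 i2] := (csmth_intg c1, csmth_intg c2).
apply/funext => y; rewrite /fourier /cintegral /cx /FC /FS.
rewrite -ItD ?intg_cos ?intg_sin// -ItB ?intg_cos ?intg_sin//.
congr (_ +i* _); apply: eq_It => x; rewrite /refun /imfun; case: (f x) => r t /=; first by rewrite mulrN opprK.
by rewrite mulrN addrC.
Qed.

(** A test function whose support misses [-sigma, sigma] vanishes there, and so do its real and
    imaginary parts; pairing the Fourier transform with p1 and p2 leaves only the four listed
    integrals for each part. *)
Lemma bandlimited_criterion (X : banach_lattice R) sigma :
  continuous p1 -> continuous p2 -> X (cx p1 p2) ->
  (forall a phi, csmth a phi -> (forall x, `|x| <= sigma -> phi x = 0) ->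
    [/\ It (fun x => p1 x * FC phi x) = 0, It (fun x => p1 x * FS phi x) = 0,
        It (fun x => p2 x * FC phi x) = 0 & It (fun x => p2 x * FS phi x) = 0]) ->
  bandlimited X sigma (cx p1 p2).
Proof.
move=> c1 c2 Xp H; split=> //; split; first by split.
exists T; split=> [|//|f tf dis]; first exact: T_is_tempered.
have [a [ca cb]] := test_parts tf.
have f0 x : `|x| <= sigma -> f x = 0.
  move=> xs; apply/eqP; apply: contraPT isT => fx.
  have : (csupport f `&` `[- sigma, sigma]) x.
    split; first by apply: subset_closure.
    by rewrite /= in_itv/= -ler_norml.
  by rewrite dis.
have [h1 h2 h3 h4] := H _ _ ca (fun x xs => congr1 (@complex.Re R) (f0 x xs)).
have [k1 k2 k3 k4] := H _ _ cb (fun x xs => congr1 (@complex.Im R) (f0 x xs)).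
have [A1 kA1] := csmth_FC ca; have [A2 kA2] := csmth_FS ca.
have [B1 kB1] := csmth_FC cb; have [B2 kB2] := csmth_FS cb.
have ik p C k : tame p -> kern C k -> intg (fun x => p x * k x) by move=> tp kk; exact: (intg_kern kk tp).
have P1 p : tame p -> It (fun x => p x * FC (refun f) x) = 0 -> It (fun x => p x * FS (imfun f) x) = 0 ->
    intg (fun x => p x * refun (fourier f) x) /\ It (fun x => p x * refun (fourier f) x) = 0.
  move=> tp e1 e2; rewrite (fourier_parts ca cb).
  have j1 := ik _ _ _ tp kA1; have j2 := ik _ _ _ tp kB2.
  have -> : (fun x => p x * refun (cx (fun y => FC (refun f) y + FS (imfun f) y) (fun y => FC (imfun f) y - FS (refun f) y)) x) =
    (fun x => p x * FC (refun f) x + p x * FS (imfun f) x) by apply/funext => x; exact: mulrDr.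
  by split; [exact: intgD|rewrite ItD// e1 e2 addr0].
have P2 p : tame p -> It (fun x => p x * FC (imfun f) x) = 0 -> It (fun x => p x * FS (refun f) x) = 0 ->
    intg (fun x => p x * imfun (fourier f) x) /\ It (fun x => p x * imfun (fourier f) x) = 0.
  move=> tp e1 e2; rewrite (fourier_parts ca cb).
  have j1 := ik _ _ _ tp kB1; have j2 := ik _ _ _ tp kA2.
  have -> : (fun x => p x * imfun (cx (fun y => FC (refun f) y + FS (imfun f) y) (fun y => FC (imfun f) y - FS (refun f) y)) x) =
    (fun x => p x * FC (imfun f) x - p x * FS (refun f) x) by apply/funext => x; exact: mulrBr.
  by split; [exact: intgB|rewrite ItB// e1 e2 subr0].
have [r1 s1] := P1 _ p1_tame h1 k2; have [r2 s2] := P1 _ p2_tame h3 k4.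
have [r3 s3] := P2 _ p1_tame k1 h2; have [r4 s4] := P2 _ p2_tame k3 h4.
by rewrite /T cintegral_split// s1 s2 s3 s4 subrr addr0.
Qed.

End Criterion.

Variables (gamma : R) (q : R -> R).
Hypothesis gamma_gt0 : 0 < gamma.
Hypothesis q_ge0 : forall x, 0 <= q x.
Hypothesis q_one : forall x, `|x| <= gamma / 2 -> q x = 1.
Hypothesis q_B0 : forall n, B0 (fun x => x ^+ n * q x).
Hypothesis q_supp : forall x, gamma <= `|x| -> q x = 0.
Opaque convol.

(** The convolution theorem yields transforms of [eta] multiplied by double transforms of [phi]. By
    inversion the latter vanish on [-gamma, gamma], and [eta] vanishes outside. *)
Lemma convol_kJ_eq0 a phi : csmth a phi -> (forall x, `|x| <= gamma -> phi x = 0) ->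
  convol (FC phi) (kJ q) = (fun=> 0) /\ convol (FS phi) (kJ q) = (fun=> 0).
Proof.
move=> cp p0; have [C1 k1] := csmth_FC cp; have [C2 k2] := csmth_FS cp.
have de := decay_eta gamma_gt0 q_ge0 q_one q_B0.
have ie := decay_intg de; have [C3 k3] := FC_kern de; have tk := kern_tame k3.
have i1 := kern_intg k1; have i2 := kern_intg k2; have ip := csmth_intg cp.
have z x : eta q x * FC (FC phi) x = 0 /\ eta q x * FS (FS phi) x = 0.
  have [xg|xg] := leP `|x| gamma; last by rewrite /eta q_supp ?ltW// !mul0r.
  have xg' : `|- x| <= gamma by rewrite normrN.
  by have [-> ->] := transforms_eq0 cp (p0 x xg) (p0 (- x) xg'); rewrite !mulr0.
have oFC t : FS (FC phi) t = 0 by apply: FS_even => // x; exact: FC_even.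
have oFS t : FC (FS phi) t = 0 by apply: FC_odd => // x; exact: FS_odd.
have E0 t : FC (fun=> 0 : R) t = 0 /\ FS (fun=> 0 : R) t = 0.
  by rewrite /FC /FS; split; rewrite -[RHS](It0 R); apply: eq_It => x; rewrite mul0r.
have key k C : kern C k -> (forall x, eta q x * FC k x = 0) -> (forall x, eta q x * FS k x = 0) ->
    convol k (kJ q) = (fun=> 0).
  move=> kk z1 z2; apply/funext => t.
  have -> : convol k (kJ q) = (fun x => ck R * convol k (FC (eta q)) x) by rewrite -(convolZr _ kk tk).
  rewrite (convol_FC _ kk ie) (_ : (fun x => _ * FC k x) = (fun=> 0)); last exact/funext.
  by rewrite (_ : (fun x => _ * FS k x) = (fun=> 0)) ?(E0 t).1 ?(E0 t).2 ?addr0 ?mulr0//; exact/funext.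
by split; [apply: (key _ _ k1)|apply: (key _ _ k2)] => x; rewrite ?oFC ?oFS ?mulr0//; have [] := z x.
Qed.

(** Up to sign the pairing is the value at 0 of a convolution with [J q w], as [FC phi] is even and
    [FS phi] odd; associativity then brings [FC phi] and [FS phi] next to [kJ]. *)
Lemma J_orthogonal a phi w : csmth a phi -> (forall x, `|x| <= gamma -> phi x = 0) -> tame w ->
  It (fun x => J q w x * FC phi x) = 0 /\ It (fun x => J q w x * FS phi x) = 0.
Proof.
move=> cp p0 tw; have [C1 k1] := csmth_FC cp; have [C2 k2] := csmth_FS cp.
have [[CJ kkJ] _ _ _ _] := kerns gamma_gt0 q_ge0 q_one q_B0.
have [z1 z2] := convol_kJ_eq0 cp p0.
have e1 := convol_convol k1 kkJ tw; have e2 := convol_convol k2 kkJ tw.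
rewrite z1 convol0 in e1; rewrite z2 convol0 in e2.
have at0 k : convol k (J q w) 0 = It (fun x => k (0 - x) * J q w x) by [].
split.
  have := congr1 (fun f => f 0) e1; cbv beta; rewrite -/(J q w) at0 => <-.
  by apply: eq_It => x; rewrite sub0r FC_even mulrC.
have := congr1 (fun f => f 0) e2; cbv beta; rewrite -/(J q w) at0 => E.
have i2 := intg_kern k2 (opc_tame (opk_opc (opk_J gamma_gt0 q_ge0 q_one q_B0)) tw).
rewrite -[LHS]opprK -ItN// -[RHS]oppr0 -E; congr (- _); apply: eq_It => x.
by rewrite sub0r FS_odd ?(csmth_intg cp)// mulNr mulrC.
Qed.

Lemma dilate_orthogonal (h : R) a phi w : 0 < h -> csmth a phi ->
  (forall x, `|x| <= gamma / h -> phi x = 0) -> tame w -> tame (fun x => J q w (x / h)) ->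
  It (fun x => J q w (x / h) * FC phi x) = 0 /\ It (fun x => J q w (x / h) * FS phi x) = 0.
Proof.
move=> h0 cp p0 tw tg; have [C1 k1] := csmth_FC cp; have [C2 k2] := csmth_FS cp.
have hn : h != 0 by rewrite gt_eqF.
have ip := csmth_intg cp; have hi0 : 0 < h^-1 by rewrite invr_gt0.
have cq : csmth (a * h) (fun x => phi (h^-1 * x)).
  split.
    by move=> n; have := smooth_comp_aff h^-1 0 cp.1 n; congr smN; apply/funext => x; rewrite addr0.
  by move=> x xa; apply: cp.2; rewrite normrM (gtr0_norm hi0) mulrC ler_pdivlMr.
have q0 x : `|x| <= gamma -> phi (h^-1 * x) = 0.
  move=> xg; apply: p0; rewrite normrM (gtr0_norm hi0) mulrC.
  by rewrite ler_wpM2r// ltW.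
have [z1 z2] := J_orthogonal cq q0 tw.
have key (F Fh : R -> R) : intg (fun x => J q w (x / h) * F x) ->
    (forall t, Fh t = h * F (t * h)) -> It (fun x => J q w x * Fh x) = 0 ->
    It (fun x => J q w (x / h) * F x) = 0.
  move=> iF FE z; have := It_dilate h0 iF => D.
  have {}D : It (fun x => J q w x * F (h * x)) = h^-1 * It (fun x => J q w (x / h) * F x).
    by rewrite -D; apply: eq_It => x; rewrite [h * x]mulrC mulfK.
  have iD : intg (fun x => J q w x * F (h * x)).
    by have := intg_dilate h0 iF; congr intg; apply/funext => x; rewrite [h * x]mulrC mulfK.
  have : h * It (fun x => J q w x * F (h * x)) = 0.
    rewrite -ItZ// -[RHS]z; apply: eq_It => x.
    by rewrite FE [h * x]mulrC mulrCA.
  by rewrite D mulrA mulfV// mul1r.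
split.
  by apply: (key _ _ (intg_kern k1 tg) _ z1) => t; rewrite FC_dilate// invrK.
by apply: (key _ _ (intg_kern k2 tg) _ z2) => t; rewrite FS_dilate// invrK.
Qed.
End BandlimitedDilates.

(** * Borel versions *)

Section AlmostEverywhere.
Variable R : realType.
Implicit Types (u v w : R -> R) (f g : R -> R[i]) (a b c h x y t C L : R).
Local Notation mu := (@Defs.mu R).
Local Notation leb := (@lebesgue_measure R).

#[global] Instance mu_ae_filter : Filter (almost_everywhere mu) := ae_filter_ringOfSetsType mu.

Section NonMeasurable.
Import HBNNSimple.

(* No measurability is assumed: simple functions below [f] can be set to 0 on a
   null set. *)
Lemma le_integral_ae (f g : R -> \bar R) : (forall x, (0 <= f x)%E) -> (forall x, (0 <= g x)%E) ->
  {ae mu, forall x, f x = g x} -> (\int[leb]_x f x <= \int[leb]_x g x)%E.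
Proof.
move=> f0 g0 [N [mN N0 sub]].
rewrite [leLHS]ge0_integralTE// [leRHS]ge0_integralTE//.
apply: ge_ereal_sup => _ [k /= kf <-].
have mNC : measurable (~` N) by exact: measurableC.
apply: ereal_sup_ubound; exists (proj_nnsfun k mNC) => /=.
  move=> x; rewrite mindicE; case: (boolP (x \in ~` N)) => xN; last by rewrite mulr0.
  rewrite mulr1; suff <- : f x = g x by exact: kf.
  by apply: contrapT => fg; move: xN; rewrite inE => /(_ (sub x fg)).
rewrite -!integralT_nnsfun; apply: ae_eq_integral => //.
- by apply/measurable_EFinP; exact: measurable_funPT.
- by apply/measurable_EFinP; exact: measurable_funPT.
exists N; split=> // x /= H; apply: contrapT => xN; apply: H => _.
by rewrite mindicE (_ : x \in ~` N) ?mulr1// inE.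
Qed.

End NonMeasurable.

Lemma integral_ae (f g : R -> \bar R) : (forall x, (0 <= f x)%E) -> (forall x, (0 <= g x)%E) ->
  {ae mu, forall x, f x = g x} -> (\int[leb]_x f x = \int[leb]_x g x)%E.
Proof.
move=> f0 g0 fg; apply/eqP; rewrite eq_le !le_integral_ae//.
by apply: filterS fg => x ->.
Qed.

Lemma Rintegral_ae u v (D : set R) : {ae mu, forall x, u x = v x} ->
  \int[mu]_(x in D) u x = \int[mu]_(x in D) v x.
Proof.
move=> uv; rewrite /Rintegral; congr fine.
rewrite integralE [RHS]integralE; congr (_ - _)%E.
  rewrite integral_mkcond [RHS]integral_mkcond; apply: integral_ae.
  - by move=> x; rewrite patchE; case: ifP => // _; exact: funepos_ge0.
  - by move=> x; rewrite patchE; case: ifP => // _; exact: funepos_ge0.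
  - by apply: filterS uv => x E; rewrite !patchE; case: ifP => // _; rewrite !funeposE E.
rewrite integral_mkcond [RHS]integral_mkcond; apply: integral_ae.
- by move=> x; rewrite patchE; case: ifP => // _; exact: funeneg_ge0.
- by move=> x; rewrite patchE; case: ifP => // _; exact: funeneg_ge0.
- by apply: filterS uv => x E; rewrite !patchE; case: ifP => // _; rewrite !funenegE E.
Qed.

Lemma steklov_ae h f g : {ae mu, forall x, f x = g x} -> steklov h f = steklov h g.
Proof.
move=> fg; apply/funext => x; rewrite /steklov /cintegral; congr (_ * (_ +i* _)).
  by apply: Rintegral_ae; apply: filterS fg => y; rewrite /refun => ->.
by apply: Rintegral_ae; apply: filterS fg => y; rewrite /imfun => ->.
Qed.

Lemma steklov_cx h u v : steklov h (cx u v) = cx (avg h u) (avg h v).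
Proof.
apply/funext => x.
have H w : \int[mu]_(t in `[x - h / 2, x + h / 2]) w t = convol (win h) w x.
  rewrite -[LHS]/(\int[leb]_(t in `[x - h / 2, x + h / 2]) w t) -It_itv.
  by apply: eq_It => y; rewrite winE mulrC.
rewrite /steklov /cintegral.
rewrite [X in X +i* _](H u : \int[mu]_(t in `[x - h / 2, x + h / 2]) refun (cx u v) t = _).
rewrite [X in _ +i* X](H v : \int[mu]_(t in `[x - h / 2, x + h / 2]) imfun (cx u v) t = _).
by apply/eqP; rewrite eq_complex /=; apply/andP; split; apply/eqP; rewrite /avg; ring.
Qed.

Definition Dh h u := fun x => u x - avg h u (x + h / 2).
Definition IAh h u := fun x => u x - avg h u x.

Lemma id_minus_dot_ae h s f u v : {ae mu, forall x, f x = cx u v x} ->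
  {ae mu, forall x, id_minus_pow (steklov_dot h) s f x = cx (iter s (Dh h) u) (iter s (Dh h) v) x}.
Proof.
move=> fe; elim: s => [//|s IH]; have E := steklov_ae h IH.
apply: filterS IH => x Ex; rewrite /id_minus_pow iterS /= -/(id_minus_pow (steklov_dot h) s f) Ex.
by rewrite /steklov_dot E steklov_cx.
Qed.

(** Averages do not see the null set where f differs from its Borel version, so that difference is
    carried along unchanged. The identity holds at every point, which is essential at the nodes. *)
Lemma id_minus_pow_raw h r f u v x : {ae mu, forall x, f x = cx u v x} ->
  id_minus_pow (steklov h) r f x = f x - cx u v x + cx (iter r (IAh h) u) (iter r (IAh h) v) x.
Proof.
move=> fe; elim: r x => [|r IH] x; first by rewrite /= subrK.
have ae : {ae mu, forall x, id_minus_pow (steklov h) r f x = cx (iter r (IAh h) u) (iter r (IAh h) v) x}.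
  by apply: filterS fe => y; rewrite IH => ->; rewrite subrr add0r.
rewrite /id_minus_pow iterS /= -/(id_minus_pow (steklov h) r f) (steklov_ae h ae) steklov_cx IH.
by rewrite -addrA.
Qed.

Variable X : banach_lattice R.
Hypothesis hA : assumption_A X.
Local Notation nm u := (bl_norm X (ofreal u)).

Lemma cmeas_cx u v : borel u -> borel v -> cmeasurable (cx u v).
Proof. by move=> bu bv; split; exact: lmeas_borel. Qed.

Lemma X_ae f g : cmeasurable g -> X f -> {ae mu, forall x, f x = g x} ->
  X g /\ bl_norm X g <= bl_norm X f.
Proof. by move=> mg Xf fg; apply: bl_ideal => //; apply: filterS fg => x ->. Qed.

Lemma X_parts u v : borel u -> borel v -> X (cx u v) ->
  [/\ X (ofreal u), X (ofreal v), nm u <= bl_norm X (cx u v) & nm v <= bl_norm X (cx u v)].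
Proof.
move=> bu bv Xuv.
have [Xu nu] : X (ofreal u) /\ nm u <= bl_norm X (cx u v).
  by apply: X_dom => // x; exact: (absc_Re (cx u v x)).
have [Xv nv] : X (ofreal v) /\ nm v <= bl_norm X (cx u v).
  by apply: X_dom => // x; exact: (absc_Im (cx u v x)).
by split.
Qed.

Lemma X_cx u v : X (ofreal u) -> X (ofreal v) ->
  X (cx u v) /\ bl_norm X (cx u v) <= nm u + nm v.
Proof.
move=> Xu Xv; have E : cx u v = ofreal u \+ (fun x => (0 +i* 1) * ofreal v x).
  apply/funext => x; rewrite /cx /ofreal /=.
  by apply/eqP; rewrite eq_complex /=; apply/andP; split; apply/eqP; ring.
have Xi := bl_scale (0 +i* 1) Xv; rewrite E; split; first exact: bl_add.
apply: (le_trans (bl_norm_add Xu Xi)); rewrite bl_norm_scale// lerD2l.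
by rewrite /absc /ComplexField.Normc.normc expr0n expr1n add0r sqrtr1 mul1r.
Qed.

Lemma borel_version f : X f -> exists u v, [/\ borel u, borel v,
  {ae mu, forall x, f x = cx u v x}, X (cx u v) & bl_norm X (cx u v) <= bl_norm X f].
Proof.
move=> Xf; have [[u bu eu] [v bv ev]] := bl_measurable Xf.
have ae : {ae mu, forall x, f x = cx u v x}.
  apply: filterS2 eu ev => x; rewrite /refun /imfun /cx => <- <-.
  by case: (f x).
have [Xc nc] := X_ae (cmeas_cx bu bv) Xf ae.
by exists u, v.
Qed.

(** Convergence of the average [pmaxh 1 u] at the point 0. *)
Lemma X_tame u : borel u -> X (ofreal u) -> tame u.
Proof.
move=> bu Xu; have [M M0 MP] := pmaxh_bound hA.
have [i _ _] := MP 1 u ltr01 bu Xu; split => //.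
apply: (intg_le _ (i 0)) => [|y]; first by apply: borelM => //; exact: borel_poi.
by rewrite normrM (ger0_norm (poi_ge0 y)) /poih invr1 mulr1 mul1r sub0r poiN mulrC.
Qed.

Lemma avg_pmaxh h u x : 0 < h -> borel u -> X (ofreal u) -> `|avg h u x| <= 2 * pmaxh h u x.
Proof.
move=> h0 bu Xu; have [M M0 MP] := pmaxh_bound hA; have [i _ _] := MP h u h0 bu Xu.
have iw := intg_win h x bu Xu.
rewrite /avg /convol /pmaxh -(ItZ h^-1 iw) -(ItZ 2 (i x)).
apply: It_norm; [exact: intg_borel (intgZ h^-1 iw)|exact: (intgZ 2 (i x))|move=> y].
rewrite mulrA normrM mulrA; apply: ler_wpM2r => //.
rewrite normrM (gtr0_norm (_ : 0 < h^-1)) ?invr_gt0// (ger0_norm (win_ge0 _ _)).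
rewrite /poih mulrCA; apply: ler_wpM2l; first by rewrite invr_ge0 ltW.
rewrite /win itvE; case: (boolP (_ <= _ <= _)); last by rewrite mulr_ge0 ?poi_ge0.
rewrite -ler_norml => xy; rewrite /poi ler_pdivlMr ?oneD_gt0// mul1r.
have : ((x - y) / h) ^+ 2 <= 1; last lra.
rewrite -real_normK ?num_real// exprn_ile1// normrM normfV (gtr0_norm h0).
by rewrite ler_pdivrMr// mul1r; lra.
Qed.

Lemma pmaxh_near h u x y rho : 0 < h -> 0 <= rho -> borel u -> X (ofreal u) ->
  `|x - y| <= rho * h -> pmaxh h u x <= 2 * (1 + rho ^+ 2) * pmaxh h u y.
Proof.
move=> h0 r0 bu Xu xy; have [M M0 MP] := pmaxh_bound hA; have [i _ _] := MP h u h0 bu Xu.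
rewrite /pmaxh -(ItZ _ (i y)); apply: le_It; [exact: i|exact: (intgZ _ (i y))|move=> z].
rewrite mulrA; apply: ler_wpM2r => //; rewrite /poih mulrCA; apply: ler_wpM2l; first by rewrite invr_ge0 ltW.
apply: (le_trans (poi_pert _ ((y - z) / h))); apply: ler_wpM2r; first exact: poi_ge0.
apply: ler_wpM2l => //; rewrite lerD2l -mulrBl opprB addrA subrK.
rewrite -[leLHS]real_normK ?num_real// ler_sqr ?nnegrE// normrM normfV (gtr0_norm h0).
by rewrite ler_pdivrMr.
Qed.

End AlmostEverywhere.

(** * Values at the nodes *)

Section Nodes.
Variable R : realType.
Implicit Types (u v w : R -> R) (f g : R -> R[i]) (a b c h x y t C L : R).
Variables (xs : int -> R) (ga gb : R).
Hypothesis ga_gt0 : 0 < ga.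
Hypothesis gap : forall k : int, ga <= xs (k + 1) - xs k <= gb.

Lemma nodes_lb (k : int) (n : nat) : n%:R * ga <= xs (k + n%:Z) - xs k.
Proof.
elim: n => [|n IH]; first by rewrite addr0 subrr mul0r.
rewrite -addn1 natrD mulrDl mul1r PoszD addrA.
by have /andP[H _] := gap (k + n%:Z); lra.
Qed.

Lemma nodes_lt (k l : int) : k < l -> xs (k + 1) <= xs l.
Proof.
move=> kl; have [n En] : exists n : nat, l = k + 1 + n%:Z.
  have : 0 <= l - (k + 1) by rewrite subr_ge0 lezD1.
  by case E : (l - (k + 1)) => [n|//] _; exists n; rewrite -E addrC subrK.
have := nodes_lb (k + 1) n; rewrite -En => H.
by rewrite -subr_ge0 (le_trans _ H)// mulr_ge0// ltW.
Qed.

Lemma node_uniq (k l : int) y : xs k <= y < xs (k + 1) -> xs l <= y < xs (l + 1) -> k = l.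
Proof.
move=> /andP[k1 k2] /andP[l1 l2]; case: (ltgtP k l) => // /nodes_lt H.
  by have := le_lt_trans (le_trans H l1) k2; rewrite ltxx.
by have := le_lt_trans (le_trans H k1) l2; rewrite ltxx.
Qed.

Lemma node_exists y : exists k : int, xs k <= y < xs (k + 1).
Proof.
have [n nP] : exists n : nat, (xs 0 - y) / ga <= n%:R.
  by exists (Num.truncn ((xs 0 - y) / ga)).+1; apply: ltW; rewrite truncnS_gt.
have lo : xs (- n%:Z) <= y.
  have := nodes_lb (- n%:Z) n; rewrite addNr.
  by move: nP; rewrite ler_pdivrMr//; lra.
have [N NP] : exists N : nat, (y - xs (- n%:Z)) / ga < N%:R.
  by exists (Num.truncn ((y - xs (- n%:Z)) / ga)).+1; rewrite truncnS_gt.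
have hi : exists N : nat, y < xs (- n%:Z + N%:Z).
  exists N; have := nodes_lb (- n%:Z) N.
  by move: NP; rewrite ltr_pdivrMr//; lra.
(* The least N with y < xs (- n + N) is positive by [lo], and the cell sought is the one ending
   there. *)
case: (ex_minnP hi) => -[|m] hm mm; first by move: hm; rewrite addr0 ltNge lo.
exists (- n%:Z + m%:Z); apply/andP; split.
  by rewrite leNgt; apply/negP => /mm; rewrite ltnn.
by move: hm; rewrite -addn1 PoszD addrA.
Qed.

Lemma node_stepE f y (k : int) : xs k <= y < xs (k + 1) -> node_step xs f y = absc (f (xs k)).
Proof.
move=> ky; rewrite /node_step -(fsbig_widen [set k] [set: int])//=.
  by rewrite fsbig_set1 indicE mem_setE in_itv/= ky mulr1.
move=> l [_ /= lk]; rewrite indicE mem_setE in_itv/=.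
case: (boolP (_ <= _ < _)) => [ly|]; last by rewrite mulr0.
by exfalso; apply: lk; exact: node_uniq ly ky.
Qed.

Lemma node_step_ge0 f y : 0 <= node_step xs f y.
Proof. by have [k /node_stepE ->] := node_exists y; exact: absc_ge0. Qed.

Lemma borel_node_step f : borel (node_step xs f).
Proof.
pose F n y : R := \sum_(j < (2 * n).+1) absc (f (xs (j%:Z - n%:Z))) *
  \1_(`[xs (j%:Z - n%:Z), xs (j%:Z - n%:Z + 1)[) y.
have bF n : borel (F n).
  rewrite /F; elim: (2 * n).+1 => [|m IH].
    by under eq_fun do rewrite big_ord0; exact: borel_cst.
  under eq_fun do rewrite big_ord_recr.
  apply: borelD => //; apply: borelM; first exact: borel_cst.
  by apply: borel_indic; exact: measurable_itv.
apply/measurable_EFinP.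
apply: (@emeasurable_fun_cvg _ _ _ setT (fun n y => (F n y)%:E)) => [n|y _].
  by apply/measurable_EFinP; exact: bF.
have [k ky] := node_exists y.
rewrite [X in _ --> X](_ : _ = (absc (f (xs k)))%:E); last by rewrite -(node_stepE f ky).
apply: cvg_near_cst; exists `|k|%N => // n /= kn; congr EFin.
pose i := absz (k + n%:Z)%R.
have hj : (i < (2 * n).+1)%N by rewrite /i; lia.
rewrite /F (bigD1 (Ordinal hj))//=.
have -> : i%:Z - n%:Z = k by rewrite /i; lia.
rewrite indicE mem_setE in_itv/= ky mulr1 big1 ?addr0// => j jn.
rewrite indicE mem_setE in_itv/=; case: (boolP (_ <= _ < _)) => [ly|]; last by rewrite mulr0.
exfalso; have E := node_uniq ky ly; move: jn => /eqP; apply.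
by apply: val_inj => /=; rewrite /i E; lia.
Qed.

Lemma node_step_le f g C u : (forall k, absc (g (xs k)) <= absc (f (xs k)) + C * u (xs k)) ->
  forall y, exists k, [/\ xs k <= y, y - xs k <= gb & node_step xs g y <= node_step xs f y + C * u (xs k)].
Proof.
move=> H y; have [k ky] := node_exists y; have /andP[k1 k2] := ky.
have /andP[_ g2] := gap k; exists k; split=> //; first lra.
by rewrite !(node_stepE _ ky).
Qed.

Variable X : banach_lattice R.
Hypothesis hA : assumption_A X.
Local Notation nm u := (bl_norm X (ofreal u)).
Local Notation ns f := (ofreal (node_step xs f)).

Lemma xsnorm_fin f : (xsnorm X xs f < +oo)%E -> X (ns f) /\ xsnorm X xs f = (nm (node_step xs f))%:E.
Proof. by rewrite /xsnorm /xnorm; case: asboolP. Qed.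

Lemma xsnorm_in f : X (ns f) -> xsnorm X xs f = (nm (node_step xs f))%:E.
Proof. by move=> Xf; rewrite /xsnorm /xnorm asboolT. Qed.

Lemma xnorm_in f : X f -> xnorm X f = (bl_norm X f)%:E.
Proof. by move=> Xf; rewrite /xnorm asboolT. Qed.

Lemma nm0 : X (ofreal (fun=> 0)) /\ nm (fun=> 0) = 0.
Proof.
have X0 := bl_zero X; have E : ofreal (fun=> 0) = (fun=> 0) :> (R -> R[i]) by [].
split; first by rewrite E.
have := bl_norm_scale 0 X0; rewrite E.
rewrite (_ : (fun=> 0 * 0) = (fun=> 0)); last by apply/funext => x; rewrite mulr0.
by rewrite (_ : absc 0 = 0) ?mul0r// /absc ComplexField.Normc.normc0.
Qed.

Lemma node_step0 y : node_step xs (fun=> 0) y = 0.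
Proof. by have [k /node_stepE ->] := node_exists y; rewrite /absc ComplexField.Normc.normc0. Qed.

Lemma node_step_add f g : X (ns f) -> X (ns g) ->
  X (ns (f \+ g)) /\ nm (node_step xs (f \+ g)) <= nm (node_step xs f) + nm (node_step xs g).
Proof.
move=> Xf Xg; have [Xs ns_] := X_add Xf Xg.
have [Xr nr_] : X (ns (f \+ g)) /\ nm (node_step xs (f \+ g)) <= nm (fun y => node_step xs f y + node_step xs g y).
  apply: X_domr => //; first exact: borel_node_step.
  move=> y; rewrite ger0_norm ?node_step_ge0//.
  by have [k ky] := node_exists y; rewrite !(node_stepE _ ky) abscD.
by split=> //; exact: le_trans ns_.
Qed.

Lemma node_step_opp f : node_step xs (fun x => - f x) = node_step xs f.
Proof.
apply/funext => y; have [k ky] := node_exists y; rewrite !(node_stepE _ ky).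
by rewrite -mulN1r abscM (_ : absc (-1) = 1) ?mul1r// /absc /ComplexField.Normc.normc /= sqrrN expr1n oppr0 expr0n addr0 sqrtr1.
Qed.

End Nodes.

(** * Averages evaluated at the nodes *)

Section NodeBound.
Variables (R : realType) (X : banach_lattice R).
Hypothesis hA : assumption_A X.
Local Notation nm u := (bl_norm X (ofreal u)).

(** A cell has length at most rho h, so within it [pmaxh h v] changes by a factor of at most 2 (1 +
    rho^2), and its value at the node is dominated by its values on the whole cell. The constant is
    uniform in the nodes and in h. *)
Lemma node_bound (rho : R) : 0 <= rho -> exists2 M, 0 <= M &
  forall xs ga h f g C v, 0 < ga -> 0 < h ->
    (forall k : int, ga <= xs (k + 1) - xs k <= rho * h) ->
    X (ofreal (node_step xs f)) -> borel v -> X (ofreal v) -> 0 <= C ->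
    (forall k, absc (g (xs k)) <= absc (f (xs k)) + C * pmaxh h v (xs k)) ->
    X (ofreal (node_step xs g)) /\
    nm (node_step xs g) <= nm (node_step xs f) + C * M * nm v.
Proof.
move=> r0; have [M M0 MP] := pmaxh_bound hA.
exists (2 * (1 + rho ^+ 2) * M); first by rewrite !mulr_ge0// addr_ge0// sqr_ge0.
move=> xs ga h f g C v ga0 h0 gap Xf bv Xv C0 H.
have [_ Xp np] := MP h v h0 bv Xv.
have [Xp' np'] := X_scale (C * (2 * (1 + rho ^+ 2))) Xp.
have [Xs ns] := X_add Xf Xp'.
have K0 : 0 <= C * (2 * (1 + rho ^+ 2)) by rewrite !mulr_ge0// addr_ge0// sqr_ge0.
have [Xr nr_] : X (ofreal (node_step xs g)) /\ nm (node_step xs g) <=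
    nm (fun y => node_step xs f y + C * (2 * (1 + rho ^+ 2)) * pmaxh h v y).
  apply: X_domr => //; first exact: borel_node_step ga0 gap _.
  move=> y; rewrite ger0_norm; last exact: (node_step_ge0 ga0 gap).
  have [k [k1 k2 k3]] := node_step_le ga0 gap H y.
  have xk : `|xs k - y| <= rho * h by rewrite ler_norml; apply/andP; split; lra.
  apply: (le_trans k3); rewrite lerD2l -[leRHS]mulrA; apply: ler_wpM2l => //.
  exact: (pmaxh_near hA h0 r0 bv Xv xk).
split=> //; apply: (le_trans nr_); apply: (le_trans ns); rewrite lerD2l np' ger0_norm//.
have -> : C * (2 * (1 + rho ^+ 2) * M) * nm v = C * (2 * (1 + rho ^+ 2)) * (M * nm v) by ring.
exact: ler_wpM2l.
Qed.
End NodeBound.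

(** * Approximation by band-limited functions at scale h *)

Section ScaledRealization.
Variable R : realType.
Implicit Types (u v w : R -> R) (f g : R -> R[i]) (a b c h x y t C L : R).
Opaque convol.

Lemma nder_scale n (c : R) (F G : R -> R) : nder n F G ->
  nder n (fun x => F (c * x)) (fun x => c ^+ n * G (c * x)).
Proof.
elim: n F => [F ->|n IH F [F' d dn]]; first by apply/funext => x; rewrite expr0 mul1r.
have H := nder_Z c (IH _ dn); have d' := der_comp d (der_scale c).
exists (fun x => c * F' (c * x)); first exact: d'.
by move: H; congr nder; apply/funext => x; rewrite exprS mulrA.
Qed.

Variable X : banach_lattice R.
Hypothesis hA : assumption_A X.
Local Notation nm u := (bl_norm X (ofreal u)).

Lemma avg_dil h u x : 0 < h -> borel u -> X (ofreal u) ->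
  avg h u (h * x) = Av (fun t => u (h * t)) x /\
  avg h u (h * x + h / 2) = Ad (fun t => u (h * t)) x.
Proof.
move=> h0 bu Xu.
have E z : avg h u z = It (fun y => win h (z - h * y) * u (h * y)).
  by have := It_dilate h0 (intg_win h z bu Xu); rewrite /avg => ->.
have hw z : win h (h * z) = w2 z.
  rewrite /win /w2 !itvE; congr (nat_of_bool _)%:R.
  by rewrite -mulrN !ler_pM2l.
split; rewrite E; apply: eq_It => y; congr (_ * _); first by rewrite -mulrBr hw.
have -> : h * x + h / 2 - h * y = h * (x - y + 2^-1) by ring.
rewrite hw /w1 /w2 !itvE; congr (nat_of_bool _)%:R.
by apply/idP/idP => /andP[? ?]; apply/andP; split; lra.
Qed.

Lemma X_sub u v : X (ofreal u) -> X (ofreal v) ->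
  X (ofreal (fun x => u x - v x)) /\ nm (fun x => u x - v x) <= nm u + nm v.
Proof.
move=> Xu Xv; have [Xn nn] := X_scale (-1) Xv.
have [Xs ns] := X_add Xu Xn; move: Xs ns; rewrite nn normrN normr1 mul1r.
by under eq_fun do rewrite mulN1r.
Qed.

(** Translations need not act on X; the shifted average is dominated by a centred one over a window
    twice as long. *)
Lemma X_Dh h u : 0 < h -> borel u -> X (ofreal u) -> borel (Dh h u) /\ X (ofreal (Dh h u)).
Proof.
move=> h0 bu Xu; have [M M0 MP] := avg_bound hA.
have [Xa _] := X_abs bu Xu; have ba := borel_abs bu.
have [X2 _] := MP _ (2 * h) ba Xa (mulr_gt0 (ltr0n _ 2) h0).
have [X3 _] := X_scale 2 X2.
have bs : borel (fun x => avg h u (x + h / 2)).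
  apply: borel_comp; first exact: avg_borel.
  by apply: borelD; [exact: borel_id|exact: borel_cst].
split; first exact: borelB.
suff H x : `|avg h u (x + h / 2)| <= 2 * avg (2 * h) (fun t => `|u t|) x.
  by have [Xs _] := X_domr bs X3 H; have [] := X_sub Xu Xs.
apply: (@le_trans _ _ (avg h (fun t => `|u t|) (x + h / 2))).
  rewrite /avg normrM (gtr0_norm (_ : 0 < h^-1)) ?invr_gt0//; apply: ler_wpM2l.
    by rewrite invr_ge0 ltW.
  have iw := intg_win h (x + h / 2) bu Xu; have iwa := intg_win h (x + h / 2) ba Xa.
  apply: (It_norm (intg_borel iw) iwa) => y.
  by rewrite normrM (ger0_norm (win_ge0 _ _)).
have hx : `|x + h / 2 - x| <= h / 2.
  by rewrite addrAC subrr add0r ger0_norm// divr_ge0// ltW.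
exact: (avg_shift bu Xu h0 hx).
Qed.

Lemma X_iter_Dh h s u : 0 < h -> borel u -> X (ofreal u) ->
  borel (iter s (Dh h) u) /\ X (ofreal (iter s (Dh h) u)).
Proof. by move=> h0 bu Xu; elim: s => [//|s [b x]]; exact: X_Dh. Qed.

Lemma iter_Dd_dil h s u : 0 < h -> borel u -> X (ofreal u) ->
  iter s (@Dd R) (fun t => u (h * t)) = (fun x => iter s (Dh h) u (h * x)).
Proof.
move=> h0 bu Xu; elim: s => [//|s IH]; rewrite iterS IH.
have [bd Xd] := X_iter_Dh s h0 bu Xu; apply/funext => x.
by rewrite /Dd -(avg_dil x h0 bd Xd).2 iterS.
Qed.

Lemma X_IAh : exists2 M, 0 <= M & forall h r u, 0 < h -> borel u -> X (ofreal u) ->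
  [/\ borel (iter r (IAh h) u), X (ofreal (iter r (IAh h) u)) &
      nm (iter r (IAh h) u) <= M ^+ r * nm u].
Proof.
have [M M0 MP] := avg_bound hA; exists (1 + M) => [|h r u h0 bu Xu]; first exact: addr_ge0.
elim: r => [|r [b1 X1 n1]]; first by rewrite expr0 mul1r.
have [X2 n2] := MP _ _ b1 X1 h0; have [X3 n3] := X_sub X1 X2.
split; [by apply: borelB => //; exact: avg_borel|exact: X3|].
apply: (le_trans n3); apply: (le_trans (lerD (lexx _) n2)).
rewrite exprS -mulrA -[X in X + _]mul1r -mulrDl; apply: ler_wpM2l => //.
exact: addr_ge0.
Qed.

Lemma iter_IA_dil h r u : 0 < h -> borel u -> X (ofreal u) ->
  iter r (@IA R) (fun t => u (h * t)) = (fun x => iter r (IAh h) u (h * x)).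
Proof.
move=> h0 bu Xu; have [M _ MP] := X_IAh; elim: r => [//|r IH]; rewrite iterS IH.
have [bd Xd _] := MP h r u h0 bu Xu; apply/funext => x.
by rewrite /IA -(avg_dil x h0 bd Xd).1 iterS.
Qed.

Lemma avgB h u v : borel u -> X (ofreal u) -> borel v -> X (ofreal v) ->
  avg h (fun x => u x - v x) = (fun x => avg h u x - avg h v x).
Proof.
move=> bu Xu bv Xv; apply/funext => x; rewrite /avg -mulrBr; congr (_ * _).
rewrite -ItB; [|exact: (intg_win h x bu Xu)|exact: (intg_win h x bv Xv)].
by apply: eq_It => y; rewrite mulrBr.
Qed.

Lemma avgD h u v : borel u -> X (ofreal u) -> borel v -> X (ofreal v) ->
  avg h (fun x => u x + v x) = (fun x => avg h u x + avg h v x).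
Proof.
move=> bu Xu bv Xv; apply/funext => x; rewrite /avg -mulrDr; congr (_ * _).
rewrite -ItD; [|exact: (intg_win h x bu Xu)|exact: (intg_win h x bv Xv)].
by apply: eq_It => y; rewrite mulrDr.
Qed.

Lemma iter_IAB h r u v : 0 < h -> borel u -> X (ofreal u) -> borel v -> X (ofreal v) ->
  iter r (IAh h) (fun x => u x - v x) = (fun x => iter r (IAh h) u x - iter r (IAh h) v x).
Proof.
move=> h0 bu Xu bv Xv; have [M _ MP] := X_IAh; elim: r => [//|r IH]; rewrite iterS IH.
have [b1 X1 _] := MP h r u h0 bu Xu; have [b2 X2 _] := MP h r v h0 bv Xv.
apply/funext => x; rewrite /= /IAh avgB//.
by move: (avg h _ x) (avg h _ x) (iter r _ u x) (iter r _ v x) => a1 a2 a3 a4; ring.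
Qed.

(** [v] is P u in the expansion (I - A)^r = I - A P. The outer average A is what later allows an
    evaluation at the nodes. *)
Lemma IAh_expand r : exists2 C, 0 <= C & forall h u, 0 < h -> borel u -> X (ofreal u) ->
  exists v, [/\ borel v, X (ofreal v), nm v <= C * nm u &
    forall x, iter r (IAh h) u x = u x - avg h v x].
Proof.
have [M M0 MP] := X_IAh; elim: r => [|r [C C0 CP]].
  exists 0 => // h u h0 bu Xu; have [X0 n0] := X_scale 0 Xu.
  exists (fun x => 0 * u x); split.
  - by apply: borelM => //; exact: borel_cst.
  - exact: X0.
  - by rewrite n0 normr0.
  - move=> x; by rewrite (avgZ _ _ bu Xu) mul0r subr0.
exists (C + M ^+ r) => [|h u h0 bu Xu]; first by rewrite addr_ge0// exprn_ge0.
have [v [bv Xv nv E]] := CP h u h0 bu Xu; have [b1 X1 n1] := MP h r u h0 bu Xu.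
have [Xs ns] := X_add Xv X1.
exists (fun x => v x + iter r (IAh h) u x); split=> //; first exact: borelD.
  by apply: (le_trans ns); rewrite mulrDl; exact: lerD.
move=> x; rewrite iterS {1}/IAh avgD// E.
by move: (avg h v x) (avg h _ x) => a1 a2; rewrite opprD addrA.
Qed.

Variable gamma : R.
Hypothesis gamma_gt0 : 0 < gamma.
Definition qg x : R := bumpR (2 / gamma * x).
Lemma qg_csmth : csmth gamma qg.
Proof.
have g2 : 0 < 2 / gamma by rewrite divr_gt0.
have := csmth_bump_scale g2; rewrite (_ : 2 / (2 / gamma) = gamma)//.
by field; rewrite gt_eqF.
Qed.
Lemma qg_ge0 x : 0 <= qg x. Proof. exact: bump_ge0. Qed.
Lemma qg_one x : `|x| <= gamma / 2 -> qg x = 1.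
Proof.
have g2 : 0 < 2 / gamma by rewrite divr_gt0.
move=> xg; rewrite /qg bump1// normrM (gtr0_norm g2) mulrAC ler_pdivrMr// mul1r.
by rewrite mulrC -ler_pdivlMr.
Qed.
Lemma qg_B0 n : B0 (fun x => x ^+ n * qg x).
Proof.
have := csmth_B0 (csmth_M qg_csmth (@smooth_exp R n)).
by apply: B0_ext => x; rewrite mulrC.
Qed.

(** Dilations need not be bounded on X, so the passage to scale h transports the pointwise bounds of
    [realization]; norms are taken only afterwards. Membership of g in X also comes from the bound
    on u - g. *)
Theorem scaled_realization (r s : nat) : (s <= 2 * r)%N -> exists2 C, 0 <= C &
  forall h u, 0 < h -> borel u -> X (ofreal u) ->
  let d := iter s (Dh h) u in
  exists w (g gs : R -> R), [/\ tame w, g = (fun x => J qg w (x / h)),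
    (borel g /\ X (ofreal g)) /\ (forall x, `|u x - g x| <= C * (`|d x| + pmaxh h d x)),
    (nder s g gs /\ borel gs) /\ (forall x, `|gs x| <= C * (h ^- s * pmaxh h d x)) &
    forall x, `|iter r (IAh h) g x| <= C * pmaxh h d x].
Proof.
move=> sr; have [W [C [oW C0 H]]] := realization gamma_gt0 qg_ge0 qg_one qg_B0 sr.
exists C => // h u h0 bu Xu d; have hn : h != 0 by rewrite gt_eqF.
have [bd Xd] := X_iter_Dh s h0 bu Xu; rewrite -/d in bd Xd.
have [M M0 MP] := pmaxh_bound hA.
pose ud t := u (h * t).
have bdil v : borel v -> borel (fun t => v (h * t)).
  by move=> bv; apply: borel_comp => //; apply: borelM; [exact: borel_cst|exact: borel_id].
have dE v x : borel v -> X (ofreal v) -> intg (fun y => poi (x - y) * `|v (h * y)|) /\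
    It (fun y => poi (x - y) * `|v (h * y)|) = pmaxh h v (h * x).
  move=> bv Xv; have [i _ _] := MP h v h0 bv Xv.
  have i1 := intg_dilate h0 (i (h * x)); have e1 := It_dilate h0 (i (h * x)).
  have E : (fun y => poi (x - y) * `|v (h * y)|) = (fun y => h * (poih h (h * x - h * y) * `|v (h * y)|)).
    apply/funext => y; rewrite /poih -mulrBr [h * (x - y)]mulrC mulfK//.
    by move: (poi _) `|_| => A B; field.
  by rewrite E; split; [exact: intgZ|rewrite ItZ// e1 mulrA mulfV// mul1r].
have tud : tame ud.
  split; first exact: bdil.
  apply: (intg_le _ (dE u 0 bu Xu).1) => [|y]; first by apply: borelM; [exact: bdil|exact: borel_poi].
  by rewrite normrM (ger0_norm (poi_ge0 y)) sub0r poiN mulrC.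
have := H ud tud; rewrite /= (iter_Dd_dil s h0 bu Xu) -/d.
set gt_ := J qg (W ud) => -[H1 [gs [dgs bgs] H2] H3].
have pmE x : pmax (fun x => d (h * x)) x = pmaxh h d (h * x) := (dE d x bd Xd).2.
pose g x := gt_ (x / h).
have kg : tame gt_ by apply: opc_tame (opk_opc (opk_J gamma_gt0 qg_ge0 qg_one qg_B0)) _; exact: opc_tame.
have bg : borel g.
  by apply: (@borel_comp _ gt_); [exact: kg.1|apply: borelM; [exact: borel_id|exact: borel_cst]].
have b1 x : `|u x - g x| <= C * (`|d x| + pmaxh h d x).
  have := H1 (x / h); rewrite /ud pmE; have -> : h * (x / h) = x by rewrite mulrC divfK.
  exact.
have [Xda nda] := X_abs bd Xd; have [_ Xp np] := MP h d h0 bd Xd.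
have [Xs _] := X_add Xda Xp; have [Xs' _] := X_scale C Xs.
have Xg : X (ofreal g).
  have [Xe _] := X_domr (borelB bu bg) Xs' b1; have [] := X_sub Xu Xe.
  by under eq_fun do rewrite subKr.
exists (W ud), g, (fun x => h^-1 ^+ s * gs (h^-1 * x)); split => //.
- exact: opc_tame.
- split; first split.
    have -> : g = (fun x => gt_ (h^-1 * x)) by apply/funext => x; rewrite /g [h^-1 * x]mulrC.
    exact: (nder_scale h^-1 dgs).
    apply: borelM; first exact: borel_cst.
    by apply: borel_comp => //; apply: borelM; [exact: borel_cst|exact: borel_id].
  move=> x; rewrite normrM exprVn (gtr0_norm (_ : 0 < h ^- s)) ?invr_gt0 ?exprn_gt0//.
  rewrite mulrCA; apply: ler_wpM2l; first by rewrite invr_ge0 exprn_ge0// ltW.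
  have := H2 (h^-1 * x); rewrite pmE; have -> : h * (h^-1 * x) = x by rewrite mulrA mulfV// mul1r.
  exact.
- move=> x; have := H3 (x / h); rewrite pmE; have -> : h * (x / h) = x by rewrite mulrC divfK.
  suff -> : iter r (@IA R) gt_ (x / h) = iter r (IAh h) g x by [].
  have -> : gt_ = (fun t => g (h * t)).
    by apply/funext => t; rewrite /g [h * t]mulrC mulfK.
  by rewrite (iter_IA_dil r h0 bg Xg) [h * _]mulrC divfK.
Qed.
End ScaledRealization.

(** * Band-limited functions in X *)

Section Assembly.
Variables (R : realType) (X : banach_lattice R).
Hypothesis hA : assumption_A X.
Implicit Types (u v w : R -> R) (f g p : R -> R[i]) (a b c h x y t C L sigma : R) (xs : int -> R).
Local Notation mu := (@Defs.mu R).
Local Notation nm u := (bl_norm X (ofreal u)).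
Local Notation ns xs f := (ofreal (node_step xs f)).

Lemma absc1 : absc (-1 : R[i]) = 1.
Proof. by rewrite /absc /ComplexField.Normc.normc /= sqrrN expr1n oppr0 expr0n addr0 sqrtr1. Qed.

Lemma X_opp f : X f -> X (fun x => - f x) /\ bl_norm X (fun x => - f x) = bl_norm X f.
Proof.
move=> Xf; have E : (fun x => - f x) = (fun x => -1 * f x) by apply/funext => x; rewrite mulN1r.
by rewrite E; split; [exact: bl_scale|rewrite bl_norm_scale// absc1 mul1r].
Qed.

Lemma X_minus f g : X f -> X g -> X (f \- g) /\ bl_norm X (f \- g) <= bl_norm X f + bl_norm X g.
Proof.
move=> Xf Xg; have [Xn nn] := X_opp Xg.
by rewrite -[f \- g]/(f \+ (fun x => - g x)) -nn; split; [exact: bl_add|exact: bl_norm_add].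
Qed.

Lemma pmaxh_mono h u v x : 0 < h -> borel u -> X (ofreal u) -> borel v -> X (ofreal v) ->
  (forall y, `|u y| <= v y) -> pmaxh h u x <= pmaxh h v x.
Proof.
move=> h0 bu Xu bv Xv uv; have [M M0 MP] := pmaxh_bound hA.
have [i1 _ _] := MP h u h0 bu Xu; have [i2 _ _] := MP h v h0 bv Xv.
apply: le_It => [//|//|y]; apply: ler_wpM2l; first exact: poih_ge0.
by apply: (le_trans (uv y)); exact: ler_norm.
Qed.

Lemma cx_parts f : cx (refun f) (imfun f) = f.
Proof. by apply/funext => x; rewrite /cx /refun /imfun; case: (f x). Qed.

Lemma bandlimited_parts sigma p : bandlimited X sigma p ->
  [/\ borel (refun p), borel (imfun p), X (ofreal (refun p)), X (ofreal (imfun p)) &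
   nm (refun p) <= bl_norm X p /\ nm (imfun p) <= bl_norm X p].
Proof.
move=> [Xp [[c1 c2] _]]; have b1 := borel_cont c1; have b2 := borel_cont c2.
have := X_parts b1 b2; rewrite cx_parts => /(_ X Xp)[X1 X2 n1 n2].
by split.
Qed.

Lemma sum_widen (s : nat -> R) (n k : nat) : (forall m, 0 <= s m) ->
  \sum_(m < n) s m <= \sum_(m < (n + k)%N) s m.
Proof.
move=> s0; elim: k => [|k IH]; first by rewrite addn0.
by rewrite addnS big_ord_recr /= (le_trans IH)// lerDl.
Qed.

Lemma sum2_widen (s : nat -> nat -> R) (n k : nat) : (forall m j, 0 <= s m j) ->
  \sum_(m < n) \sum_(j < n) s m j <= \sum_(m < (n + k)%N) \sum_(j < (n + k)%N) s m j.
Proof.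
move=> s0; apply: (@le_trans _ _ (\sum_(m < n) \sum_(j < (n + k)%N) s m j)).
  by apply: ler_sum => m _; exact: sum_widen.
apply: (@sum_widen (fun m => \sum_(j < (n + k)%N) s m j)) => m.
by apply: sumr_ge0 => j _.
Qed.

Lemma tempered_sub T1 T2 : @tempered_distribution R T1 -> tempered_distribution T2 ->
  tempered_distribution (fun p => T1 p - T2 p).
Proof.
move=> [l1 [C1 [N1 B1]]] [l2 [C2 [N2 B2]]]; split.
  by move=> c p q sp sq; rewrite l1// l2//; move: (T1 p) (T1 q) (T2 p) (T2 q) => a1 a2 a3 a4; ring.
exists (`|C1| + `|C2|), (N1 + N2)%N => p sp.
have s0 m n := schwartz_seminorm_ge0 m n sp.
pose S n := \sum_(m < n) \sum_(j < n) schwartz_seminorm m j p.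
have S0 n : 0 <= S n by apply: sumr_ge0 => m _; apply: sumr_ge0 => j _.
have H1 : S N1 <= S (N1 + N2)%N by exact: (sum2_widen N1 N2 s0).
have H2 : S N2 <= S (N1 + N2)%N by rewrite addnC; exact: (sum2_widen N2 N1 s0).
rewrite mulrDl -[T1 p - T2 p]/(T1 p + - T2 p); apply: (le_trans (abscD _ _)).
apply: lerD.
  apply: (le_trans (B1 p sp)); apply: (@le_trans _ _ (`|C1| * S N1)).
    by rewrite ler_wpM2r ?ler_norm//; exact: S0.
  by apply: ler_wpM2l.
rewrite -mulN1r abscM absc1 mul1r.
apply: (le_trans (B2 p sp)); apply: (@le_trans _ _ (`|C2| * S N2)).
  by rewrite ler_wpM2r ?ler_norm//; exact: S0.
by apply: ler_wpM2l.
Qed.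

Lemma bandlimited_sub sigma p q : bandlimited X sigma p -> bandlimited X sigma q ->
  bandlimited X sigma (p \- q).
Proof.
move=> bp bq; have [b1 b2 X1 X2 _] := bandlimited_parts bp.
have [b3 b4 X3 X4 _] := bandlimited_parts bq.
have t1 := X_tame hA b1 X1; have t2 := X_tame hA b2 X2.
have t3 := X_tame hA b3 X3; have t4 := X_tame hA b4 X4.
case: bp => Xp [[c1 c2] [T1 [tp1 r1 s1]]]; case: bq => Xq [[c3 c4] [T2 [tp2 r2 s2]]].
split; first by have [] := X_minus Xp Xq.
have ER : refun (p \- q) = (fun x => refun p x - refun q x).
  by apply/funext => x; rewrite /refun /=; case: (p x) (q x) => ? ? [].
have EI : imfun (p \- q) = (fun x => imfun p x - imfun q x).
  by apply/funext => x; rewrite /imfun /=; case: (p x) (q x) => ? ? [].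
split.
  split; rewrite ?ER ?EI => x; apply: cvgB; [exact: c1|exact: c3|exact: c2|exact: c4].
exists (fun f => T1 f - T2 f); split; first exact: tempered_sub.
- move=> f tf; rewrite r1// r2//; have [a [ca cb]] := test_parts tf.
  have k1 := intg_csmth ca; have k2 := intg_csmth cb.
  have I3 F : tame (refun F) -> tame (imfun F) -> cintegral setT (fun x => F x * f x) =
      (It (fun x => refun F x * refun f x) - It (fun x => imfun F x * imfun f x)) +i*
      (It (fun x => refun F x * imfun f x) + It (fun x => imfun F x * refun f x)).
    move=> tF1 tF2.
    by have := cintegral_split (k1 _ tF1) (k2 _ tF1) (k1 _ tF2) (k2 _ tF2); rewrite cx_parts.
  have t13 := tameB t1 t3; have t24 := tameB t2 t4.
  rewrite (I3 p t1 t2) (I3 q t3 t4) (I3 (p \- q)) ?ER ?EI//.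
  have D u v (k : R -> R) : intg (fun x => u x * k x) -> intg (fun x => v x * k x) ->
      It (fun x => (u x - v x) * k x) = It (fun x => u x * k x) - It (fun x => v x * k x).
    by move=> i1 i2; rewrite -ItB//; apply: eq_It => x; rewrite mulrBl.
  rewrite (D _ _ _ (k1 _ t1) (k1 _ t3)) (D _ _ _ (k2 _ t1) (k2 _ t3)).
  rewrite (D _ _ _ (k1 _ t2) (k1 _ t4)) (D _ _ _ (k2 _ t2) (k2 _ t4)).
  by apply/eqP; rewrite eq_complex /=; apply/andP; split; apply/eqP; ring.
- by move=> f tf df; rewrite s1// s2// subrr.
Qed.

(** The reproducing formula dominates the values of p by averages of p at scale 1 / (2 sigma); then
    [node_bound] is applied with 0 as the function f. *)
Lemma bandlimited_node_bound (gamma' : R) : 0 < gamma' -> exists2 C, 0 <= C &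
  forall sigma xs ga p, 1 <= sigma -> 0 < ga ->
    (forall k : int, ga <= xs (k + 1) - xs k <= gamma' / sigma) -> bandlimited X sigma p ->
    X (ns xs p) /\ nm (node_step xs p) <= C * bl_norm X p.
Proof.
(* Measured in units of 1 / (2 sigma), a cell has length at most 2 gamma', which is the value of
   rho. *)
move=> g0; have g2 : 0 <= 2 * gamma' by rewrite mulr_ge0// ltW.
have [M M0 MP] := node_bound hA g2.
have cb : csmth 2 (@bumpR R) by split; [exact: smooth_bump|exact: bump0].
have [K kK] := csmth_FC cb; have K0 := kern_ge0 kK.
pose D := K / (2 * c0 R); have D0 : 0 <= D by rewrite divr_ge0// mulr_ge0// ltW// c0_gt0.
have DM : 0 <= 2 * D * M by apply: mulr_ge0 => //; apply: mulr_ge0.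
exists (2 * D * M * 2) => [|sigma xs ga p s1 ga0 gap bp]; first by apply: mulr_ge0.
have s0 : 0 < sigma by lra.
have h0 : 0 < (2 * sigma)^-1 by rewrite invr_gt0 mulr_gt0.
have [b1 b2 X1 X2 [n1 n2]] := bandlimited_parts bp.
have t1 := X_tame hA b1 X1; have t2 := X_tame hA b2 X2.
have Xp : X p by case: bp.
have [Xa1 na1] := X_abs b1 X1; have [Xa2 na2] := X_abs b2 X2.
have ba1 := borel_abs b1; have ba2 := borel_abs b2.
pose V x := `|refun p x| + `|imfun p x|.
have [XV nV] : X (ofreal V) /\ nm V <= nm (fun x => `|refun p x|) + nm (fun x => `|imfun p x|) := X_add Xa1 Xa2.
have bV : borel V by exact: borelD.
have gap' (k : int) : ga <= xs (k + 1) - xs k <= 2 * gamma' * (2 * sigma)^-1.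
  have -> : 2 * gamma' * (2 * sigma)^-1 = gamma' / sigma by field; rewrite gt_eqF.
  exact: gap.
have E0 : node_step xs (fun=> 0 : R[i]) = (fun=> 0).
  by apply/funext => y; exact: (node_step0 ga0 gap).
have [X00 n00] := nm0 X.
have key (k : int) : absc (p (xs k)) <= absc (0 : R[i]) + 2 * D * pmaxh (2 * sigma)^-1 V (xs k).
  rewrite /absc ComplexField.Normc.normc0 add0r -/(absc (p (xs k))).
  apply: (le_trans (absc_le _)); rewrite -/(refun p (xs k)) -/(imfun p (xs k)).
  have [m1 m2] : `|refun p (xs k)| <= D * pmaxh (2 * sigma)^-1 (refun p) (xs k) /\
      `|imfun p (xs k)| <= D * pmaxh (2 * sigma)^-1 (imfun p) (xs k).
    case: bp => _ [[c1 c2] [T [tp rp sp]]].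
    have rp' : represents T (cx (refun p) (imfun p)) by rewrite cx_parts.
    exact: (bandlimited_maximal tp rp' sp s0 t1 t2 c1 c2 (xs k) kK).
  have q1 : pmaxh (2 * sigma)^-1 (refun p) (xs k) <= pmaxh (2 * sigma)^-1 V (xs k).
    by apply: pmaxh_mono => // y; rewrite /V lerDl.
  have q2 : pmaxh (2 * sigma)^-1 (imfun p) (xs k) <= pmaxh (2 * sigma)^-1 V (xs k).
    by apply: pmaxh_mono => // y; rewrite /V lerDr.
  have q1' := ler_wpM2l D0 q1; have q2' := ler_wpM2l D0 q2.
  have -> : 2 * D * pmaxh (2 * sigma)^-1 V (xs k) = D * pmaxh (2 * sigma)^-1 V (xs k) + D * pmaxh (2 * sigma)^-1 V (xs k).
    by move: (pmaxh _ V _) => z; ring.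
  by apply: lerD; [exact: le_trans m1 q1'|exact: le_trans m2 q2'].
have DD : 0 <= 2 * D by rewrite mulr_ge0.
have := MP xs ga _ (fun=> 0) p (2 * D) V ga0 h0 gap'; rewrite E0 => /(_ X00 bV XV DD key)[XN nN].
split=> //; apply: (le_trans nN); rewrite n00 add0r -[leRHS]mulrA; apply: ler_wpM2l => //.
by apply: (le_trans nV); rewrite mulr2n mulrDl mul1r; apply: lerD; [exact: le_trans na1 n1|exact: le_trans na2 n2].
Qed.

End Assembly.

(** * The decomposition of f *)

Section Decomposition.
Variables (R : realType) (X : banach_lattice R).
Hypothesis hA : assumption_A X.
Implicit Types (u v w : R -> R) (f g p : R -> R[i]) (a b c h x y t C L sigma : R) (xs : int -> R).
Local Notation mu := (@Defs.mu R).
Local Notation nm u := (bl_norm X (ofreal u)).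
Local Notation ns xs f := (ofreal (node_step xs f)).

(** The last estimate concerns u - g - (I - A)^r u, which is a combination of averages although u -
    g is not. The function [v] collects everything that these averages act on. *)
Lemma component_bound (gamma : R) (r s : nat) : 0 < gamma -> (s <= 2 * r)%N -> exists2 C, 0 <= C &
  forall h u, 0 < h -> borel u -> X (ofreal u) -> let d := iter s (Dh h) u in
  exists w (g gs v : R -> R), [/\ tame w /\ g = (fun x => J (qg gamma) w (x / h)),
    borel g /\ X (ofreal g),
    [/\ nder s g gs, borel gs, X (ofreal gs) & nm gs <= C * (h ^- s * nm d)],
    nm (fun x => u x - g x) <= C * nm d &
    [/\ borel v, X (ofreal v), nm v <= C * nm d &
      forall x, `|u x - g x - iter r (IAh h) u x| <= C * pmaxh h v x]].
Proof.
move=> g0 sr; have [C C0 CP] := scaled_realization hA g0 sr.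
have [M M0 MP] := pmaxh_bound hA; have [K K0 KP] := IAh_expand hA r.
pose E := C * (1 + M); have E0 : 0 <= E by rewrite mulr_ge0// addr_ge0.
pose Z := E + C * M + (K * E + 1) + (2 + C).
have EZ : E <= Z by rewrite /Z; have := mulr_ge0 C0 M0; have := mulr_ge0 K0 E0; lra.
have CMZ : C * M <= Z by rewrite /Z; have := mulr_ge0 C0 M0; have := mulr_ge0 K0 E0; lra.
have KEZ : K * E + 1 <= Z by rewrite /Z; have := mulr_ge0 C0 M0; have := mulr_ge0 K0 E0; lra.
have CZ : 2 + C <= Z by rewrite /Z; have := mulr_ge0 C0 M0; have := mulr_ge0 K0 E0; lra.
have Z0 : 0 <= Z by exact: le_trans E0 EZ.
exists Z => // h u h0 bu Xu d.
have [w [g [gs [tw gE [[bg Xg] b1] [[dgs bgs] b2] b3]]]] := CP h u h0 bu Xu.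
rewrite -/d in b1 b2 b3.
have [bd Xd] := X_iter_Dh hA s h0 bu Xu; rewrite -/d in bd Xd.
have [Xa na] := X_abs bd Xd; have ba := borel_abs bd.
have [_ Xp np] := MP h d h0 bd Xd.
have n0 : 0 <= nm d by exact: bl_norm_ge0.
have p0 x : 0 <= pmaxh h d x.
  by apply: It_ge0 => y; apply: mulr_ge0 => //; exact: poih_ge0.
pose e x := u x - g x; have be : borel e by exact: borelB.
have [Xe ne] : X (ofreal e) /\ nm e <= E * nm d.
  have [Xs ns_] := X_add Xa Xp; have [Xc nc] := X_scale C Xs.
  have [Xe ne] := X_domr be Xc b1; split=> //.
  apply: (le_trans ne); rewrite nc ger0_norm// /E -mulrA; apply: ler_wpM2l => //.
  by apply: (le_trans ns_); rewrite mulrDl mul1r; exact: lerD.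
have hs0 : 0 <= h ^- s by rewrite invr_ge0 exprn_ge0// ltW.
have [Xgs ngs] : X (ofreal gs) /\ nm gs <= Z * (h ^- s * nm d).
  have [X1 n1] := X_scale (h ^- s) Xp; have [X2 n2] := X_scale C X1.
  have [X3 n3] := X_domr bgs X2 b2; split=> //.
  apply: (le_trans n3); rewrite n2 n1 ger0_norm// ger0_norm// mulrCA [Z * _]mulrCA.
  apply: ler_wpM2l => //; apply: (le_trans (ler_wpM2l C0 np)); rewrite mulrA.
  by apply: ler_wpM2r.
have [v0 [bv0 Xv0 nv0 vE]] := KP h e h0 be Xe.
have [Xav nav] := X_abs bv0 Xv0; have bav := borel_abs bv0.
have [XV nV] : X (ofreal (fun x => `|v0 x| + `|d x|)) /\
  nm (fun x => `|v0 x| + `|d x|) <= nm (fun x => `|v0 x|) + nm (fun x => `|d x|) := X_add Xav Xa.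
have bV : borel (fun x => `|v0 x| + `|d x|) by exact: borelD.
exists w, g, gs, (fun x => `|v0 x| + `|d x|); split=> //.
  by apply: (le_trans ne); apply: ler_wpM2r.
split=> //.
  apply: (le_trans nV); apply: (le_trans (lerD nav na)).
  apply: (le_trans (lerD (le_trans nv0 (ler_wpM2l K0 ne)) (lexx _))).
  by rewrite mulrA -[X in _ + X]mul1r -mulrDl; apply: ler_wpM2r.
move=> x.
have IE := congr1 (fun F => F x) (iter_IAB hA r h0 bu Xu bg Xg); cbv beta in IE.
(* With e = u - g, expand (I - A)^r e once by linearity and once as e - A v0. *)
have -> : u x - g x - iter r (IAh h) u x = avg h v0 x - iter r (IAh h) g x.
  have := vE x; rewrite -/(e x) IE.
  by move: (iter r _ u x) (iter r _ g x) (avg _ _ _) => y1 y2 y3 H; rewrite /e -/(u x) in H *; lra.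
apply: (le_trans (ler_normB _ _)).
have q1 : pmaxh h v0 x <= pmaxh h (fun x => `|v0 x| + `|d x|) x.
  by apply: (pmaxh_mono hA) => // y; rewrite lerDl.
have q2 : pmaxh h d x <= pmaxh h (fun x => `|v0 x| + `|d x|) x.
  by apply: (pmaxh_mono hA) => // y; rewrite lerDr.
have a1 := avg_pmaxh hA x h0 bv0 Xv0.
have P0 := le_trans (p0 x) q2.
apply: (@le_trans _ _ ((2 + C) * pmaxh h (fun x => `|v0 x| + `|d x|) x)); last exact: ler_wpM2r.
rewrite mulrDl; apply: lerD.
  by apply: (le_trans a1); exact: ler_wpM2l.
by apply: (le_trans (b3 x)); exact: ler_wpM2l.
Qed.

(** Real and imaginary parts of a Borel version are approximated separately. The two memberships
    assumed of D and E say that the right-hand side of the claim is finite. *)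
Lemma decomposition (gamma gamma' : R) (r s : nat) : 0 < gamma -> 0 < gamma' -> (s <= 2 * r)%N ->
  exists2 C, 0 <= C & forall sigma xs f, 1 <= sigma ->
    (forall k : int, gamma / sigma <= xs (k + 1) - xs k <= gamma' / sigma) -> X f ->
    let D := id_minus_pow (steklov_dot (gamma / sigma)) s f in
    let E := id_minus_pow (steklov (gamma / sigma)) r f in
    X D -> X (ns xs E) ->
    exists g, [/\ bandlimited X sigma g,
      bl_norm X (f \- g) <= C * bl_norm X D,
      X (cderiv s g) /\ bl_norm X (cderiv s g) <= C * sigma ^+ s * bl_norm X D &
      X (ns xs (f \- g)) /\ nm (node_step xs (f \- g)) <= C * (bl_norm X D + nm (node_step xs E))].
Proof.
move=> g0 g'0 sr; have [C C0 CP] := component_bound g0 sr.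
have rho0 : 0 <= gamma' / gamma by rewrite divr_ge0// ltW.
have [M M0 MP] := node_bound hA rho0.
(* [K1] is for f - g, with 2 for the real and imaginary parts; [K2] is for the derivative, where
   h^-s = gamma^-s sigma^s; [K3] is for the averages at the nodes. *)
pose K1 := 2 * C; pose K2 := 2 * C * gamma ^- s; pose K3 := 2 * C * M * K1.
have gs0 : 0 <= gamma ^- s by rewrite invr_ge0 exprn_ge0// ltW.
have K10 : 0 <= K1 by exact: mulr_ge0.
have K20 : 0 <= K2 by exact: mulr_ge0.
have CM0 : 0 <= 2 * C * M by apply: mulr_ge0.
have K30 : 0 <= K3 by exact: mulr_ge0.
exists (K1 + K2 + K3 + 1) => [|sigma xs f s1 gap Xf D E XD XE]; first by rewrite !addr_ge0.
have s0 : 0 < sigma by lra.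
set h := gamma / sigma in D E XD XE *.
have h0 : 0 < h by exact: divr_gt0.
have [u [v [bu bv ae Xc nc]]] := borel_version Xf.
have [Xu Xv nu nv] := X_parts bu bv Xc.
have [w1 [g1 [gs1 [v1 [[tw1 e1] [bg1 Xg1] [ng1 bs1 Xs1 ns1] ne1 [bv1 Xv1 nv1 H1]]]]]] := CP h u h0 bu Xu.
have [w2 [g2 [gs2 [v2 [[tw2 e2] [bg2 Xg2] [ng2 bs2 Xs2 ns2] ne2 [bv2 Xv2 nv2 H2]]]]]] := CP h v h0 bv Xv.
set d1 := iter s (Dh h) u in ns1 ne1 nv1; set d2 := iter s (Dh h) v in ns2 ne2 nv2.
have [bd1 Xd1] := X_iter_Dh hA s h0 bu Xu; have [bd2 Xd2] := X_iter_Dh hA s h0 bv Xv.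
have [XDc nD] := X_ae (cmeas_cx bd1 bd2) XD (id_minus_dot_ae h s ae).
have [_ _ nd1 nd2] := X_parts bd1 bd2 XDc.
have {}nd1 : nm d1 <= bl_norm X D := le_trans nd1 nD.
have {}nd2 : nm d2 <= bl_norm X D := le_trans nd2 nD.
have D0 : 0 <= bl_norm X D by exact: bl_norm_ge0.
have two (k1 k2 : R) : k1 <= C * nm d1 -> k2 <= C * nm d2 -> k1 + k2 <= K1 * bl_norm X D.
  move=> a1 a2; rewrite /K1 -mulrA mulr2n mulrDl mul1r; apply: lerD.
    by apply: (le_trans a1); exact: ler_wpM2l.
  by apply: (le_trans a2); exact: ler_wpM2l.
have [Xg ng] := X_cx Xg1 Xg2.
exists (cx g1 g2).
have [Xfg _] := X_minus Xf Xg.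
split.
- have gs : gamma / h = sigma by rewrite /h; field; rewrite !gt_eqF.
  have cg (g w : R -> R) : tame w -> g = (fun x => J (qg gamma) w (x / h)) -> continuous g.
    move=> tw ->.
    have dJ := der_J g0 (@qg_ge0 R gamma) (qg_one g0) (qg_B0 g0) tw.
    have -> : (fun x => J (qg gamma) w (x / h)) = (fun x => J (qg gamma) w (h^-1 * x)).
      by apply/funext => x; rewrite [h^-1 * x]mulrC.
    exact: (der_cont (der_comp dJ (der_scale h^-1))).
  have tg1 := X_tame hA bg1 Xg1; have tg2 := X_tame hA bg2 Xg2.
  apply: (bandlimited_criterion tg1 tg2) => //; [exact: cg e1|exact: cg e2|move=> a phi cp p0].
  have p0' x : `|x| <= gamma / h -> phi x = 0 by rewrite gs; exact: p0.
  have orth (w g : R -> R) : tame w -> g = (fun x => J (qg gamma) w (x / h)) -> tame g ->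
      It (fun x => g x * FC phi x) = 0 /\ It (fun x => g x * FS phi x) = 0.
    move=> tw -> tg.
    exact: (dilate_orthogonal g0 (@qg_ge0 R gamma) (qg_one g0) (qg_B0 g0) (qg_csmth g0).2 h0 cp p0' tw tg).
  by have [z1 z2] := orth _ _ tw1 e1 tg1; have [z3 z4] := orth _ _ tw2 e2 tg2.
- have [Xe1 _] := X_sub Xu Xg1; have [Xe2 _] := X_sub Xv Xg2; have [Xe ne] := X_cx Xe1 Xe2.
  have ae' : {ae mu, forall x, absc ((f \- cx g1 g2) x) <= absc (cx (fun x => u x - g1 x) (fun x => v x - g2 x) x)}.
    by apply: filterS ae => x fx /=; rewrite fx.
  have [_ n1] := bl_ideal (bl_measurable Xfg) Xe ae'.
  apply: (le_trans n1); apply: (le_trans ne); apply: (le_trans (two _ _ ne1 ne2)).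
  apply: ler_wpM2r => //; lra.
- have -> : cderiv s (cx g1 g2) = cx gs1 gs2.
    apply/funext => x; rewrite cderivE; congr (_ +i* _).
      by rewrite -[refun _]/g1 (nder_derive1n ng1).
    by rewrite -[imfun _]/g2 (nder_derive1n ng2).
  have [Xs ns_] := X_cx Xs1 Xs2; split=> //; apply: (le_trans ns_).
  have hs0 : 0 <= h ^- s by rewrite invr_ge0 exprn_ge0// ltW.
  have hE : h ^- s = gamma ^- s * sigma ^+ s by rewrite /h expr_div_n invfM invrK.
  apply: (@le_trans _ _ (h ^- s * (K1 * bl_norm X D))).
    apply: (le_trans _ (ler_wpM2l hs0 (two _ _ (lexx _) (lexx _)))).
    by rewrite mulrDr; apply: lerD; rewrite mulrCA.
  rewrite hE; have -> : gamma ^- s * sigma ^+ s * (K1 * bl_norm X D) = K2 * (sigma ^+ s * bl_norm X D).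
    by rewrite /K2 /K1; move: (gamma ^- s) (sigma ^+ s) (bl_norm X D) => z1 z2 z3; ring.
  rewrite -mulrA; apply: ler_wpM2r; last lra.
  by rewrite mulr_ge0// exprn_ge0// ltW.
- have [Xa1 na1] := X_abs bv1 Xv1; have ba1 := borel_abs bv1.
  have [Xa2 na2] := X_abs bv2 Xv2; have ba2 := borel_abs bv2.
  have [XV nV] : X (ofreal (fun x => `|v1 x| + `|v2 x|)) /\
    nm (fun x => `|v1 x| + `|v2 x|) <= nm (fun x => `|v1 x|) + nm (fun x => `|v2 x|) := X_add Xa1 Xa2.
  have bV : borel (fun x => `|v1 x| + `|v2 x|) by exact: borelD.
  set V := (fun x => `|v1 x| + `|v2 x|) in XV nV bV.
  have gap' (k : int) : gamma / sigma <= xs (k + 1) - xs k <= gamma' / gamma * h.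
    have -> : gamma' / gamma * h = gamma' / sigma by rewrite /h; field; rewrite !gt_eqF.
    exact: gap.
  (* At a node f - g equals E plus terms of the Borel version only, by [id_minus_pow_raw]; these are
     the ones bounded in [component_bound]. *)
  have key (k : int) : absc ((f \- cx g1 g2) (xs k)) <= absc (E (xs k)) + (2 * C) * pmaxh h V (xs k).
    have q1 : pmaxh h v1 (xs k) <= pmaxh h V (xs k) by apply: (pmaxh_mono hA) => // y; rewrite /V lerDl.
    have q2 : pmaxh h v2 (xs k) <= pmaxh h V (xs k) by apply: (pmaxh_mono hA) => // y; rewrite /V lerDr.
    pose z := (u (xs k) - g1 (xs k) - iter r (IAh h) u (xs k)) +i* (v (xs k) - g2 (xs k) - iter r (IAh h) v (xs k)).
    have -> : (f \- cx g1 g2) (xs k) = E (xs k) + z.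
      rewrite /E (id_minus_pow_raw h r (xs k) ae) /z /cx /=; case: (f (xs k)) => z1 z2.
      by apply/eqP; rewrite eq_complex /=; apply/andP; split; apply/eqP; ring.
    apply: (le_trans (abscD _ _)); rewrite lerD2l; apply: (le_trans (absc_le _)).
    rewrite -mulrA mulr2n mulrDl mul1r; apply: lerD.
      by apply: (le_trans (H1 (xs k))); exact: ler_wpM2l.
    by apply: (le_trans (H2 (xs k))); exact: ler_wpM2l.
  have CC : 0 <= 2 * C by exact: mulr_ge0.
  have [XN nN] := MP xs (gamma / sigma) h E _ (2 * C) V h0 h0 gap' XE bV XV CC key.
  split=> //; apply: (le_trans nN).
  have nVD : nm V <= K1 * bl_norm X D.
    by apply: (le_trans nV); apply: two; [exact: le_trans na1 nv1|exact: le_trans na2 nv2].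
  have nE0 : 0 <= nm (node_step xs E) by exact: bl_norm_ge0.
  rewrite addrC mulrDr; apply: lerD.
    apply: (le_trans (ler_wpM2l CM0 nVD)); rewrite mulrA -/K3; apply: ler_wpM2r => //; lra.
  by rewrite ler_peMl//; lra.
Qed.

Lemma sampling_sum_add xs (phi : int -> R -> R[i]) f g n :
  sampling_sum xs phi (f \+ g) n = sampling_sum xs phi f n \+ sampling_sum xs phi g n.
Proof.
apply/funext => y; rewrite /sampling_sum /= -big_split /=.
by apply: eq_bigr => j _; rewrite mulrDl.
Qed.

Lemma X_sampling_sum xs (phi : int -> R -> R[i]) f n : (forall k, X (phi k)) ->
  X (sampling_sum xs phi f n).
Proof.
move=> Xphi; rewrite /sampling_sum; elim: (2 * n).+1 => [|m IH].
  have -> : (fun y => \sum_(j < 0) f (xs (j%:Z - n%:Z)) * phi (j%:Z - n%:Z) y) = (fun=> 0).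
    by apply/funext => y; rewrite big_ord0.
  exact: bl_zero.
have -> : (fun y => \sum_(j < m.+1) f (xs (j%:Z - n%:Z)) * phi (j%:Z - n%:Z) y) =
  (fun y => \sum_(j < m) f (xs (j%:Z - n%:Z)) * phi (j%:Z - n%:Z) y) \+
  (fun y => f (xs (m%:Z - n%:Z)) * phi (m%:Z - n%:Z) y).
  by apply/funext => y; rewrite big_ord_recr.
by apply: bl_add => //; exact: bl_scale.
Qed.

(** The sampling series determines G only up to functions of norm 0, so additivity holds in norm, as
    a limit of the exact additivity of the partial sums. *)
Lemma sampling_additive xs (phi : int -> R -> R[i]) (G : (R -> R[i]) -> R -> R[i]) f g :
  (forall k, X (phi k)) -> sampling_operator X xs phi G ->
  xs_space X xs f -> xs_space X xs g -> xs_space X xs (f \+ g) ->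
  bl_norm X ((G f \+ G g) \- G (f \+ g)) = 0.
Proof.
move=> Xphi GS sf sg sfg.
have [Xf lf] := GS _ sf; have [Xg lg] := GS _ sg; have [Xfg lfg] := GS _ sfg.
pose S (F : R -> R[i]) n := sampling_sum xs phi F n.
have XS (F : R -> R[i]) n : X (S F n) by exact: X_sampling_sum.
have XD : X ((G f \+ G g) \- G (f \+ g)).
  by have [] := X_minus (bl_add Xf Xg) Xfg.
apply/eqP; rewrite eq_le bl_norm_ge0// andbT.
have lim : bl_norm X (S (f \+ g) n \- G (f \+ g)) + (bl_norm X (S f n \- G f) + bl_norm X (S g n \- G g)) @[n --> \oo] --> (0 + (0 + 0) : R).
  by apply: cvgD => //; apply: cvgD.
rewrite !addr0 in lim; apply: (cvgr_to_ge lim); apply: nearW => n.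
have [X1 _] := X_minus (XS f n) Xf; have [X2 _] := X_minus (XS g n) Xg.
have [X3 _] := X_minus (XS (f \+ g) n) Xfg.
have -> : (G f \+ G g) \- G (f \+ g) = (S (f \+ g) n \- G (f \+ g)) \- ((S f n \- G f) \+ (S g n \- G g)).
  rewrite /S sampling_sum_add; apply/funext => y /=.
  move: (sampling_sum xs phi f n y) (sampling_sum xs phi g n y) (G f y) (G g y) (G _ y) => z1 z2 z3 z4 z5.
  by ring.
apply: (le_trans (X_minus X3 (bl_add X1 X2)).2); rewrite lerD2l.
exact: bl_norm_add.
Qed.

End Decomposition.

(** * The two error estimates for the sampling operators *)

Unset Implicit Arguments.
Set Strict Implicit.
Set Printing Implicit Defensive.

Theorem theorem4p1 (R : realType) (X : banach_lattice R) (r s : nat)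
    (Phi : R -> set (R -> R[i])) (phi : R -> int -> R -> R[i])
    (x : R -> int -> R) (G : R -> (R -> R[i]) -> R -> R[i])
    (gamma gamma' K1 K3 : R)
    (X_order_continuous : order_continuous X)
    (X_schwartz_dense : schwartz_dense X)
    (X_assumption_A : assumption_A X)
    (le_s_2r : (s <= 2 * r)%N)
    (Phi_spaces : approximation_spaces X s Phi)
    (gamma_gt0 : 0 < gamma) (gamma'_gt0 : 0 < gamma')
    (x_nodes : separated_nodes x gamma gamma')
    (phi_Phi : forall (sigma : R) (k : int), 1 <= sigma ->
      Phi sigma (phi sigma k))
    (G_sampling : forall sigma : R, 1 <= sigma ->
      sampling_operator X (x sigma) (phi sigma) (G sigma))
    (K1_gt0 : 0 < K1) (K3_gt0 : 0 < K3)
    (G_bounded : forall (sigma : R) (f : R -> R[i]), 1 <= sigma ->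
      xs_space X (x sigma) f ->
      (xnorm X (G sigma f) <= K1%:E * xsnorm X (x sigma) f)%E)
    (G_approx : forall (sigma : R) (g : R -> R[i]), 1 <= sigma ->
      bandlimited X sigma g ->
      (xnorm X (g \- G sigma g)%R
         <= (K3 * sigma ^- s)%:E * xnorm X (cderiv s g))%E) :
  (exists2 C : R, 0 < C &
    forall (sigma : R) (f : R -> R[i]), 1 <= sigma ->
      xs_space X (x sigma) f ->
      (xnorm X (f \- G sigma f)%R <=
        C%:E * (xnorm X (id_minus_pow (steklov_dot (gamma / sigma)) s f)
          + xsnorm X (x sigma)
              (id_minus_pow (steklov (gamma / sigma)) r f)))%E) /\
  ((forall (sigma : R) (f : R -> R[i]), 1 <= sigma ->
      xs_space X (x sigma) f -> bandlimited X sigma (G sigma f)) ->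
   exists2 C : R, 0 < C &
    forall (sigma : R) (f : R -> R[i]), 1 <= sigma ->
      xs_space X (x sigma) f ->
      (xsnorm X (x sigma) (f \- G sigma f)%R <=
        C%:E * (xnorm X (id_minus_pow (steklov_dot (gamma / sigma)) s f)
          + xsnorm X (x sigma)
              (id_minus_pow (steklov (gamma / sigma)) r f)))%E).
Proof.
have [C C0 CP] := decomposition X_assumption_A gamma_gt0 gamma'_gt0 le_s_2r.
have [B B0 BP] := bandlimited_node_bound X_assumption_A gamma'_gt0.
have phiX sigma (k : int) : 1 <= sigma -> X (phi sigma k).
  move=> s1; have [_ H _ _ _] := Phi_spaces.
  by apply: (H sigma _ _ (phi_Phi sigma k s1)); lra.
have main (sigma : R) (f : R -> R[i]) : 1 <= sigma -> xs_space X (x sigma) f ->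
    let D := id_minus_pow (steklov_dot (gamma / sigma)) s f in
    let E := id_minus_pow (steklov (gamma / sigma)) r f in
    X D -> X (ofreal (node_step (x sigma) E)) ->
    exists g, [/\ bandlimited X sigma g, X (f \- G sigma f),
      X (g \- G sigma f), X (f \- g) &
      [/\ bl_norm X (f \- g) <= C * (bl_norm X D + bl_norm X (ofreal (node_step (x sigma) E))),
       bl_norm X (f \- G sigma f) <= (C + K1 * C + K3 * C) * (bl_norm X D + bl_norm X (ofreal (node_step (x sigma) E))),
       X (ofreal (node_step (x sigma) (f \- g))) &
       bl_norm X (ofreal (node_step (x sigma) (f \- g))) <= C * (bl_norm X D + bl_norm X (ofreal (node_step (x sigma) E)))]].
  move=> s1 sf D E XD XE; have gap (k : int) := x_nodes sigma k s1.
  have s0 : 0 < sigma by lra.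
  have ga0 : 0 < gamma / sigma by exact: divr_gt0.
  have Xf : X f by case: sf.
  have [Xns _] := xsnorm_fin sf.2.
  have [g [bg nfg [Xd nd] [Xe ne]]] := CP sigma (x sigma) f s1 gap Xf XD XE.
  set N := bl_norm X D + _ in ne *.
  have D0 : 0 <= bl_norm X D by exact: bl_norm_ge0.
  have E0 : 0 <= bl_norm X (ofreal (node_step (x sigma) E)) by exact: bl_norm_ge0.
  have DN : bl_norm X D <= N by rewrite /N lerDl.
  have Xg : X g by case: bg.
  have [Xfg _] := X_minus Xf Xg.
  have Efg : f = (f \- g) \+ g by apply/funext => y /=; rewrite subrK.
  have s_fg : xs_space X (x sigma) (f \- g).
    by split=> //; rewrite (xsnorm_in Xe) ltry.
  (* The node norm of g is finite because g = f - (f - g); hence f, g and f - g may all be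
     sampled. *)
  have s_g : xs_space X (x sigma) g.
    split=> //; have Egf : g = f \+ (fun y => - (f \- g) y).
      by apply/funext => y /=; rewrite subKr.
    have Xo' : X (ofreal (node_step (x sigma) (fun y => - (f \- g) y))).
      by rewrite (node_step_opp ga0 gap).
    have [Xo _] := node_step_add ga0 gap Xns Xo'.
    by rewrite -Egf in Xo; rewrite (xsnorm_in Xo) ltry.
  have [XGf _] := G_sampling sigma s1 f sf.
  have [XGe _] := G_sampling sigma s1 _ s_fg.
  have [XGg _] := G_sampling sigma s1 g s_g.
  (* [G sigma f] is replaced by [G sigma (f \- g) \+ G sigma g] at the cost of a function of norm
     0. *)
  have add : bl_norm X ((G sigma (f \- g) \+ G sigma g) \- G sigma f) = 0.
    rewrite [in G sigma f]Efg; apply: (sampling_additive (fun k => phiX sigma k s1) (G_sampling sigma s1)) => //.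
    by rewrite -Efg.
  have nGe : bl_norm X (G sigma (f \- g)) <= K1 * (C * N).
    have := G_bounded sigma _ s1 s_fg.
    rewrite (xnorm_in XGe) (xsnorm_in Xe) -EFinM lee_fin => H; apply: (le_trans H).
    by apply: ler_wpM2l => //; exact: ltW.
  have [XgG _] := X_minus Xg XGg.
  have ngG : bl_norm X (g \- G sigma g) <= K3 * (C * N).
    have := G_approx sigma g s1 bg.
    rewrite (xnorm_in XgG) (xnorm_in Xd) -EFinM lee_fin => H; apply: (le_trans H).
    have sn : 0 <= sigma ^- s by rewrite invr_ge0 exprn_ge0// ltW.
    have sne : sigma ^+ s != 0 by rewrite expf_neq0// gt_eqF.
    rewrite -mulrA; apply: ler_wpM2l; first exact: ltW.
    apply: (le_trans (ler_wpM2l sn nd)).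
    have -> : sigma ^- s * (C * sigma ^+ s * bl_norm X D) = C * bl_norm X D.
      by move: (bl_norm X D) => z; field.
    exact: ler_wpM2l.
  have nfg' : bl_norm X (f \- g) <= C * N.
    by apply: (le_trans nfg); exact: ler_wpM2l.
  have [XfG _] := X_minus Xf XGf; have [XgGf _] := X_minus Xg XGf.
  exists g; split=> //; split=> //.
  have Xsum := (X_minus (bl_add XGe XGg) XGf).1.
  have E1 : f \- G sigma f = ((f \- g) \- G sigma (f \- g)) \+ ((g \- G sigma g) \+ ((G sigma (f \- g) \+ G sigma g) \- G sigma f)).
    apply/funext => y /=; move: (f y) (g y) (G sigma f y) (G sigma g y) (G sigma _ y) => a1 a2 a3 a4 a5; ring.
  have [X1 n1] := X_minus Xfg XGe; have X2 := bl_add XgG Xsum.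
  rewrite E1; apply: (le_trans (bl_norm_add X1 X2)).
  apply: (le_trans (lerD n1 (bl_norm_add XgG Xsum))); rewrite add addr0.
  rewrite !mulrDl -!mulrA; apply: lerD => //; exact: lerD.
have K10 := ltW K1_gt0; have K30 := ltW K3_gt0.
pose Z := C + K1 * C + K3 * C + 1.
have Z0 : 0 <= C + K1 * C + K3 * C by rewrite !addr_ge0// mulr_ge0.
(* If one of the two norms on the right is infinite, so is the right-hand side because c > 0;
   otherwise everything is real. *)
have reduce (c : R) (P : \bar R) (sigma : R) (f : R -> R[i]) : 0 < c ->
    (X (id_minus_pow (steklov_dot (gamma / sigma)) s f) ->
     X (ofreal (node_step (x sigma) (id_minus_pow (steklov (gamma / sigma)) r f))) ->
     (P <= (c * (bl_norm X (id_minus_pow (steklov_dot (gamma / sigma)) s f) +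
        bl_norm X (ofreal (node_step (x sigma) (id_minus_pow (steklov (gamma / sigma)) r f)))))%:E)%E) ->
    (P <= c%:E * (xnorm X (id_minus_pow (steklov_dot (gamma / sigma)) s f) +
       xsnorm X (x sigma) (id_minus_pow (steklov (gamma / sigma)) r f)))%E.
  move=> c0 H; rewrite /xsnorm /xnorm; case: asboolP => h1; last first.
    by rewrite addye ?gt0_muley ?leey ?lte_fin//; case: ifP.
  case: asboolP => h2; last by rewrite addey// gt0_muley ?leey ?lte_fin.
  by rewrite -EFinD -EFinM; exact: H.
split.
  exists Z => [|sigma f s1 sf]; first by rewrite /Z ltr_wpDl.
  apply: reduce => [|h1 h2]; first by rewrite /Z ltr_wpDl.
  have [g [_ XfG _ _ [_ n _ _]]] := main sigma f s1 sf h1 h2.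
  rewrite (xnorm_in XfG) lee_fin; apply: (le_trans n); apply: ler_wpM2r; last by rewrite /Z lerDl.
  by rewrite addr_ge0// bl_norm_ge0.
(* In f - G f = (f - g) + (g - G f) the first term costs [C]. The second one is band-limited and
   costs [B] times its norm in X, which is estimated from g - G f = (f - G f) - (f - g). The summand
   1 ensures positivity. *)
move=> GB; pose Y := C + B * (C + (C + K1 * C + K3 * C)) + 1.
have Y0 : 0 < Y by rewrite /Y ltr_wpDl// addr_ge0// mulr_ge0// addr_ge0.
exists Y => // sigma f s1 sf; apply: reduce => // h1 h2.
have s0 : 0 < sigma by lra.
have ga0 : 0 < gamma / sigma by exact: divr_gt0.
have gap (k : int) := x_nodes sigma k s1.
have [g [bg XfG XgG Xfg [n1 n2 Xn n3]]] := main sigma f s1 sf h1 h2.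
set N := bl_norm X _ + _ in n1 n2 n3 *.
have N0 : 0 <= N by rewrite /N addr_ge0// bl_norm_ge0.
have bp := bandlimited_sub X_assumption_A bg (GB sigma f s1 sf).
have [Xp np] := BP sigma (x sigma) (gamma / sigma) _ s1 ga0 gap bp.
have E : f \- G sigma f = (f \- g) \+ (g \- G sigma f).
  by apply/funext => y /=; rewrite addrA subrK.
have [Xs ns] := node_step_add ga0 gap Xn Xp.
rewrite -E in Xs ns; rewrite (xsnorm_in Xs) lee_fin.
have ngG : bl_norm X (g \- G sigma f) <= C * N + (C + K1 * C + K3 * C) * N.
  have E2 : g \- G sigma f = (f \- G sigma f) \- (f \- g).
    by apply/funext => y /=; rewrite opprB [RHS]addrC addrA subrK.
  rewrite E2 addrC; apply: (le_trans (X_minus XfG Xfg).2); exact: lerD.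
apply: (le_trans ns); apply: (le_trans (lerD n3 (le_trans np (ler_wpM2l B0 ngG)))).
by rewrite -mulrDl mulrA -mulrDl; apply: ler_wpM2r => //; rewrite /Y lerDl.
Qed.
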